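(* Let $X$ be a pointed metric space. The following are equivalent. (i) $(\mathrm{Lip}_0(X),\tau_\gamma)$ has the approximation property. (ii) $\mathcal{F}(X)$ has the approximation property. (iii) $\mathrm{Lip}_0(X)\otimes F$ is dense in $(\mathrm{Lip}_0(X),\tau_\gamma)\,\epsilon\, F$ for every Banach space $F$. (iv) $\mathrm{Lip}_{0F}(X,F)$ is dense in $(\mathrm{Lip}_0(X,F),\gamma\tau_\gamma)$ for every Banach space $F$.
   Context: $\mathbb{K}$ is $\mathbb{R}$ or $\mathbb{C}$, the scalar field of all spaces. $(X,d)$ is a metric space with a distinguished base point $0$. For a Banach space $F$, $\mathrm{Lip}_0(X,F)$ is the Banach space of all Lipschitz maps $f\colon X\to F$ with $f(0)=0$, with norm $\mathrm{Lip}(f)=\sup\{\|f(x)-f(y)\|/d(x,y)\colon x,y\in X,\ x\ne y\}$; $\mathrm{Lip}_0(X)=\mathrm{Lip}_0(X,\mathbb{K})$, with closed unit ball $B_{\mathrm{Lip}_0(X)}$. $\mathrm{Lip}_{0F}(X,F)$ is the vector space of all $f\in\mathrm{Lip}_0(X,F)$ such that the linear hull of $f(X)$ is finite-dimensional (Lipschitz finite-rank operators). $\mathcal{F}(X)$ (the Lipschitz-free space) is the norm-closed linear hull in the Banach dual $\mathrm{Lip}_0(X)'$ of the functionals $\delta_x\colon f\mapsto f(x)$, $x\in X$. $\tau_0$ is the compact-open topology on $\mathrm{Lip}_0(X)$ (uniform convergence on compact subsets of $X$). $\tau_\gamma$ is the mixed topology $\gamma[\mathrm{Lip},\tau_0]$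 on $\mathrm{Lip}_0(X)$: the locally convex topology having as a base of neighborhoods of zero the sets $\gamma(U)=\bigcup_{n=1}^\infty\left(U_1\cap B_{\mathrm{Lip}_0(X)}+U_2\cap 2B_{\mathrm{Lip}_0(X)}+\cdots+U_n\cap 2^{n-1}B_{\mathrm{Lip}_0(X)}\right)$, where $U=\{U_n\}$ ranges over sequences of convex balanced $\tau_0$-neighborhoods of zero. Let $\widetilde X=\{(x,y)\in X^2\colon x\ne y\}$. The topology $\gamma\tau_\gamma$ on $\mathrm{Lip}_0(X,F)$ is the locally convex topology generated by the seminorms $q(f)=\sup_{n}\alpha_n\frac{\|f(x_n)-f(y_n)\|}{d(x_n,y_n)}$, where $\{\alpha_n\}$ ranges over sequences in $\mathbb{R}^+$ tending to zero and $\{(x_n,y_n)\}$ over sequences in $\widetilde X$. For locally convex Hausdorff spaces $E,F$: $\mathcal{L}(E;F)$ is the space of continuous linear maps; $\mathcal{L}_c(E;F)$ is $\mathcal{L}(E;F)$ with the topology of uniform convergence on convex balanced compact subsets of $E$; $E'=\mathcal{L}(E;\mathbb{K})$ and $E'_c=\mathcal{L}_c(E;\mathbb{K})$. $E'\otimes F$ is identified with the finite-rank maps in $\mathcal{L}(E;F)$. $E$ has the approximation property if the identity map on $E$ lies in the closure of $E'\otimes E$ in $\mathcal{L}_c(E;E)$ (for Banach spaces this is the usual approximation property). The $\epsilon$-product $E\,\epsilon\,F$ is the space $\mathcal{L}(F'_c;E)$ with the topology of uniform convergence on equicontinuous subsets of $F'$ (norm bounded subsets of $F'$ when $F$ is normed).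 $E\otimes F$ is regarded as a subspace of $E\,\epsilon\,F$ by identifying $\sum_j e_j\otimes u_j$ with the map $\psi\mapsto\sum_j\psi(u_j)e_j$. *)

(* Defs.v *)
From HB Require Import structures.
From mathcomp Require Import all_boot all_order all_algebra complex.
From mathcomp Require Import all_classical all_reals all_analysis.
From mathcomp Require Import ring.

Set Implicit Arguments.
Unset Strict Implicit.
Unset Printing Implicit Defensive.

Import Order.TTheory GRing.Theory Num.Theory.
Import numFieldNormedType.Exports.

Local Open Scope classical_set_scope.
Local Open Scope ring_scope.

(** The statement is for real and for complex scalars, over a real metric
    space; [of_real] and [real_of] mediate between [R] and the scalar field. *)
Variant scalar_kind := RealScalars | ComplexScalars.

Definition scalar_field (R : realType) (k : scalar_kind) : numFieldType :=
  match k with RealScalars => R | ComplexScalars => R[i] end.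

Definition of_real (R : realType) (k : scalar_kind) : R -> scalar_field R k :=
  match k with RealScalars => id | ComplexScalars => real_complex R end.

Definition real_of (R : realType) (k : scalar_kind) : scalar_field R k -> R :=
  match k with RealScalars => id | ComplexScalars => @complex.Re R end.

Section scalar_theory.
Context (R : realType) (k : scalar_kind).
Local Notation K := (scalar_field R k).

Lemma of_realD (x y : R) : of_real k (x + y) = of_real k x + of_real k y.
Proof. by case: k => //=; rewrite rmorphD. Qed.

Lemma of_realM (x y : R) : of_real k (x * y) = of_real k x * of_real k y.
Proof. by case: k => //=; rewrite rmorphM. Qed.

Lemma of_real0 : of_real k 0 = 0 :> scalar_field R k.
Proof. by case: k. Qed.

Lemma of_realK (x : R) : real_of (of_real k x) = x.
Proof. by case: k. Qed.

Lemma real_ofK (x : K) : 0 <= x -> of_real k (real_of x) = x.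
Proof.
case: k x => //= -[a b]; rewrite lecE /= => /andP[/eqP -> _].
by [].
Qed.

Lemma ler_of_real (x y : R) : (of_real k x <= of_real k y) = (x <= y).
Proof. by case: k => //=; rewrite lecR. Qed.

Lemma ltr_of_real (x y : R) : (of_real k x < of_real k y) = (x < y).
Proof. by case: k => //=; rewrite ltcR. Qed.

Lemma of_real1 : of_real k 1 = 1 :> scalar_field R k.
Proof. by case: k. Qed.

Lemma real_of_gt0 (x : K) : 0 < x -> 0 < real_of x.
Proof. by move=> x0; rewrite -ltr_of_real of_real0 real_ofK// ltW. Qed.

End scalar_theory.

(** The norm of a normed space over [scalar_field R k] takes its values in
    [scalar_field R k]; [rnorm] is the same norm with values in [R]. *)
Definition rnorm (R : realType) (k : scalar_kind)
  (V : normedModType (scalar_field R k)) (v : V) : R := real_of `|v|.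

Section rnorm_theory.
Context (R : realType) (k : scalar_kind).
Local Notation K := (scalar_field R k).

Lemma of_real_rnorm (V : normedModType K) (v : V) : of_real k (rnorm v) = `|v|.
Proof. by rewrite real_ofK. Qed.

Lemma rnorm_ge0 (V : normedModType K) (v : V) : 0 <= rnorm v.
Proof. by rewrite -(ler_of_real k) of_real0 of_real_rnorm. Qed.

Lemma ler_rnorm (V W : normedModType K) (v : V) (w : W) :
  (rnorm v <= rnorm w) = (`|v| <= `|w|).
Proof. by rewrite -(ler_of_real k) !of_real_rnorm. Qed.

Lemma rnormD (V : normedModType K) (v w : V) :
  rnorm (v + w) <= rnorm v + rnorm w.
Proof. by rewrite -(ler_of_real k) of_realD !of_real_rnorm ler_normD. Qed.

Lemma rnormZ (V : normedModType K) (a : K) (v : V) :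
  rnorm (a *: v) = rnorm (a : K^o) * rnorm v.
Proof.
by apply: (can_inj (@of_realK R k)); rewrite of_realM !of_real_rnorm normrZ.
Qed.

Lemma rnorm0_eq0 (V : normedModType K) (v : V) : rnorm v = 0 -> v = 0.
Proof.
by move=> v0; apply/normr0_eq0; rewrite -of_real_rnorm v0 of_real0.
Qed.

Lemma rnorm0 (V : normedModType K) : rnorm (0 : V) = 0.
Proof. by apply: (can_inj (@of_realK R k)); rewrite of_real_rnorm of_real0 normr0. Qed.

End rnorm_theory.

Definition balanced (K : numFieldType) (V : lmodType K) (A : set V) :=
  forall (a : K) v, `|a| <= 1 -> A v -> A (a *: v).

Definition abs_convex (K : numFieldType) (V : lmodType K) (A : set V) :=
  convex_set A /\ balanced A.

Record lc_base (K : numFieldType) (V : lmodType K) := LCBase {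
  lc_sets : set_system V;
  lc_inhabited : lc_sets !=set0;
  lc_directed : forall A B, lc_sets A -> lc_sets B ->
    exists2 C, lc_sets C & C `<=` A `&` B;
  lc_abs_convex : forall A, lc_sets A -> abs_convex A;
  lc_absorbing : forall A v, lc_sets A -> exists2 e : K, 0 < e & A (e *: v);
  lc_scale : forall (a : K) A, lc_sets A ->
    exists2 B, lc_sets B & forall v, B v -> A (a *: v)
}.

(** [lcs B] is the space [V] with the vector space topology whose
    neighbourhoods of zero are the supersets of the members of [B]. *)
Definition lcs (K : numFieldType) (V : lmodType K) (B : lc_base V) : Type := V.

Section lcs.
Context (K : numFieldType) (V : lmodType K) (B : lc_base V).
Local Notation E := (lcs B).

HB.instance Definition _ := GRing.Lmodule.on E.

Definition lcs_entourage : set_system (E * E) :=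
  filter_from (lc_sets B) (fun W => [set uv | W (uv.1 - uv.2)]).

Lemma abs_convex_comb (A : set V) (a b : K) u v :
  abs_convex A -> `|a| + `|b| <= 1 -> A u -> A v -> A (a *: u + b *: v).
Proof.
move=> [cA bA] ab Au Av.
have [b0|b0] := eqVneq b 0.
  rewrite b0 scale0r addr0; apply: bA => //.
  by rewrite b0 normr0 addr0 in ab.
have [a0|a0] := eqVneq a 0.
  rewrite a0 scale0r add0r; apply: bA => //.
  by rewrite a0 normr0 add0r in ab.
have na : 0 < `|a| by rewrite normr_gt0.
have nb : 0 < `|b| by rewrite normr_gt0.
pose s : K := `|a| + `|b|.
have s0 : 0 < s by rewrite addr_gt0.
have l0 : (0 <= `|a| / s)%R by rewrite divr_ge0// ltW.
have l1 : (`|a| / s <= 1)%R by rewrite ler_pdivrMr// mul1r lerDl ltW.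
have := cA ((s * (a / `|a|)) *: u) ((s * (b / `|b|)) *: v) (Itv01 l0 l1).
have ss : `|s| <= 1 by rewrite gtr0_norm.
have Au' : A ((s * (a / `|a|)) *: u).
  apply: bA => //; rewrite !normrM normfV normr_id divff ?mulr1//.
  exact: lt0r_neq0.
have Av' : A ((s * (b / `|b|)) *: v).
  apply: bA => //; rewrite !normrM normfV normr_id divff ?mulr1//.
  exact: lt0r_neq0.
move=> /(_ (mem_set Au') (mem_set Av')).
rewrite /conv/=.
have sn : s != 0 by exact: lt0r_neq0.
have nan : `|a| != 0 by exact: lt0r_neq0.
have nbn : `|b| != 0 by exact: lt0r_neq0.
rewrite !scalerA.
have -> : `|a| / s * (s * (a / `|a|)) = a by field; apply/andP.
suff -> : unstable.onem (`|a| / s) * (s * (b / `|b|)) = b by rewrite inE.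
rewrite /unstable.onem; have -> : 1 - `|a| / s = `|b| / s.
  by rewrite -{1}(divff sn) -mulrBl /s addrAC subrr add0r.
by field; apply/andP.
Qed.

Lemma lc_abs_convex0 (A : set V) : lc_sets B A -> A 0.
Proof.
move=> BA; have [e _ Ae] := lc_absorbing 0 BA.
by have := (lc_abs_convex BA).2 0 _ _ Ae; rewrite scale0r normr0; apply.
Qed.

Lemma lcs_entourage_filter : Filter lcs_entourage.
Proof.
apply: filter_from_filter; first by have [A BA] := lc_inhabited B; exists A.
move=> A C BA BC; have [D BD DAC] := lc_directed BA BC.
by exists D => // uv /DAC.
Qed.

Lemma lcs_entourage_diagonal A : lcs_entourage A -> diagonal `<=` A.
Proof.
move=> [W BW WA] [u v] /diagonalP ->; apply: WA => /=.
by rewrite subrr; exact: lc_abs_convex0.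
Qed.

Lemma lcs_entourage_inv A : lcs_entourage A -> lcs_entourage A^-1%relation.
Proof.
move=> [W BW WA]; exists W => // -[u v] /= Wuv; apply: WA => /=.
rewrite -opprB -scaleN1r; apply: (lc_abs_convex BW).2 => //.
by rewrite normrN1.
Qed.

Lemma lc_add (A : set V) : lc_sets B A ->
  exists2 C, lc_sets B C & forall u v, C u -> C v -> A (u + v).
Proof.
move=> BA; have [C BC CA] := lc_scale 2 BA; exists C => // u v Cu Cv.
have -> : u + v = 2^-1 *: (2 *: u) + 2^-1 *: (2 *: v).
  by rewrite !scalerA mulVf ?pnatr_eq0// !scale1r.
apply: abs_convex_comb; [exact: (lc_abs_convex BA)| |exact: CA|exact: CA].
rewrite ger0_norm ?invr_ge0//.
by have -> : 2^-1 + 2^-1 = 1 :> K by field.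
Qed.

Lemma lcs_entourage_split A : lcs_entourage A ->
  exists2 C, lcs_entourage C & (C \; C)%relation `<=` A.
Proof.
move=> [W BW WA]; have [U BU UW] := lc_add BW.
exists [set uv | U (uv.1 - uv.2)]; first by exists U.
move=> [u v] [w /= Uuw Uwv]; apply: WA => /=.
by have := UW _ _ Uuw Uwv; rewrite addrA subrK.
Qed.

HB.instance Definition _ := isUniform.Build E lcs_entourage_filter
  lcs_entourage_diagonal lcs_entourage_inv lcs_entourage_split.

Lemma lcs_nbhsP (u : E) (A : set E) :
  nbhs u A <-> exists2 W, lc_sets B W & forall w, W w -> A (u + w).
Proof.
rewrite -nbhs_entourageE; split=> [[P [W BW WP] PA]|[W BW WA]].
  exists W => // w Ww; apply/PA/xsectionP/WP => /=.
  rewrite opprD addrA subrr add0r -scaleN1r.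
  by apply: (lc_abs_convex BW).2 => //; rewrite normrN1.
exists [set uv | W (uv.1 - uv.2)]; first by exists W.
move=> v /xsectionP /= Wuv.
have := WA (v - u); rewrite [u + _]addrC subrK; apply.
rewrite -opprB -scaleN1r.
by apply: (lc_abs_convex BW).2 => //; rewrite normrN1.
Qed.

Lemma lcs_add_continuous : continuous (fun x : E * E => x.1 + x.2).
Proof.
move=> [u v] A /lcs_nbhsP[W BW WA].
have [U BU UW] := lc_add BW.
exists ([set x | U (x - u)], [set x | U (x - v)]).
  by split; apply/lcs_nbhsP; exists U => // w Uw; rewrite /= addrC addKr.
move=> [x y] /= [Ux Uy].
have := WA _ (UW _ _ Ux Uy); congr A.
by rewrite addrACA ![_ + (_ - _)]addrC !subrK.
Qed.

Lemma lcs_scale_continuous : continuous (fun z : K^o * E => z.1 *: z.2).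
Proof.
move=> [a u'] A /lcs_nbhsP[W BW WA].
pose u : V := u'.
have [U BU UW] := lc_add BW.
have [e e0 Ue] := lc_absorbing u BU.
have [C BC CU] := lc_scale (`|a| + e) BU.
exists (ball a e, [set x | C (x - u)]).
  split; first exact: nbhsx_ballx.
  by apply/lcs_nbhsP; exists C => // w Cw; rewrite /= addrC addKr.
move=> [b x'] /=; pose x : V := x'; move=> [ab Cx].
have aeb : `|b| <= `|a| + e.
  rewrite -(subrK a b) addrC (le_trans (ler_normD _ _))// lerD2l distrC.
  by move: ab; rewrite -ball_normE /= => /ltW.
have ae0 : 0 < `|a| + e by rewrite ltr_wpDl.
have U1 : U (b *: (x - u)).
  have := (lc_abs_convex BU).2 (b / (`|a| + e)) _ _ (CU _ Cx).
  rewrite scalerA divfK ?gt_eqF//; apply.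
  by rewrite normrM normfV (gtr0_norm ae0) ler_pdivrMr ?mul1r.
have U2 : U ((b - a) *: u).
  have := (lc_abs_convex BU).2 ((b - a) / e) _ _ Ue.
  rewrite scalerA divfK ?gt_eqF//; apply.
  rewrite normrM normfV (gtr0_norm e0) ler_pdivrMr ?mul1r// distrC.
  by move: ab; rewrite -ball_normE /= => /ltW.
have := WA _ (UW _ _ U1 U2); congr A.
rewrite -[RHS]/(b *: x) -[LHS]/(a *: u + (b *: (x - u) + (b - a) *: u)).
have addK3 (p q r : V) : p + (q - r + (r - p)) = q.
  by rewrite [X in p + X]addrA subrK addrCA subrr addr0.
by rewrite scalerBr scalerBl addK3.
Qed.

Lemma lcs_locally_convex : exists2 D : set_system E,
  (forall A, A \in D -> convex_set A) & basis D.
Proof.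
exists [set A | open A /\ convex_set A].
  by move=> A; rewrite inE => -[].
split; first by move=> A [].
move=> u A /= /lcs_nbhsP[W BW WA].
pose C : set E := [set v | W (v - u)].
have cC : convex_set C.
  move=> x y l; rewrite !inE => Cx Cy; rewrite /C /=.
  have := (lc_abs_convex BW).1 _ _ l (mem_set Cx) (mem_set Cy).
  rewrite inE; congr W; rewrite /conv /= !scalerBr addrACA -opprD; congr (_ - _).
  by rewrite -scalerDl addrC /unstable.onem subrK scale1r.
exists (interior C).
  split; first split.
- exact: open_interior.
- move=> x y l; rewrite !inE => /lcs_nbhsP[W1 BW1 W1C] /lcs_nbhsP[W2 BW2 W2C].
  have [W3 BW3 W312] := lc_directed BW1 BW2.
  apply/lcs_nbhsP; exists W3 => // w W3w.
  have [/W1C C1 /W2C C2] := W312 _ W3w.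
  have := cC _ _ l (mem_set C1) (mem_set C2); rewrite inE.
  congr C; rewrite /conv /= !scalerDr addrACA; congr (_ + _).
  by rewrite -scalerDl addrC /unstable.onem subrK scale1r.
- by apply/lcs_nbhsP; exists W => // w Ww; rewrite /C /= addrC addKr.
- move=> v /interior_subset Cv; rewrite -(subrK u v) [_ + u]addrC; exact: WA.
Qed.

HB.instance Definition _ :=
  PreTopologicalNmodule_isTopologicalNmodule.Build E lcs_add_continuous.
HB.instance Definition _ :=
  TopologicalNmodule_isTopologicalLmodule.Build K E lcs_scale_continuous.
HB.instance Definition _ := Uniform_isTvs.Build K E lcs_locally_convex.

End lcs.

Definition seminorm (R : realType) (k : scalar_kind)
    (V : lmodType (scalar_field R k)) (p : V -> R) :=
  (forall u v, p (u + v) <= p u + p v) /\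
  (forall (a : scalar_field R k) v, p (a *: v) = rnorm (a : (scalar_field R k)^o) * p v).

Section seminorm_theory.
Context (R : realType) (k : scalar_kind).
Local Notation K := (scalar_field R k).
Context (V : lmodType K).

Lemma seminorm0 (p : V -> R) : seminorm p -> p 0 = 0.
Proof. by move=> [_ pZ]; rewrite -(scale0r 0) pZ rnorm0 mul0r. Qed.

Lemma rnormN1 : rnorm (- 1 : K^o) = 1.
Proof.
apply: (can_inj (@of_realK R k)); rewrite of_real_rnorm normrN1.
by case: k.
Qed.

Lemma seminorm_ge0 (p : V -> R) v : seminorm p -> 0 <= p v.
Proof.
move=> sp; have := sp.1 v ((-1) *: v).
rewrite scaleN1r subrr (seminorm0 sp) -scaleN1r sp.2 rnormN1 mul1r.
by rewrite -mulr2n pmulrn_lge0.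
Qed.

Lemma sup_seminorm (I : Type) (D : set I) (g : I -> V -> R) :
  (forall i, D i -> seminorm (g i)) ->
  (forall v, has_ubound [set g i v | i in D]) ->
  seminorm (fun v => sup [set g i v | i in D]).
Proof.
move=> sg bg.
have [D0|/set0P D0] := eqVneq D set0.
  by split=> [u v|a v]; rewrite D0 !image_set0 sup0 ?addr0 ?mulr0.
have ne v : [set g i v | i in D] !=set0.
  by have [i Di] := D0; exists (g i v); exists i.
have ub v i : D i -> g i v <= sup [set g i v | i in D].
  by move=> Di; apply: ub_le_sup => //; exists i.
have le a v : sup [set g i (a *: v) | i in D] <=
              rnorm (a : K^o) * sup [set g i v | i in D].
  apply: ge_sup => // _ [i Di <-]; rewrite (sg i Di).2.
  by rewrite ler_wpM2l ?rnorm_ge0 ?ub.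
split=> [u v|a v].
  apply: ge_sup => // _ [i Di <-].
  by rewrite (le_trans ((sg i Di).1 _ _))// lerD ?ub.
apply/eqP; rewrite eq_le le /=.
have [->|a0] := eqVneq a 0.
  rewrite rnorm0 mul0r scale0r.
  have [i Di] := D0; rewrite -(seminorm0 (sg i Di)); exact: ub.
have na : 0 < rnorm (a : K^o).
  by rewrite lt_neqAle rnorm_ge0 andbT eq_sym; apply: contra_neq a0 => /rnorm0_eq0.
rewrite mulrC -ler_pdivlMr// mulrC.
have -> : (rnorm (a : K^o))^-1 = rnorm (a^-1 : K^o).
  apply: (mulfI (lt0r_neq0 na)); rewrite divff ?lt0r_neq0//.
  by rewrite -rnormZ /GRing.scale/= divff// -rnormN1 -scaleN1r rnormZ rnormN1 mul1r.
by have := le a^-1 (a *: v); rewrite scalerA mulVf// scale1r.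
Qed.

Lemma seminorm_le_inv (p : V -> R) (e : R) v : seminorm p -> 0 < e ->
  exists2 d : R, 0 < d & p (of_real k d *: v) < e.
Proof.
move=> sp e0.
have pv0 := seminorm_ge0 v sp.
have pv1 : 0 < p v + 1 by rewrite ltr_wpDl.
pose d := e / (p v + 1).
have d0 : 0 < d by rewrite divr_gt0.
have dK : 0 < of_real k d by rewrite -of_real0 ltr_of_real.
exists d => //.
rewrite sp.2 /rnorm gtr0_norm// of_realK /d mulrAC ltr_pdivrMr// ltr_pM2l//.
by rewrite ltrDl.
Qed.

Context (P : set (V -> R)).

Definition seminorm_sets : set_system V :=
  [set A | exists (s : seq (V -> R)) (e : R),
    [/\ [set` s] `<=` P, 0 < e & A = [set v | forall p, p \in s -> p v < e]]].

Context (sP : forall p, P p -> seminorm p).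

Lemma seminorm_inhabited : seminorm_sets !=set0.
Proof. by exists setT, [::], 1; split => //; apply/seteqP; split. Qed.

Lemma seminorm_directed A B : seminorm_sets A -> seminorm_sets B ->
  exists2 C, seminorm_sets C & C `<=` A `&` B.
Proof.
move=> [s [e [sP1 e0 ->]]] [t [d [tP d0 ->]]].
exists [set v | forall p, p \in s ++ t -> p v < Num.min e d].
  exists (s ++ t), (Num.min e d); split => //; last by rewrite lt_min e0.
  by move=> p /=; rewrite mem_cat => /orP[/sP1|/tP].
move=> v /= H; split=> p ps; have := H p; rewrite mem_cat ps ?orbT lt_min.
  by move=> /(_ isT)/andP[].
by move=> /(_ isT)/andP[].
Qed.

Lemma seminorm_abs_convex A : seminorm_sets A -> abs_convex A.
Proof.
move=> [s [e [sP1 e0 ->]]]; split.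
  apply/convex_setW => u v; rewrite !inE => ue ve l l0 l1; rewrite inE => p ps.
  rewrite /conv /=; have [pD pZ] := sP (sP1 _ ps).
  have rp (a : K) : 0 < a -> exists2 r : R, a = of_real k r & 0 < r.
    by move=> a0; exists (real_of a); rewrite ?real_of_gt0// real_ofK// ltW.
  have [r lr r0] := rp _ l0.
  have [t lt t0] : exists2 t : R, 1 - l%:num = of_real k t & 0 < t.
    by apply: rp; rewrite subr_gt0.
  have rt : r + t = 1.
    apply: (can_inj (@of_realK R k)); by rewrite of_realD -lr -lt addrC subrK of_real1.
  rewrite (le_lt_trans (pD _ _))// !pZ.
  have -> : rnorm (l%:num : K^o) = r by rewrite /rnorm gtr0_norm// lr of_realK.
  have -> : rnorm (unstable.onem l%:num : K^o) = t.
    by rewrite /rnorm gtr0_norm ?subr_gt0// /unstable.onem lt of_realK.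
  rewrite -[e]mul1r -rt mulrDl ltrD// ltr_pM2l//; [exact: ue|exact: ve].
move=> a v a1 ve p ps; have sp := sP (sP1 _ ps).
rewrite sp.2 (le_lt_trans _ (ve p ps))// ler_piMl ?seminorm_ge0//.
by rewrite -(ler_of_real k) of_real_rnorm of_real1.
Qed.

Lemma seminorm_absorbing A v : seminorm_sets A -> exists2 e : K, 0 < e & A (e *: v).
Proof.
move=> [s [e [sP1 e0 ->]]].
suff [d d0 dv] : exists2 d : R, 0 < d &
    forall p, p \in s -> p (of_real k d *: v) < e.
  by exists (of_real k d) => //; rewrite -of_real0 ltr_of_real.
elim: s sP1 => [|p s IH] sP1; first by exists 1.
have [q qs|d d0 dv] := IH; first by apply: sP1; rewrite /= inE qs orbT.
have sp : seminorm p by apply/sP/sP1; rewrite /= inE eqxx.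
have [c c0 cv] := seminorm_le_inv v sp e0.
have mono (x y : R) q : 0 < x -> x <= y -> seminorm q ->
    q (of_real k y *: v) < e -> q (of_real k x *: v) < e.
  move=> x0 xy sq; apply: le_lt_trans; rewrite !sq.2 ler_wpM2r ?seminorm_ge0//.
  rewrite ler_rnorm !gtr0_norm ?ler_of_real// -of_real0 ltr_of_real//.
  exact: lt_le_trans xy.
have [cd|cd] := lerP c d.
  exists c => // q; rewrite inE => /orP[/eqP->//|qs].
  apply: (mono c d) => //; last exact: dv.
  by apply/sP/sP1; rewrite /= inE qs orbT.
exists d => // q; rewrite inE => /orP[/eqP->|/dv//].
by apply: (mono d c) => //; rewrite ltW.
Qed.

Lemma seminorm_scale (a : K) A : seminorm_sets A ->
  exists2 B, seminorm_sets B & forall v, B v -> A (a *: v).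
Proof.
move=> [s [e [sP1 e0 ->]]].
have a1 : 0 < rnorm (a : K^o) + 1 by rewrite ltr_wpDl ?rnorm_ge0.
exists [set v | forall p, p \in s -> p v < e / (rnorm (a : K^o) + 1)].
  by exists s, (e / (rnorm (a : K^o) + 1)); split => //; rewrite divr_gt0.
move=> v /= vs p ps; have sp := sP (sP1 _ ps).
have := vs p ps; rewrite ltr_pdivlMr// mulrC; apply: le_lt_trans.
by rewrite sp.2 ler_wpM2r ?seminorm_ge0// lerDl.
Qed.

Definition seminorm_base : lc_base V :=
  LCBase seminorm_inhabited seminorm_directed seminorm_abs_convex
    seminorm_absorbing seminorm_scale.

End seminorm_theory.

Lemma seminorm_ball_abs_convex (R : realType) (k : scalar_kind)
    (V : lmodType (scalar_field R k)) (p : V -> R) (e : R) :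
  seminorm p -> abs_convex [set v | p v <= e].
Proof.
move=> sp.
have acd d : e < d -> abs_convex [set v | p v < d].
  have [d0 _|d0] := ltrP 0 d; last first.
    move=> ed; have -> : [set v | p v < d] = set0.
      apply/seteqP; split=> // v /=; rewrite ltNge => /negP; apply.
      by rewrite (le_trans d0)// seminorm_ge0.
    by split=> [u v l|a v _ //]; rewrite inE.
  have sP : forall q, [set p] q -> seminorm q by move=> q ->.
  apply: (seminorm_abs_convex sP); exists [:: p], d; split => //.
    by move=> q /=; rewrite inE => /eqP.
  apply/seteqP; split=> v /=; first by move=> pv q; rewrite inE => /eqP ->.
  by apply; rewrite inE.
split=> [u v l|a v a1 ve /=].
  rewrite !inE /= => ue ve; apply/ler_addgt0Pr => d d0; apply/ltW; have ed : e < e + d by rewrite ltrDl.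
  have := (acd _ ed).1 u v l; rewrite !inE /=; apply.
  - exact: le_lt_trans ed.
  - exact: le_lt_trans ed.
apply/ler_addgt0Pr => d d0; apply/ltW; have ed : e < e + d by rewrite ltrDl.
by apply: (acd _ ed).2 => //=; exact: le_lt_trans ed.
Qed.

Definition continuous_linear (K : numFieldType)
    (E F : preTopologicalLmodType K) : set (E -> F) :=
  [set u | linear u /\ continuous u].

Definition dual_pred (K : numFieldType) (E : tvsType K) : {pred E -> K^o} :=
  mem (@continuous_linear K E K^o).
Arguments dual_pred {K} E.

Structure dual (K : numFieldType) (E : tvsType K) := Dual {
  dual_fun :> E -> K^o;
  _ : dual_fun \in dual_pred E
}.

Section dual.
Context (K : numFieldType) (E : tvsType K).

HB.instance Definition _ := [isSub for @dual_fun K E].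
HB.instance Definition _ := [Choice of dual E by <:].

Lemma dual_linear (phi : dual E) : linear phi.
Proof. by case: phi => f /= /set_mem[]. Qed.

Lemma dual_continuous (phi : dual E) : continuous phi.
Proof. by case: phi => f /= /set_mem[]. Qed.

Lemma dual_submod_closed : submod_closed (dual_pred E).
Proof.
split.
  rewrite inE; split=> [a u v|]; first by rewrite /= scaler0 addr0.
  exact: cst_continuous.
move=> a f g /[!inE] -[lf cf] [lg cg]; split.
  move=> b u v; rewrite !fctE lf lg !scalerDr addrACA; congr (_ + _ + _).
  by rewrite !scalerA mulrC.
move=> x; apply: cvgD; last exact: cg.
by apply: cvgZr; exact: cf.
Qed.

HB.instance Definition _ :=
  GRing.isSubmodClosed.Build _ _ (dual_pred E) dual_submod_closed.
HB.instance Definition _ := [SubChoice_isSubLmodule of dual E by <:].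

HB.instance Definition _ (phi : dual E) :=
  GRing.isLinear.Build K E K^o _ phi (dual_linear phi).

End dual.

Section dual_normed.
Context (R : realType) (k : scalar_kind).
Local Notation K := (scalar_field R k).
Context (V : normedModType K).

Definition dual_norm (phi : dual V) : R :=
  sup [set rnorm (phi v) | v in [set v | rnorm v <= 1]].

Let sphi (v : V) : seminorm (fun phi : dual V => rnorm (phi v)).
Proof. by split=> [phi psi|a phi]; [exact: rnormD|exact: rnormZ]. Qed.

Lemma dual_bounded (phi : dual V) :
  exists2 M : R, 0 <= M & forall v, rnorm (phi v) <= M * rnorm v.
Proof.
have /linear_bounded_continuous/linear_boundedP/pinfty_ex_gt0[M M0 MP] :=
  @dual_continuous _ _ phi.
exists (real_of M); first exact/ltW/real_of_gt0.
move=> v; rewrite -(ler_of_real k) of_realM !of_real_rnorm real_ofK ?(ltW M0)//.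
exact: MP.
Qed.

Let bphi (phi : dual V) :
  has_ubound [set rnorm (phi v) | v in [set v | rnorm v <= 1]].
Proof.
have [M M0 MP] := dual_bounded phi; exists M => _ [v /= v1 <-].
by rewrite (le_trans (MP v))// ler_piMr.
Qed.

Lemma dual_seminorm : seminorm dual_norm.
Proof. by apply: sup_seminorm => // v _; exact: sphi. Qed.

Lemma dual_norm_ub (phi : dual V) v : rnorm v <= 1 -> rnorm (phi v) <= dual_norm phi.
Proof. by move=> v1; apply: ub_le_sup => //; exists v. Qed.

Lemma dual_norm_eq0 (phi : dual V) : of_real k (dual_norm phi) = 0 -> phi = 0.
Proof.
rewrite -of_real0 => /(can_inj (@of_realK R k)) phi0.
apply/val_inj/funext => v /=.
have [->|v0] := eqVneq v 0; first by rewrite linear0.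
have nv : `|v| != 0 by rewrite normr_eq0.
apply: (scalerI (invr_neq0 nv)); rewrite -linearZ scaler0.
apply/rnorm0_eq0/eqP; rewrite eq_le rnorm_ge0 andbT -phi0; apply: dual_norm_ub.
by rewrite -(ler_of_real k) of_real_rnorm normfZV// of_real1.
Qed.

Let dual_normD (phi psi : dual V) : of_real k (dual_norm (phi + psi)) <=
  of_real k (dual_norm phi) + of_real k (dual_norm psi).
Proof. by rewrite -of_realD ler_of_real dual_seminorm.1. Qed.

Let dual_normZ (a : K) (phi : dual V) :
  of_real k (dual_norm (a *: phi)) = `|a| * of_real k (dual_norm phi).
Proof. by rewrite dual_seminorm.2 of_realM of_real_rnorm. Qed.

HB.instance Definition _ := Lmodule_isNormed.Build K (dual V)
  dual_normD dual_normZ dual_norm_eq0.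

End dual_normed.

Section approximation_property.
Context (K : numFieldType).

Definition abs_convex_compact (E : tvsType K) : set (set E) :=
  [set A | abs_convex A /\ compact A].

(** [L_c(E;F)], with the subspace topology of the ambient function space *)
Definition Lc (E F : tvsType K) : Type :=
  set_type (@continuous_linear K E F : set {family @abs_convex_compact E, E -> F}).

(** [E'_c]: the dual with the topology of [L_c(E;K)]; for normed [E], the type
    [dual E] itself carries the norm topology instead. *)
Definition dualc (E : tvsType K) : Type := dual E.

HB.instance Definition _ (E : tvsType K) := GRing.Lmodule.on (dualc E).
HB.instance Definition _ (E : tvsType K) := Uniform.copy (dualc E)
  (initial_topology (@dual_fun K E : _ -> {family @abs_convex_compact E, E -> K^o})).

Lemma continuous_linear_id (E : tvsType K) : (idfun : E -> E) \in @continuous_linear K E E.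
Proof. by apply/mem_set; split=> [a u v //|x]; exact: cvg_id. Qed.

Definition Lc_id (E : tvsType K) : Lc E E := SigSub (continuous_linear_id E).

(** [E' (x) F] as the finite-rank maps in [L_c(E;F)] *)
Definition dual_tensor (E F : tvsType K) : set (Lc E F) :=
  [set u | exists (n : nat) (phi : 'I_n -> dual E) (v : 'I_n -> F),
    forall x, set_val u x = \sum_(i < n) phi i x *: v i].

Definition approximation_property (E : tvsType K) :=
  closure (@dual_tensor E E) (Lc_id E).

End approximation_property.

Section eps_product.
Context (R : realType) (k : scalar_kind).
Local Notation K := (scalar_field R k).

(** [E eps F = L(F'_c;E)]; as [F] is normed, the equicontinuous subsets of its
    dual are the bounded ones. *)
Definition eps_product (E : tvsType K) (F : normedModType K) : Type :=
  set_type (@continuous_linear K (dualc F) E :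
    set {family (bounded_set : set (set (dual F))), dual F -> E}).

(** [E (x) F] as a subspace of [E eps F] *)
Definition eps_tensor (E : tvsType K) (F : normedModType K) :
    set (eps_product E F) :=
  [set u | exists (n : nat) (e : 'I_n -> E) (v : 'I_n -> F),
    forall psi : dual F, set_val u psi = \sum_(i < n) psi (v i) *: e i].

End eps_product.
Arguments eps_tensor {R k} E F.

Section linear_hull.
Context (K : numFieldType) (V : lmodType K).

Definition linear_subspace (S : set V) :=
  S 0 /\ forall (a : K) u v, S u -> S v -> S (a *: u + v).

Definition linear_hull (A : set V) : set V := smallest linear_subspace A.

Definition finite_dimensional (S : set V) :=
  exists s : seq V, S = linear_hull [set` s].

Lemma linear_hull_subspace A : linear_subspace (linear_hull A).
Proof.
split=> [S [[]]//|a u v Au Av S [SS AS]].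
by apply: SS.2; [apply: Au|apply: Av].
Qed.

End linear_hull.

Definition lip0_pred (R : realType) (k : scalar_kind) (X : metricType R)
    (x0 : X) (F : normedModType (scalar_field R k)) : {pred X -> F} :=
  mem [set f | f x0 = 0 /\
    exists C : R, forall x y, rnorm (f x - f y) <= C * mdist x y].
Arguments lip0_pred {R k X} x0 F.

Structure lip0 (R : realType) (k : scalar_kind) (X : metricType R)
    (x0 : X) (F : normedModType (scalar_field R k)) := Lip0 {
  lip0_fun :> X -> F;
  _ : lip0_fun \in lip0_pred x0 F
}.
Arguments lip0 {R k X} x0 F.

Section lip0.
Context (R : realType) (k : scalar_kind).
Local Notation K := (scalar_field R k).
Context (X : metricType R) (x0 : X) (F : normedModType K).

HB.instance Definition _ := [isSub for @lip0_fun R k X x0 F].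
HB.instance Definition _ := [Choice of lip0 x0 F by <:].

Lemma lip0_base (f : lip0 x0 F) : f x0 = 0.
Proof. by case: f => f /= /set_mem[]. Qed.

Lemma lip0_lip (f : lip0 x0 F) :
  exists C : R, forall x y, rnorm (f x - f y) <= C * mdist x y.
Proof. by case: f => f /= /set_mem[]. Qed.

Lemma lip0_submod_closed : submod_closed (lip0_pred x0 F).
Proof.
split.
  rewrite inE; split=> //; exists 0 => x y.
  by rewrite mul0r subr0 rnorm0.
move=> a f g /[!inE] -[f0 [C fC]] [g0 [D gD]]; split.
  by rewrite -[LHS]/(a *: f x0 + g x0) f0 g0 scaler0 addr0.
exists (rnorm (a : K^o) * C + D) => x y.
have -> : (a *: f + g) x - (a *: f + g) y = a *: (f x - f y) + (g x - g y).
  by rewrite scalerBr addrACA -opprD.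
rewrite (le_trans (rnormD _ _))// mulrDl lerD// rnormZ -mulrA.
by rewrite ler_wpM2l ?rnorm_ge0.
Qed.

HB.instance Definition _ :=
  GRing.isSubmodClosed.Build _ _ (lip0_pred x0 F) lip0_submod_closed.
HB.instance Definition _ := [SubChoice_isSubLmodule of lip0 x0 F by <:].

Definition distinct_pairs : set (X * X) := [set z | z.1 != z.2].

Definition slope (f : lip0 x0 F) (z : X * X) : R :=
  rnorm (f z.1 - f z.2) / mdist z.1 z.2.

(** If [X] is a point the supremum is over the empty set, and [sup set0 = 0]. *)
Definition lip_norm (f : lip0 x0 F) : R := sup [set slope f z | z in distinct_pairs].

Lemma slope_seminorm (z : X * X) : seminorm (slope^~ z).
Proof.
split=> [f g|a f]; rewrite /slope.
  rewrite -mulrDl ler_wpM2r ?invr_ge0 ?mdist_ge0// -[leLHS]/(rnorm (_ + _ - (_ + _))).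
  by rewrite opprD addrACA rnormD.
by rewrite mulrA -rnormZ scalerBr.
Qed.

Lemma slope_ub (f : lip0 x0 F) :
  exists C : R, forall z, slope f z <= C.
Proof.
have [C fC] := lip0_lip f; exists (Num.max C 0) => z; rewrite /slope.
have [->|z12] := eqVneq z.1 z.2.
  by rewrite mdistxx invr0 mulr0 le_max lexx orbT.
by rewrite ler_pdivrMr ?mdist_gt0// (le_trans (fC _ _))// ler_wpM2r ?mdist_ge0// le_max lexx.
Qed.

Lemma lip_seminorm : seminorm lip_norm.
Proof.
apply: sup_seminorm => [z _|f]; first exact: slope_seminorm.
by have [C fC] := slope_ub f; exists C => _ [z _ <-].
Qed.

Lemma lip_norm_ub (f : lip0 x0 F) x y :
  rnorm (f x - f y) <= lip_norm f * mdist x y.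
Proof.
have [->|xy] := eqVneq x y; first by rewrite subrr rnorm0 mdistxx mulr0.
rewrite -ler_pdivrMr ?mdist_gt0//; apply: ub_le_sup; last by exists (x, y).
by have [C fC] := slope_ub f; exists C => _ [z _ <-].
Qed.

Lemma lip_norm_eq0 (f : lip0 x0 F) : of_real k (lip_norm f) = 0 -> f = 0.
Proof.
rewrite -of_real0 => /(can_inj (@of_realK R k)) f0.
apply/val_inj/funext => x /=; apply/rnorm0_eq0/eqP; rewrite eq_le rnorm_ge0 andbT.
by have := lip_norm_ub f x x0; rewrite f0 mul0r lip0_base subr0.
Qed.

Let lip_normD (f g : lip0 x0 F) : of_real k (lip_norm (f + g)) <=
  of_real k (lip_norm f) + of_real k (lip_norm g).
Proof. by rewrite -of_realD ler_of_real lip_seminorm.1. Qed.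

Let lip_normZ (a : K) (f : lip0 x0 F) :
  of_real k (lip_norm (a *: f)) = `|a| * of_real k (lip_norm f).
Proof. by rewrite lip_seminorm.2 of_realM of_real_rnorm. Qed.

HB.instance Definition _ := Lmodule_isNormed.Build K (lip0 x0 F)
  lip_normD lip_normZ lip_norm_eq0.

Definition weighted_slopes (alpha : nat -> R) (z : nat -> X * X)
    (f : lip0 x0 F) : R :=
  sup [set alpha n * slope f (z n) | n in [set: nat]].

(** The weights range over the sequences of positive reals tending to zero. *)
Definition gamma_tau_seminorms : set (lip0 x0 F -> R) :=
  [set q | exists (alpha : nat -> R) (z : nat -> X * X),
    [/\ forall n, 0 < alpha n, alpha @ \oo --> 0,
        forall n, distinct_pairs (z n) & q = weighted_slopes alpha z]].

Lemma gamma_tau_seminormsP q : gamma_tau_seminorms q -> seminorm q.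
Proof.
move=> [alpha [z [a0 acvg zX ->]]]; apply: sup_seminorm => [n _|f].
  split=> [f g|a f].
    by rewrite -mulrDr ler_pM2l// (slope_seminorm (z n)).1.
  by rewrite (slope_seminorm (z n)).2 mulrCA.
have [C fC] := slope_ub f.
have [M [Mr MP]] := cvg_seq_bounded (cvgP _ acvg).
pose N := Num.max (M + 1) 0.
exists (N * C) => _ [n _ <-].
rewrite (le_trans (y := N * slope f (z n)))//.
  rewrite ler_wpM2r ?(seminorm_ge0 _ (slope_seminorm _))//.
  rewrite /N le_max; apply/orP; left.
  by have := MP (M + 1) (ltr_pwDr ltr01 (lexx _)) n I; rewrite /= gtr0_norm.
by rewrite ler_wpM2l// /N le_max lexx orbT.
Qed.

Definition gamma_tau_base : lc_base (lip0 x0 F) :=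
  seminorm_base gamma_tau_seminormsP.

Definition lip0_finite_rank : set (lip0 x0 F) :=
  [set f | finite_dimensional (linear_hull (range f))].

End lip0.

Section scalar_lip0.
Context (R : realType) (k : scalar_kind).
Local Notation K := (scalar_field R k).
Context (X : metricType R) (x0 : X).
Local Notation L := (lip0 x0 (K^o : normedModType K)).

Lemma evaluation_dual (x : X) :
  (fun f : L => f x) \in dual_pred L.
Proof.
rewrite inE; have lin : linear (fun f : L => f x) by [].
pose lf : {linear L -> K^o} := HB.pack (fun f : L => f x)
  (GRing.isLinear.Build K L K^o _ (fun f : L => f x) lin).
split=> //; apply: (bounded_linear_continuous (f := lf)).
apply/linear_boundedP; exists (of_real k (mdist x x0)).
split; first by rewrite ger0_real// -of_real0 ler_of_real mdist_ge0.
move=> r /ltW rx f; rewrite (le_trans (y := of_real k (mdist x x0) * `|f|))//; last first.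
  by rewrite ler_wpM2r.
have := lip_norm_ub f x x0; rewrite lip0_base subr0 -(ler_of_real k) of_realM.
by rewrite of_real_rnorm mulrC.
Qed.

Definition delta (x : X) : dual L := Dual (evaluation_dual x).

Definition lipfree_pred : {pred dual L} :=
  mem (closure (linear_hull (range delta))).

Lemma closure_subspace (V : normedModType K) (S : set V) :
  linear_subspace S -> linear_subspace (closure S).
Proof.
move=> [S0 SD]; split; first exact: subset_closure.
move=> a u v Su Sv A nA.
have : (fun z : V * V => a *: z.1 + z.2) @ (u, v) --> a *: u + v.
  by apply: cvgD; [apply: cvgZr; exact: cvg_fst|exact: cvg_snd].
move=> /(_ A nA)[[B C] [/= /Su[u' [Su' Bu']] /Sv[v' [Sv' Cv']]] BCA].
exists (a *: u' + v'); split; first exact: SD.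
exact: (BCA (u', v')).
Qed.

Lemma lipfree_submod_closed : submod_closed lipfree_pred.
Proof.
have [H0 HD] := closure_subspace (linear_hull_subspace (range delta)).
split; first exact: mem_set.
by move=> a u v /set_mem Hu /set_mem Hv; apply/mem_set/HD.
Qed.

HB.instance Definition _ :=
  GRing.isSubmodClosed.Build _ _ lipfree_pred lipfree_submod_closed.

(** [Lip_0(X)] with the compact-open topology [tau_0] *)
Definition tau0 : Type := initial_topology
  (@lip0_fun R k X x0 K^o : _ -> {family compact, X -> K^o}).

HB.instance Definition _ := Uniform.on tau0.

Definition tau0_nbhs0 (U : set L) := nbhs ((0 : L) : tau0) U.

(** The indices are shifted by one: [U i] is the set [U_{i+1}]. *)
Definition mixed_nbhs (U : nat -> set L) : set L :=
  [set f | exists (n : nat) (g : 'I_n.+1 -> L),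
    (forall i : 'I_n.+1, U i (g i) /\ lip_norm (g i) <= 2 ^+ i) /\ f = \sum_(i < n.+1) g i].

Definition mixed_sets : set_system L :=
  [set A | exists U : nat -> set L,
    (forall i, abs_convex (U i) /\ tau0_nbhs0 (U i)) /\ A = mixed_nbhs U].

Lemma tau0_nbhs0P (U : set L) : tau0_nbhs0 U <->
  exists2 W, nbhs (cst 0 : {family compact, X -> K^o}) W &
    forall f : L, W f -> U f.
Proof.
split=> [[B [[C oC <-] C0 CU]]|[W nW WU]].
  by exists C; [exact: open_nbhs_nbhs|move=> f; exact: CU].
have : nbhs ((0 : L) : tau0) (@lip0_fun R k X x0 K^o @^-1` W).
  exact: (@initial_continuous _ _ (@lip0_fun R k X x0 K^o : L -> {family compact, X -> K^o}) 0).
by apply: filterS => f; exact: WU.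
Qed.

Lemma fam0_nbhs (A : set X) (e : K) : compact A -> 0 < e ->
  nbhs (cst 0 : {family compact, X -> K^o}) [set g | forall x, A x -> `|g x| < e].
Proof.
move=> cA e0.
have := @fam_nbhs X (K^o : uniformType) compact A
  [set xy : K^o * K^o | ball xy.1 e xy.2] (cst 0) (entourage_ball _ (PosNum e0)) cA.
apply: filterS => g /= gA x /gA.
by rewrite -ball_normE /= sub0r normrN.
Qed.

Lemma fam0_cvg (F : set_system (X -> K^o)) : Filter F ->
  (forall A (e : K), compact A -> 0 < e -> F [set g | forall x, A x -> `|g x| < e]) ->
  F --> (cst 0 : {family compact, X -> K^o}).
Proof.
move=> FF FA; apply/fam_cvgP => A cA P /uniform_nbhs[E [entE EP]].
move: entE; rewrite -entourage_ballE => -[e /= e0 eE].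
apply: filterS (FA A e cA e0) => g gA; apply: EP => x Ax; apply: eE => /=.
by rewrite -ball_normE /= sub0r normrN; exact: gA.
Qed.

Lemma tau0_nbhs0I (U W : set L) :
  tau0_nbhs0 U -> tau0_nbhs0 W -> tau0_nbhs0 (U `&` W).
Proof. exact: filterI. Qed.

Lemma tau0_nbhs0Z (a : K) (U : set L) :
  tau0_nbhs0 U -> tau0_nbhs0 [set f | U (a *: f)].
Proof.
move=> /tau0_nbhs0P[W nW WU]; apply/tau0_nbhs0P.
exists [set g | W (a *: g)]; last by move=> f; exact: (WU (a *: f)).
have : (fun g : X -> K^o => a *: g) @ nbhs (cst 0 : {family compact, X -> K^o})
    --> (cst 0 : {family compact, X -> K^o}).
  apply: fam0_cvg => A e cA e0.
  have a1 : 0 < `|a| + 1 by rewrite ltr_wpDl.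
  have := @fam0_nbhs A (e / (`|a| + 1)) cA; rewrite divr_gt0// => /(_ isT).
  apply: filterS => g gA x /gA; rewrite ltr_pdivlMr// => /le_lt_trans; apply.
  by rewrite normrZ mulrC ler_wpM2l// lerDl.
exact.
Qed.

Lemma lip0_compact_bounded (f : L) (A : set X) : compact A ->
  exists2 M : R, 0 < M & forall x, A x -> rnorm (f x) <= M.
Proof.
move=> cA; pose h (x : X) : R^o := mdist x x0.
have ch : continuous h.
  move=> x; apply/cvgrPdist_lt => e e0.
  apply/nbhs_ballP; exists e => //= y; rewrite ballEmdist /= => xy.
  have tri a b : mdist a x0 - mdist b x0 <= mdist a b.
    by rewrite lerBlDr metric_triangle.
  rewrite (le_lt_trans _ xy)// ler_norml; apply/andP; split; last exact: tri.
  by rewrite lerNl opprB metric_sym; exact: tri.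
have /compact_bounded[M [Mr MP]] : compact (h @` A).
  by apply: continuous_compact => //; exact: continuous_subspaceT.
exists (lip_norm f * `|M + 1| + 1).
  by rewrite ltr_wpDl// mulr_ge0// (seminorm_ge0 _ (@lip_seminorm _ _ _ _ _)).
move=> x Ax; have := lip_norm_ub f x x0; rewrite lip0_base subr0.
move=> /le_trans; apply; rewrite (le_trans (y := lip_norm f * `|M + 1|)) ?lerDl//.
apply: ler_wpM2l; first exact: (seminorm_ge0 _ (@lip_seminorm _ _ _ _ _)).
rewrite (le_trans _ (ler_norm _))//.
have := MP (M + 1) (ltr_pwDr ltr01 (lexx _)) (h x) (imageP _ Ax).
by rewrite /= ger0_norm ?mdist_ge0.
Qed.

Lemma tau0_absorbing (U : set L) (f : L) : tau0_nbhs0 U ->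
  exists2 e : R, 0 < e & U (of_real k e *: f).
Proof.
move=> /tau0_nbhs0P[W nW WU].
have cvg0 : (fun t : R => of_real k t *: (f : X -> K^o)) @ 0^'+
    --> (cst 0 : {family compact, X -> K^o}).
  apply: fam0_cvg => A e cA e0.
  have [M M0 MP] := lip0_compact_bounded f cA.
  have e1 := real_of_gt0 e0.
  suff : \forall t \near (0 : R)^'+, forall x, A x -> `|of_real k t *: f x| < e by [].
  near=> t => x Ax; rewrite -of_real_rnorm.
  rewrite -[e]real_ofK ?ltW// ltr_of_real rnormZ.
  have t0 : 0 < t by near: t; exact: nbhs_right_gt.
  have -> : rnorm (of_real k t : K^o) = t.
    by rewrite /rnorm gtr0_norm ?of_realK// -of_real0 ltr_of_real.
  rewrite (le_lt_trans (y := t * M))//; first by rewrite ler_pM2l// MP.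
  rewrite -ltr_pdivlMr//.
  by near: t; apply: nbhs_right_lt; rewrite divr_gt0.
near (0 : R)^'+ => t.
exists t; first by near: t; exact: nbhs_right_gt.
apply: WU; near: t; exact: (cvg0 W nW).
Unshelve. all: by end_near. Qed.

End scalar_lip0.

Arguments mixed_sets {R} k {X} x0.
Arguments lipfree_pred {R} k {X} x0.

Lemma abs_convexI (K : numFieldType) (V : lmodType K) (A B : set V) :
  abs_convex A -> abs_convex B -> abs_convex (A `&` B).
Proof.
move=> [cA bA] [cB bB]; split=> [u v l|a v a1 [Av Bv]].
  rewrite !inE => -[/mem_set Au /mem_set Bu] [/mem_set Av /mem_set Bv]; split.
    exact/set_mem/cA.
  exact/set_mem/cB.
by split; [exact: bA|exact: bB].
Qed.

Lemma abs_convex_scale (K : numFieldType) (V : lmodType K) (A : set V) (a : K) :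
  abs_convex A -> abs_convex [set v | A (a *: v)].
Proof.
move=> [cA bA]; split=> [u v l|b v b1 /= Av].
  rewrite !inE /= => Au Av.
  have := cA _ _ l (mem_set Au) (mem_set Av); rewrite inE /conv /=; congr A.
  by rewrite scalerDr !scalerA mulrC [X in _ + X *: _]mulrC.
by rewrite scalerA mulrC -scalerA; exact: bA.
Qed.

Section mixed_topology.
Context (R : realType) (k : scalar_kind).
Local Notation K := (scalar_field R k).
Context (X : metricType R) (x0 : X).
Local Notation L := (lip0 x0 (K^o : normedModType K)).
Implicit Types (U : nat -> set L).

Let piece U i : set L := U i `&` [set f | lip_norm f <= 2 ^+ i].

Let slip : seminorm (@lip_norm R k X x0 K^o) := @lip_seminorm R k X x0 K^o.

Let good U := forall i, abs_convex (U i) /\ tau0_nbhs0 (U i).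

Let piece_abs_convex U i : good U -> abs_convex (piece U i).
Proof.
move=> /(_ i)[acU _]; apply: abs_convexI => //.
exact: seminorm_ball_abs_convex.
Qed.

Let piece0 U i : good U -> piece U i 0.
Proof.
move=> /(_ i)[_ nU]; split; last by rewrite /= (seminorm0 slip).
exact: nbhs_singleton nU.
Qed.

Let mixedE U f : good U -> mixed_nbhs U f <->
  exists n, forall N, (n <= N)%N -> exists g : nat -> L,
    (forall i, piece U i (g i)) /\ f = \sum_(i < N.+1) g i.
Proof.
move=> gU; split=> [[n [g [gP ->]]]|[n /(_ n (leqnn n))[g [gP ->]]]]; last first.
  by exists n, (fun i : 'I_n.+1 => g i); split=> // i; exact: gP.
exists n => N nN.
pose h i := if insub i is Some j then g j else 0.
exists h; split.
  move=> i; rewrite /h; case: insubP => [j _ <-|_]; last exact: piece0.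
  exact: gP.
have -> : \sum_(i < n.+1) g i = \sum_(i < n.+1) h i.
  by apply: eq_bigr => i _; rewrite /h valK.
rewrite (big_ord_widen N.+1 h) ?ltnS// big_mkcond /=; apply: eq_bigr => i _.
by case: ifPn => // ni; rewrite /h insubN.
Qed.

Lemma mixed_abs_convex A : mixed_sets k x0 A -> abs_convex A.
Proof.
move=> [U [gU ->]]; split.
  move=> u v l; rewrite !inE => /(mixedE _ gU)[n nP] /(mixedE _ gU)[m mP].
  apply/(mixedE _ gU); exists (maxn n m) => N; rewrite geq_max => /andP[nN mN].
  have [g [gP ->]] := nP _ nN; have [h [hP ->]] := mP _ mN.
  exists (fun i => (l%:num : K) *: g i + unstable.onem (l%:num : K) *: h i); split.
    move=> i; apply/set_mem.
    exact: ((piece_abs_convex i gU).1 (g i) (h i) l (mem_set (gP i)) (mem_set (hP i))).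
  by rewrite /conv /= big_split /= -!scaler_sumr.
move=> a v a1 /(mixedE _ gU)[n nP]; apply/(mixedE _ gU); exists n => N nN.
have [g [gP ->]] := nP _ nN; exists (fun i => a *: g i); split.
  by move=> i; exact: (piece_abs_convex i gU).2.
by rewrite scaler_sumr.
Qed.

Lemma mixed_inhabited : mixed_sets k x0 !=set0.
Proof.
exists (mixed_nbhs (fun=> setT)), (fun=> setT); split=> // i; split.
  by split=> // u v l; rewrite !inE.
exact: filterT.
Qed.

Lemma mixed_directed A B : mixed_sets k x0 A -> mixed_sets k x0 B ->
  exists2 C, mixed_sets k x0 C & C `<=` A `&` B.
Proof.
move=> [U [gU ->]] [W [gW ->]].
exists (mixed_nbhs (fun i => U i `&` W i)).
  exists (fun i => U i `&` W i); split=> // i.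
  split; first exact: abs_convexI (gU i).1 (gW i).1.
  exact: tau0_nbhs0I (gU i).2 (gW i).2.
move=> f [n [g [gP ->]]]; split; exists n, g; split=> // i.
  by have [[]] := gP i.
by have [[]] := gP i.
Qed.

Lemma mixed_absorbing A f : mixed_sets k x0 A -> exists2 e : K, 0 < e & A (e *: f).
Proof.
move=> [U [gU ->]].
have l0 : 0 <= lip_norm f by exact: (seminorm_ge0 _ slip).
pose n := Num.bound (lip_norm f).
have fn : lip_norm f <= 2 ^+ n by rewrite ltW// upper_nthrootP.
have [d d0 Ud] := tau0_absorbing f (gU n).2.
pose e := Num.min d 1.
have e0 : 0 < e by rewrite lt_min d0 ltr01.
have rne (r : R) : 0 < r -> rnorm (of_real k r : K^o) = r.
  by move=> r0; rewrite /rnorm gtr0_norm ?of_realK// -of_real0 ltr_of_real.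
exists (of_real k e); first by rewrite -of_real0 ltr_of_real.
have pe : piece U n (of_real k e *: f).
  split.
    have := (gU n).1.2 (of_real k (e / d)) _ _ Ud.
    rewrite scalerA -of_realM divfK ?gt_eqF//; apply.
    rewrite -[X in X <= _]/(`|(of_real k (e / d) : K^o)|) -of_real_rnorm.
    rewrite rne ?divr_gt0// -(of_real1 R k) ler_of_real ler_pdivrMr// mul1r.
    by rewrite ge_min lexx.
  rewrite /= slip.2 rne// (le_trans _ fn)// ler_piMl//.
  by rewrite ge_min lexx orbT.
exists n, (fun i : 'I_n.+1 => if i == n :> nat then of_real k e *: f else 0); split.
  by move=> i; case: eqP => [->//|_]; exact: (piece0 i gU).
rewrite big_ord_recr /= eqxx big1 ?add0r// => i _.
by rewrite ltn_eqF.
Qed.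

Lemma mixed_scale (a : K) A : mixed_sets k x0 A ->
  exists2 B, mixed_sets k x0 B & forall f, B f -> A (a *: f).
Proof.
move=> [U [gU ->]].
pose m := Num.bound (rnorm (a : K^o)).
have am : rnorm (a : K^o) <= 2 ^+ m by rewrite ltW// upper_nthrootP.
pose W i := [set f | U (i + m)%N (a *: f)].
exists (mixed_nbhs W).
  exists W; split=> // i; split.
    exact: abs_convex_scale (gU _).1.
  exact: tau0_nbhs0Z (gU _).2.
move=> _ [n [g [gP ->]]].
pose h (i : nat) : L := if insub i is Some j then a *: g j else 0.
exists (n + m)%N, (fun i => if (i < m)%N then 0 else h (i - m)%N); split.
  move=> i; case: ltnP => mi; first exact: (piece0 i gU).
  rewrite /h; case: insubP => [j jn ji|_]; last exact: (piece0 i gU).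
  have [Uj gj] := gP j.
  have ij : i = (j + m)%N :> nat by rewrite ji subnK.
  rewrite ij; split; first exact: Uj.
  rewrite slip.2 addnC exprD.
  by rewrite ler_pM// ?rnorm_ge0// (seminorm_ge0 _ slip).
rewrite -(big_mkord xpredT (fun i => if (i < m)%N then 0 else h (i - m)%N)).
rewrite (big_cat_nat (n := m)) //=; last by rewrite -addSn leq_addl.
rewrite [X in X + _]big1_seq ?add0r; last first.
  by move=> i; rewrite mem_index_iota => /andP[_ /andP[_ ->]].
rewrite -{1}[m]add0n big_addn -addSn addnK big_mkord scaler_sumr.
apply: eq_bigr => i _; rewrite ltnNge leq_addl /= addnK /h valK.
by [].
Qed.

Definition mixed_base : lc_base L :=
  LCBase mixed_inhabited mixed_directed mixed_abs_convex mixed_absorbing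
    mixed_scale.

End mixed_topology.

(** The Lipschitz-free space, normed as a subspace of the dual of [Lip_0(X)] *)
Structure lipfree (R : realType) (k : scalar_kind) (X : metricType R)
    (x0 : X) := Lipfree {
  lipfree_val :> dual (lip0 x0 ((scalar_field R k)^o : normedModType (scalar_field R k)));
  _ : lipfree_val \in lipfree_pred k x0
}.
Arguments lipfree {R} k {X} x0.

Section lipfree.
Context (R : realType) (k : scalar_kind) (X : metricType R) (x0 : X).

HB.instance Definition _ := [isSub for @lipfree_val R k X x0].
HB.instance Definition _ := [Choice of lipfree k x0 by <:].
HB.instance Definition _ := [SubChoice_isSubLmodule of lipfree k x0 by <:].

Definition lipfree_norm (m : lipfree k x0) : scalar_field R k := `|lipfree_val m|.

Let lipfree_normD (m m' : lipfree k x0) :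
  lipfree_norm (m + m') <= lipfree_norm m + lipfree_norm m'.
Proof. exact: ler_normD. Qed.

Let lipfree_normZ (a : scalar_field R k) (m : lipfree k x0) :
  lipfree_norm (a *: m) = `|a| * lipfree_norm m.
Proof. exact: normrZ. Qed.

Let lipfree_norm_eq0 (m : lipfree k x0) : lipfree_norm m = 0 -> m = 0.
Proof. by move=> /normr0_eq0 m0; exact: val_inj. Qed.

HB.instance Definition _ := Lmodule_isNormed.Build (scalar_field R k) (lipfree k x0)
  lipfree_normD lipfree_normZ lipfree_norm_eq0.

(** [(Lip_0(X), tau_gamma)] *)
Definition lip0_mixed : tvsType (scalar_field R k) := lcs (mixed_base k x0).

(** [(Lip_0(X,F), gamma tau_gamma)] *)
Definition lip0_gamma_tau (F : normedModType (scalar_field R k)) :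
  tvsType (scalar_field R k) := lcs (gamma_tau_base x0 F).

End lipfree.
Arguments lip0_mixed {R} k {X} x0.
Arguments lip0_gamma_tau {R k X} x0 F.
Arguments lip0_finite_rank {R k X} x0 F.

(* Main.v *)
From HB Require Import structures.
Require Import Defs.
From mathcomp Require Import all_boot all_order all_algebra complex.
From mathcomp Require Import all_classical all_reals all_analysis.
From mathcomp Require Import ring lra.

Set Implicit Arguments.
Unset Strict Implicit.
Unset Printing Implicit Defensive.

Import Order.TTheory GRing.Theory Num.Theory.
Import numFieldNormedType.Exports.

Local Open Scope classical_set_scope.
Local Open Scope ring_scope.

(** Write [E] for [Lip_0(X)] with the mixed topology and [G] for the free space,
    whose dual is [Lip_0(X)]. The theorem is true because [E] is [G'_c], and because
    [Lip_0(X,F)] with its topology is [E eps F], a map [f] corresponding to the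
    operator [psi |-> psi o f] from [F'_c] to [E]. After this identification (iii) and
    (iv) are the same assertion about finite-rank operators, and the rest is the
    invariance of the approximation property under passage from [G] to [G'_c].

    The description of [E] is the technical core. In one direction,
    [mixed_nbhs_weighted] finds inside each basic neighbourhood
    a ball of a seminorm [sup_n alpha_n slope(f, z_n)]. This is done without
    duality, by McShane extension from finite sets. In the other direction,
    [mixed_small] shows that seminorms that are [tau_0]-continuous on bounded sets are
    continuous on [E]; this applies to those weighted suprema and to the suprema over
    compact subsets of [G] ([lipfree_compact_mixed]). Since weighted slopes
    are the values of functionals on a null sequence of a Banach space, and such a
    sequence lies in a compact convex set ([null_sequence_hull]), neighbourhoods in
    [E], in [F'_c] and in [L_c] can be compared.

    The implications are proved in the cycle (i), (iii), (iv), (ii), (i).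
    From (i) to (iii), an operator [u] from [F'_c] to [E] maps bounded sets to bounded
    sets ([eps_product_bounded]), and these lie in compact ones ([lip_ball_compact]);
    hence a finite-rank [w] close to the identity of [E] gives [w o u] close to [u], and
    [w o u] is a tensor as the continuous functionals on [F'_c] are the evaluations
    at points of [F] ([mackey_arens]). From (iii) to (iv), norming functionals pass from
    scalar to vector-valued seminorms. From (iv) to (ii), the embedding of [X] in
    [G] is approximated by finite-rank maps, whose linear extensions to [G] approximate
    the identity. From (ii) to (i), one takes adjoints. *)

Ltac ilra := intros; lra.

(** * Scalars *)

Section scalars.
Context (R : realType) (k : scalar_kind).
Local Notation K := (scalar_field R k).

Lemma real_ofD (a b : K) : real_of (a + b) = real_of a + real_of b.
Proof. by case: k a b => //= -[a a'] [b b']. Qed.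

Lemma real_of_of_realM (t : R) (a : K) : real_of (of_real k t * a) = t * real_of a.
Proof. by case: k a => //= -[a b] /=; rewrite mul0r subr0. Qed.

Lemma rnorm_of_real (t : R) : 0 <= t -> rnorm (of_real k t : K^o) = t.
Proof. by move=> t0; rewrite /rnorm ger0_norm ?of_realK// -of_real0 ler_of_real. Qed.

Lemma rnorm_scale_real (V : normedModType K) (t : R) (v : V) :
  0 <= t -> rnorm (of_real k t *: v) = t * rnorm v.
Proof. by move=> t0; rewrite rnormZ rnorm_of_real. Qed.

Lemma rnormN (V : normedModType K) (v : V) : rnorm (- v) = rnorm v.
Proof. by rewrite /rnorm normrN. Qed.

Lemma rnorm_sub (V : normedModType K) (u v : V) : rnorm (u - v) = rnorm (v - u).
Proof. by rewrite -rnormN opprB. Qed.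

Lemma ler_rnormB (V : normedModType K) (u v : V) :
  rnorm (u - v) <= rnorm u + rnorm v.
Proof. by rewrite (le_trans (rnormD _ _))// rnormN. Qed.

Lemma rnorm_sum (V : normedModType K) (I : Type) (s : seq I) (v : I -> V) :
  rnorm (\sum_(i <- s) v i) <= \sum_(i <- s) rnorm (v i).
Proof.
elim: s => [|i s IH]; first by rewrite !big_nil rnorm0.
by rewrite !big_cons (le_trans (rnormD _ _))// lerD2l.
Qed.

Lemma rnorm_seminorm (V : normedModType K) : seminorm (@rnorm R k V).
Proof. by split=> [u v|a v]; [exact: rnormD|exact: rnormZ]. Qed.

Lemma rnorm_eq0 (V : normedModType K) (v : V) : (rnorm v == 0) = (v == 0).
Proof.
by apply/eqP/eqP => [|->]; [exact: rnorm0_eq0|exact: rnorm0].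
Qed.

Lemma rnorm_gt0 (V : normedModType K) (v : V) : (0 < rnorm v) = (v != 0).
Proof. by rewrite lt_neqAle rnorm_ge0 andbT eq_sym rnorm_eq0. Qed.

Lemma ball_rnorm (V : normedModType K) (v w : V) (e : R) :
  ball v (of_real k e) w <-> rnorm (v - w) < e.
Proof. by rewrite -ball_normE /= -of_real_rnorm ltr_of_real. Qed.

Lemma real_of_le_rnorm (a : K) : real_of a <= rnorm (a : K^o).
Proof.
rewrite /rnorm; case: k a => /= [a|[a b]]; first exact: ler_norm.
have := @normc_ge_Re R (a +i* b)%C; rewrite lecE => /andP[_]; apply: le_trans.
by rewrite /= ler_norm.
Qed.

Lemma rotate (a : K) : exists2 c : K, rnorm (c : K^o) <= 1 & c * a = `|a|.
Proof.
have [->|a0] := eqVneq a 0.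
  by exists 0; rewrite ?rnorm0// normr0 mulr0.
exists (`|a| / a); last by rewrite divfK.
rewrite -(ler_of_real k) of_real_rnorm of_real1.
by rewrite normrM normfV normr_id divff// normr_eq0.
Qed.

Definition sublinear (V : lmodType K) (N : V -> R) :=
  (forall u v, N (u + v) <= N u + N v) /\
  (forall (t : R) u, 0 < t -> N (of_real k t *: u) <= t * N u).

Definition real_linear (V : lmodType K) (N : V -> R) :=
  (forall u v, N (u + v) = N u + N v) /\
  (forall (t : R) u, N (of_real k t *: u) = t * N u).

Lemma of_realN1 : of_real k (- 1) = - 1 :> K.
Proof. by apply: (addrI 1); rewrite -{1}(of_real1 R k) -of_realD !subrr of_real0. Qed.

(** * The Hahn-Banach theorem *)

Section hahn_banach.
Context (V : lmodType K).
Implicit Types N : V -> R.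

Lemma sublinear0 N : sublinear N -> N 0 = 0.
Proof.
move=> [_ NZ].
have h1 : N 0 <= 2 * N 0 by rewrite -{1}(scaler0 _ (of_real k 2)) NZ.
have h2 : N 0 <= 2^-1 * N 0.
  by rewrite -{1}(scaler0 _ (of_real k (2^-1))) NZ// invr_gt0.
by ilra.
Qed.

Lemma sublinear_scale N (t : R) u : sublinear N -> 0 < t -> N (of_real k t *: u) = t * N u.
Proof.
move=> sN t0; apply/eqP; rewrite eq_le sN.2//=.
have := sN.2 t^-1 (of_real k t *: u); rewrite invr_gt0 => /(_ t0).
rewrite scalerA -of_realM mulVf ?gt_eqF// of_real1 scale1r => h.
by rewrite -(ler_pM2l (x := t^-1)) ?invr_gt0// mulrA mulVf ?gt_eqF// mul1r.
Qed.

Lemma sublinear_opp N u : sublinear N -> - N (- u) <= N u :> R.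
Proof.
by move=> sN; have := sN.1 u (- u); rewrite subrr sublinear0//; ilra.
Qed.

(** The functional [M u = inf (N (u + w) - c)], over the [(w, c)] in the cone [C],
    is again sublinear. A linear functional below [M] is at least [c] at [w];
    suitable cones give norming functionals and decompositions. *)
Lemma sublinear_cone N (C : V -> R -> Prop) : sublinear N ->
  C 0 0 -> (forall v c w d, C v c -> C w d -> C (v + w) (c + d)) ->
  (forall (t : R) v c, 0 < t -> C v c -> C (of_real k t *: v) (t * c)) ->
  (forall v c, C v c -> c <= N v) ->
  exists M, [/\ sublinear M, forall u, M u <= N u & forall v c, C v c -> M (- v) <= - c].
Proof.
move=> sN C0 CD CZ CN.
pose E u : set R := [set r | exists v c, C v c /\ r = N (u + v) - c].
have lE u : lbound (E u) (- N (- u)).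
  move=> _ [v [c [Cvc ->]]]; have := CN _ _ Cvc; have := sN.1 (u + v) (- u).
  by rewrite addrAC subrr add0r; ilra.
have nE u : E u !=set0 by exists (N (u + 0) - 0), 0, 0.
have bE u : has_lbound (E u) by exists (- N (- u)).
have Mle u v c : C v c -> inf (E u) <= N (u + v) - c.
  by move=> Cvc; apply: ge_inf => //; exists v, c.
exists (fun u => inf (E u)); split=> [|u|v c Cvc].
- split=> [u v|t u t0].
    rewrite -lerBlDr; apply: lb_le_inf => // _ [w [c [Cwc ->]]].
    rewrite lerBlDl -lerBlDr; apply: lb_le_inf => // _ [w' [c' [Cwc' ->]]].
    rewrite lerBlDl; have := Mle (u + v) _ _ (CD _ _ _ _ Cwc Cwc').
    by rewrite addrACA; have := sN.1 (u + w) (v + w'); ilra.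
  rewrite mulrC -ler_pdivrMr//; apply: lb_le_inf => // _ [w [c [Cwc ->]]].
  rewrite ler_pdivrMr//; have := Mle (of_real k t *: u) _ _ (CZ _ _ _ t0 Cwc).
  by rewrite -scalerDr (sublinear_scale _ sN)// mulrBl ![_ * t]mulrC.
- by have := Mle u _ _ C0; rewrite addr0 subr0.
- by have := Mle (- v) _ _ Cvc; rewrite addNr sublinear0// sub0r.
Qed.

(** Zorn's lemma applies as the pointwise infimum of a chain is sublinear; it is
    finite because [M u >= - M (- u) >= - N (- u)]. *)
Lemma sublinear_minimal N : sublinear N ->
  exists M, [/\ sublinear M, forall u, M u <= N u &
    forall M', sublinear M' -> (forall u, M' u <= M u) -> forall u, M u <= M' u].
Proof.
move=> sN; pose T := {M : V -> R | sublinear M /\ forall u, M u <= N u}.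
pose mk M (h : sublinear M /\ forall u, M u <= N u) : T := exist _ M h.
pose le (M M' : T) := `[< forall u, sval M' u <= sval M u >].
have [| | |[M [sM MN]] Mmin] := @ZL_preorder T (mk N (conj sN (fun=> lexx _))) le.
- by move=> M; apply/asboolP => u.
- move=> M1 M2 M3 /asboolP h12 /asboolP h23; apply/asboolP => u.
  exact: le_trans (h23 u) (h12 u).
- move=> A totA.
  have [->|/set0P [M0 AM0]] := eqVneq A set0.
    by exists (mk N (conj sN (fun=> lexx _))).
  pose E u : set R := [set r | exists2 M, A M & r = sval M u].
  have lE u : has_lbound (E u).
    exists (- N (- u)) => _ [[M [sM MN]] _ ->] /=.
    by rewrite (le_trans _ (sublinear_opp u sM))// lerN2.
  have nE u : E u !=set0 by exists (sval M0 u), M0.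
  have Ele u M : A M -> inf (E u) <= sval M u.
    by move=> AM; apply: ge_inf => //; exists M.
  have sE : sublinear (fun u => inf (E u)).
    split=> [u v|t u t0].
      rewrite -lerBlDr; apply: lb_le_inf => // _ [M AM ->].
      rewrite lerBlDl -lerBlDr; apply: lb_le_inf => // _ [M' AM' ->].
      rewrite lerBlDl; have [/asboolP h|/asboolP h] := totA _ _ AM AM'.
        have := Ele (u + v) _ AM'; have := (svalP M').1.1 u v; have := h u.
        by have := h v; ilra.
      have := Ele (u + v) _ AM; have := (svalP M).1.1 u v; have := h u.
      by have := h v; ilra.
    rewrite mulrC -ler_pdivrMr//; apply: lb_le_inf => // _ [M AM ->].
    rewrite ler_pdivrMr// mulrC (le_trans (Ele _ _ AM))//.
    exact: (svalP M).1.2.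
  have EN u : inf (E u) <= N u by rewrite (le_trans (Ele _ _ AM0))// (svalP M0).2.
  exists (mk _ (conj sE EN)) => M AM; apply/asboolP => u /=.
  exact: Ele.
- exists M; split=> // M' sM' M'M u.
  have M'N v : M' v <= N v by exact: le_trans (M'M v) (MN v).
  by have /asboolP := Mmin (mk M' (conj sM' M'N)) (asboolT M'M); apply.
Qed.

(** A minimal sublinear functional is linear: with the cone of the multiples of
    one vector, it could otherwise be lowered. *)
Theorem hahn_banach N : sublinear N ->
  exists2 M, real_linear M & forall u, M u <= N u.
Proof.
move=> /sublinear_minimal[M [sM MN Mmin]]; exists M => //.
have MO v : M (- v) = - M v.
  pose C w c := exists2 t, 0 <= t & w = of_real k t *: v /\ c = t * M v.
  have [| | | |M' [sM' M'M /(_ v (M v)) h]] := @sublinear_cone M C sM.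
  - by exists 0; rewrite // of_real0 scale0r mul0r.
  - move=> _ _ _ _ [s s0 [-> ->]] [t t0 [-> ->]]; exists (s + t).
      by rewrite addr_ge0.
    by rewrite of_realD scalerDl mulrDl.
  - move=> s _ _ s0 [t t0 [-> ->]]; exists (s * t); first by rewrite mulr_ge0 // ltW.
    by rewrite of_realM -scalerA mulrA.
  - move=> w c [t]; rewrite le_eqVlt => /orP[/eqP <-|t0] [-> ->].
      by rewrite of_real0 scale0r mul0r sublinear0.
    by rewrite sublinear_scale.
  have /h : C v (M v) by exists 1; rewrite // of_real1 scale1r mul1r.
  have := Mmin _ sM' M'M (- v); have := sublinear_opp v sM; ilra.
have MZ (t : R) u : 0 < t -> M (of_real k t *: u) = t * M u by move=> ?; exact: sublinear_scale.
split=> [u v|t u].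
  apply/eqP; rewrite eq_le sM.1 /=; have := sM.1 (- u) (- v).
  by rewrite -opprD !MO; ilra.
have [t0|t0|<-] := ltgtP 0 t; first exact: MZ.
- have -> : of_real k t = - of_real k (- t).
    by rewrite -mulN1r -of_realN1 -of_realM mulN1r opprK.
  by rewrite scaleNr MO MZ ?oppr_gt0// mulNr opprK.
- by rewrite of_real0 scale0r mul0r sublinear0.
Qed.

(** A scalar functional is recovered from its real part; over complex scalars
    this is [psi v - i psi (i v)]. *)
Lemma complexify N : real_linear N ->
  exists2 phi : V -> K, linear (phi : V -> K^o) & forall v, real_of (phi v) = N v.
Proof.
move: V N; rewrite /real_linear; case: k => /= W N [ND NZ].
  by exists N => // a u v; rewrite ND NZ.
have NO v : N (- v) = - N v.
  by rewrite -scaleN1r -[X in X *: _](rmorphN1 (real_complex R)) NZ mulN1r.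
exists (fun v => (N v +i* - N ('i%C *: v))%C) => //.
move=> [a b] u v.
rewrite -[X in _ = X + _]/((a +i* b)%C * (N u +i* - N ('i%C *: u))%C).
have E w : (a +i* b)%C *: w = (a%:C)%C *: w + (b%:C)%C *: ('i%C *: w).
  by rewrite scalerA -scalerDl; congr (_ *: _); simpc.
have I2 w : 'i%C *: ('i%C *: w) = - w.
  by rewrite scalerA -scaleN1r; congr (_ *: _); simpc.
have swapI (t : R) w : 'i%C *: ((t%:C)%C *: w) = (t%:C)%C *: ('i%C *: w).
  by rewrite !scalerA mulrC.
apply/eqP; rewrite eq_complex /=; apply/andP; split; apply/eqP.
  by rewrite ND E ND !NZ; ring.
rewrite scalerDr ND E scalerDr !swapI ND !NZ I2 NO.
by ring.
Qed.

Lemma linear_functionalD (phi : V -> K) u v : linear (phi : V -> K^o) ->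
  phi (u + v) = phi u + phi v.
Proof. by move=> lphi; have := lphi 1 u v; rewrite !scale1r. Qed.

Lemma linear_functional0 (phi : V -> K) : linear (phi : V -> K^o) -> phi 0 = 0.
Proof.
by move=> lphi; apply: (addrI (phi 0)); rewrite -linear_functionalD// !addr0.
Qed.

Lemma linear_functionalZ (phi : V -> K) a u : linear (phi : V -> K^o) ->
  phi (a *: u) = a * phi u.
Proof. by move=> lphi; have := lphi a u 0; rewrite !addr0 linear_functional0 ?addr0. Qed.

(** Multiply [v] by a scalar of modulus one that makes [phi v] nonnegative. *)
Lemma real_part_le (phi : V -> K) (p : V -> R) : linear (phi : V -> K^o) ->
  seminorm p -> (forall v, real_of (phi v) <= p v) ->
  forall v, rnorm (phi v : K^o) <= p v.
Proof.
move=> lphi sp phip v; have [c c1 cv] := rotate (phi v).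
have phiZ : phi (c *: v) = c * phi v by exact: linear_functionalZ.
have := phip (c *: v); rewrite phiZ cv /rnorm => /le_trans; apply.
by rewrite sp.2 ler_piMl// seminorm_ge0.
Qed.

(** The cone consists of the multiples of [v] with their values of [p]. *)
Lemma norming_functional (p : V -> R) v : seminorm p ->
  exists phi : V -> K, [/\ linear (phi : V -> K^o),
    forall u, rnorm (phi u : K^o) <= p u & p v <= rnorm (phi v : K^o)].
Proof.
move=> sp; have spl : sublinear p.
  split; first exact: sp.1.
  by move=> t u t0; rewrite sp.2 rnorm_of_real// ltW.
pose C w c := exists2 t, 0 <= t & w = of_real k t *: v /\ c = t * p v.
have [| | | |M [sM Mp /(_ v (p v)) h]] := @sublinear_cone p C spl.
- by exists 0; rewrite // of_real0 scale0r mul0r.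
- move=> _ _ _ _ [s s0 [-> ->]] [t t0 [-> ->]]; exists (s + t).
    by rewrite addr_ge0.
  by rewrite of_realD scalerDl mulrDl.
- move=> s _ _ s0 [t t0 [-> ->]]; exists (s * t); first by rewrite mulr_ge0 // ltW.
  by rewrite of_realM -scalerA mulrA.
- by move=> _ _ [t t0 [-> ->]]; rewrite sp.2 rnorm_of_real.
have {}h : M (- v) <= - p v by apply: h; exists 1; rewrite // of_real1 scale1r mul1r.
have [N lN NM] := hahn_banach sM; have [phi lphi phiN] := complexify lN.
exists phi; split=> //.
  by apply: real_part_le => // u; rewrite phiN (le_trans (NM u)).
rewrite (le_trans _ (real_of_le_rnorm _))// phiN.
have := NM (- v); have := lN.2 (-1) v; rewrite of_realN1 scaleN1r; ilra.
Qed.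

(** An additive form of the extension theorem: if [q] is a small multiple of a norm,
    [psi] is an approximation of [phi] that vanishes with [p]. It is a real
    functional between [Re phi - q] and [p] that has to be found, and the cone is the
    hypograph of [Re phi - q]. *)
Lemma split_functional (phi : V -> K) (p q : V -> R) :
  linear (phi : V -> K^o) -> seminorm p -> seminorm q ->
  (forall v, rnorm (phi v : K^o) <= p v + q v) ->
  exists psi : V -> K, [/\ linear (psi : V -> K^o),
    forall v, rnorm (psi v : K^o) <= p v & forall v, rnorm (phi v - psi v : K^o) <= q v].
Proof.
move=> lphi sp sq phipq; have spl : sublinear p.
  split; first exact: sp.1.
  by move=> t u t0; rewrite sp.2 rnorm_of_real// ltW.
pose C w c := c <= real_of (phi w) - q w.
have [| | | |M [sM Mp h]] := @sublinear_cone p C spl.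
- by rewrite /C linear_functional0// (seminorm0 sq) subr0; case: k.
- move=> v c w d; rewrite /C => Cv Cw; rewrite linear_functionalD// real_ofD.
  by have := sq.1 v w; ilra.
- move=> t v c t0; rewrite /C linear_functionalZ// real_of_of_realM sq.2.
  rewrite (rnorm_of_real (ltW t0)) -mulrBr.
  by rewrite ler_pM2l.
- move=> v c; rewrite /C => Cv; have := phipq v; have := real_of_le_rnorm (phi v).
  by ilra.
have [N lN NM] := hahn_banach sM; have [psi lpsi psiN] := complexify lN.
exists psi; split=> //.
  by apply: real_part_le => // u; rewrite psiN (le_trans (NM u)).
apply: real_part_le => //.
  by move=> a u v; rewrite lphi lpsi scalerBr opprD addrACA.
move=> v; have -> : real_of (phi v - psi v) = real_of (phi v) - real_of (psi v).
  by apply: (addIr (real_of (psi v))); rewrite -real_ofD !subrK.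
rewrite psiN; have := h v _ (lexx _); have := NM (- v).
have := lN.2 (-1) v; rewrite of_realN1 scaleN1r; ilra.
Qed.

End hahn_banach.
End scalars.

(** * Linear algebra and dual spaces *)

Section linear_algebra.
Context (K : numFieldType).

Lemma linear_hull_sub (V : lmodType K) (A S : set V) :
  linear_subspace S -> A `<=` S -> linear_hull A `<=` S.
Proof. by move=> SS AS v Hv; exact: (Hv S (conj SS AS)). Qed.

Lemma sub_linear_hull (V : lmodType K) (A : set V) : A `<=` linear_hull A.
Proof. by move=> v Av S [_ AS]; exact: AS. Qed.

Lemma linear_subspaceZ (V : lmodType K) (S : set V) a v :
  linear_subspace S -> S v -> S (a *: v).
Proof. by move=> [S0 SD] Sv; have := SD a v 0 Sv S0; rewrite addr0. Qed.

Lemma linear_subspace_sum (V : lmodType K) (S : set V) (I : Type) (s : seq I)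
    (v : I -> V) : linear_subspace S -> (forall i, S (v i)) -> S (\sum_(i <- s) v i).
Proof.
move=> SS Sv; elim: s => [|i s IH]; first by rewrite big_nil; exact: SS.1.
by rewrite big_cons -[v i]scale1r; exact: SS.2.
Qed.

Lemma linear_hull_cons (V : lmodType K) (c : V) (s : seq V) v :
  linear_hull [set` c :: s] v -> exists a u, linear_hull [set` s] u /\ v = a *: c + u.
Proof.
have [H0 HD] := linear_hull_subspace [set` s].
apply: (@linear_hull_sub _ _ [set v | exists a u, linear_hull [set` s] u /\ v = a *: c + u]);
  last first.
  move=> u /=; rewrite inE => /orP[/eqP ->|us].
    by exists 1, 0; rewrite scale1r addr0.
  by exists 0, u; rewrite scale0r add0r; split=> //; exact: sub_linear_hull.
split; first by exists 0, 0; rewrite scale0r addr0.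
move=> b _ _ [a [u [Hu ->]]] [a' [u' [Hu' ->]]].
exists (b * a + a'), (b *: u + u'); split; first exact: HD.
by rewrite scalerDr scalerA addrACA -scalerDl.
Qed.

Lemma linear_hull_mono (V : lmodType K) (A B : set V) :
  A `<=` B -> linear_hull A `<=` linear_hull B.
Proof.
move=> AB; apply: linear_hull_sub; first exact: linear_hull_subspace.
by move=> v /AB; exact: sub_linear_hull.
Qed.

(** A member of [S] outside the span of [s], if there is one, spans [S] together with
    the intersection of [S] and the span of [s]. *)
Lemma subspace_finite_dimensional (V : lmodType K) (s : seq V) (S : set V) :
  linear_subspace S -> S `<=` linear_hull [set` s] -> finite_dimensional S.
Proof.
elim: s S => [|c s IH] S SS Ss.
  exists [::]; apply/seteqP; split=> //.
  by apply: linear_hull_sub.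
have [S0 SD] := SS; have [H0 HD] := linear_hull_subspace [set` s].
have [|v [u1 u2]|t tE] := IH (S `&` linear_hull [set` s]); last first.
  have [Ssub|] := pselect (S `<=` linear_hull [set` s]).
    by exists t; rewrite -tE; apply/seteqP; split=> [v Sv|v []//]; split=> //; exact: Ssub.
  move=> /existsNP[w /not_implyP[Sw nw]].
  have [a [u [Hu wE]]] := linear_hull_cons (Ss _ Sw).
  have a0 : a != 0.
    by apply: contra_notN nw => /eqP a0; rewrite wE a0 scale0r add0r.
  exists (w :: t); apply/seteqP; split; last first.
    apply: linear_hull_sub => // v /=; rewrite inE => /orP[/eqP -> //|vt].
    suff : (S `&` linear_hull [set` s]) v by case.
    by rewrite tE; exact: sub_linear_hull.
  move=> v Sv; have [b [u' [Hu' vE]]] := linear_hull_cons (Ss _ Sv).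
  have ht : linear_hull [set` t] ((- (b / a)) *: w + v).
    rewrite -tE; split; first exact: SD.
    rewrite wE vE scalerDr scalerA mulNr divfK// addrA [_ + b *: c]addrAC.
    by rewrite -scalerDl addNr scale0r add0r; exact: HD.
  have -> : v = (b / a) *: w + ((- (b / a)) *: w + v).
    by rewrite addrA -scalerDl subrr scale0r add0r.
  have [_ HtD] := linear_hull_subspace [set` w :: t].
  apply: HtD; first by apply: sub_linear_hull; rewrite /= inE eqxx.
  by apply: linear_hull_mono ht => x /= xt; rewrite inE xt orbT.
- exact: u2.
- by split=> // a u v [Su Hu] [Sv Hv]; split; [exact: SD|exact: HD].
Qed.

(** With [B c u] the value of [u] at [c], this finds functionals among the evaluations.
    If [c] is not redundant, it is nonzero at some [e] annihilated by [s],
    and subtracting a multiple of [B c] from [phi] reduces the list to [s]. *)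
Lemma functional_in_span (V F : lmodType K) (B : F -> V -> K) (s : seq F)
    (phi : V -> K) :
  (forall c, linear (B c : V -> K^o)) -> (forall u, linear (B^~ u : F -> K^o)) ->
  linear (phi : V -> K^o) ->
  (forall u, (forall c, c \in s -> B c u = 0) -> phi u = 0) ->
  exists v, forall u, phi u = B v u.
Proof.
move=> lBV lBF.
elim: s phi => [|c s IH] phi lphi phi0.
  exists 0 => u; rewrite phi0//.
  by have := lBF u 1 0 0; rewrite scale1r addr0 scale1r => /eqP; rewrite -subr_eq subrr => /eqP.
have [cs|] := pselect (forall u, (forall d, d \in s -> B d u = 0) -> B c u = 0).
  apply: IH => // u us; apply: phi0 => d; rewrite inE => /orP[/eqP ->|/us//].
  exact: cs.
move=> /existsNP[e /not_implyP[es /eqP ce]].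
pose a := phi e / B c e.
have [||v vE] := IH (fun u => phi u - a * B c u).
- move=> b u v; rewrite lphi lBV scalerBr mulrDr opprD addrACA.
  by congr (_ - _ + _); rewrite mulrCA.
- move=> u us.
  have : phi ((- (B c u / B c e)) *: e + u) = 0.
    apply: phi0 => d; rewrite inE => /orP[/eqP ->|ds]; rewrite lBV.
      by rewrite /GRing.scale /= mulNr divfK// addNr.
    by rewrite (es _ ds) scaler0 add0r us.
  rewrite lphi /GRing.scale /= => h; rewrite -h addrC; congr (_ + _).
  by rewrite mulNr /a; congr (- _); ring.
- exists (a *: c + v) => u.
  by rewrite lBF -vE /GRing.scale /= addrC subrK.
Qed.

End linear_algebra.

Section dual_theory.
Context (R : realType) (k : scalar_kind).
Local Notation K := (scalar_field R k).
Context (F : normedModType K).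

Lemma dual_of_bounded (phi : F -> K) (M : R) : linear (phi : F -> K^o) -> 0 <= M ->
  (forall v, rnorm (phi v : K^o) <= M * rnorm v) ->
  exists2 psi : dual F, psi =1 phi & dual_norm psi <= M.
Proof.
move=> lin M0 phiM.
pose lf : {linear F -> K^o} := HB.pack (phi : F -> K^o)
  (GRing.isLinear.Build K F K^o _ (phi : F -> K^o) lin).
have phiP : (phi : F -> K^o) \in dual_pred F.
  rewrite inE; split=> //; apply: (bounded_linear_continuous (f := lf)).
  apply/linear_boundedP; exists (of_real k M).
  split; first by rewrite ger0_real// -of_real0 ler_of_real.
  move=> r /ltW rx f; rewrite (le_trans (y := of_real k M * `|f|))//; last first.
    by rewrite ler_wpM2r.
  by have := phiM f; rewrite -(ler_of_real k) of_realM !of_real_rnorm.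
exists (Dual phiP) => //; apply: ge_sup.
  by exists (rnorm (phi 0 : K^o)); exists 0 => //; rewrite /= rnorm0.
by move=> _ [v /= v1 <-]; rewrite (le_trans (phiM v))// ler_piMr.
Qed.

Lemma rnorm_dual (psi : dual F) : rnorm psi = dual_norm psi.
Proof. by rewrite /rnorm [`|psi|]/(of_real k (dual_norm psi)) of_realK. Qed.

Lemma dual_norm_ge0 (psi : dual F) : 0 <= dual_norm psi.
Proof. by rewrite -rnorm_dual rnorm_ge0. Qed.

Lemma dual_norm_le (psi : dual F) v : rnorm (psi v) <= dual_norm psi * rnorm v.
Proof.
have [->|v0] := eqVneq v 0; first by rewrite linear0 !rnorm0 mulr0.
have nv : 0 < rnorm v by rewrite rnorm_gt0.
rewrite -ler_pdivrMr// mulrC.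
have iv : 0 <= (rnorm v)^-1 by rewrite invr_ge0 ltW.
rewrite -(rnorm_scale_real _ iv) -linearZ; apply: dual_norm_ub.
by rewrite rnorm_scale_real// mulVf// gt_eqF.
Qed.

Lemma norming_dual (v : F) :
  exists2 psi : dual F, dual_norm psi <= 1 & rnorm v <= rnorm (psi v).
Proof.
have [phi [lphi phi1 phiv]] := norming_functional v (@rnorm_seminorm R k F).
have [|psi psiE psi1] := dual_of_bounded lphi ler01; first by move=> u; rewrite mul1r.
by exists psi; rewrite // psiE.
Qed.

(** Finite-dimensional subspaces are complemented: one vector is added at a
    time, by a functional that does not vanish on its part outside the span. *)
Lemma hull_projection (s : seq F) : exists t : seq (dual F * F),
  forall x, linear_hull [set` s] x -> \sum_(p <- t) p.1 x *: p.2 = x.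
Proof.
elim: s => [|w s [t tP]].
  exists [::] => x Hx; rewrite big_nil; apply/esym.
  by apply: (@linear_hull_sub _ _ _ [set 0]) Hx => //; split=> // a u v -> ->;
    rewrite scaler0 addr0.
pose P x := \sum_(p <- t) p.1 x *: p.2.
have lP a u v : P (a *: u + v) = a *: P u + P v.
  rewrite /P scaler_sumr -big_split /=; apply: eq_bigr => p _.
  by rewrite linearP scalerDl scalerA.
pose r := w - P w.
have [r0|r0] := eqVneq r 0.
  exists t => x /linear_hull_cons[a [u [Hu ->]]].
  by rewrite -/(P _) lP [P u]tP//; move/eqP: r0; rewrite subr_eq0 => /eqP <-.
have [psi _ psir] := norming_dual r.
have psir0 : psi r != 0.
  by rewrite -rnorm_gt0 (lt_le_trans _ psir)// rnorm_gt0.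
pose chi : dual F := (psi r)^-1 *: (psi - \sum_(p <- t) psi p.2 *: p.1).
have dsum (t' : seq (dual F * F)) x :
    (\sum_(p <- t') psi p.2 *: p.1 : dual F) x = \sum_(p <- t') psi p.2 * p.1 x.
  by elim: t' => [|p t' IH]; rewrite ?big_nil// !big_cons -IH.
have chiE x : chi x = (psi r)^-1 * psi (x - P x).
  rewrite -[LHS]/((psi r)^-1 * (psi x - (\sum_(p <- t) psi p.2 *: p.1 : dual F) x)).
  rewrite dsum; congr (_ * _); rewrite [RHS]linearB /= /P.
  rewrite [psi (\sum_(p <- t) _)]linear_sum /=; congr (_ - _).
  apply: eq_bigr => p _.
  by rewrite linearZ /= /GRing.scale /= mulrC.
clearbody chi; exists ((chi, r) :: t) => x /linear_hull_cons[a [u [Hu ->]]].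
rewrite big_cons /= -/(P _) chiE lP [P u]tP//.
have -> : a *: w + u - (a *: P w + u) = a *: r.
  by rewrite opprD addrACA subrr addr0 -scalerBr.
rewrite linearZ /= [a *: psi r]/(a * psi r) mulrCA mulVf// mulr1 /r scalerBr.
by rewrite addrA subrK.
Qed.

End dual_theory.

(** * Compactness *)

Section covers.

Lemma compact_finite_cover (T : topologicalType) (I : eqType) (U : I -> set T)
    (C : set T) : compact C -> (forall x, C x -> exists i, nbhs x (U i)) ->
  exists s : seq I, forall x, C x -> exists2 i, i \in s & U i x.
Proof.
move=> /compact_near_coveringP cC CU.
(* As lists grow, they eventually contain a neighbourhood index for each point. *)
pose G : set_system (seq I) :=
  filter_from setT (fun s : seq I => [set t : seq I | {subset s <= t}]).
have FG : Filter G.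
  apply: filter_from_filter; first by exists [::].
  move=> s t _ _; exists (s ++ t) => // r rs; split=> x xs; apply: rs;
    by rewrite mem_cat xs ?orbT.
have [|s _ sP] := cC _ G (fun s x => exists2 i, i \in s & U i x) FG.
  move=> x Cx; have [i Ui] := CU x Cx.
  exists (U i, [set t : seq I | {subset [:: i] <= t}]); first by split=> //; exists [:: i].
  by move=> [y t] /= [Uy it]; exists i => //; apply: it; rewrite inE.
by exists s => x Cx; exact: (sP s _ x Cx).
Qed.

End covers.

Section complex_norm.
Context (R : realType).
Local Notation C := ((scalar_field R ComplexScalars)^o).

Lemma normc_re (z : C) : `|complex.Re z| <= rnorm z.
Proof.
have := @real_of_le_rnorm R ComplexScalars z.
have := @real_of_le_rnorm R ComplexScalars (- z); rewrite rnormN.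
by case: z => a b /= h1 h2; rewrite ler_norml h2 lerNl h1.
Qed.

Lemma rnorm_i : rnorm ('i%C : C) = 1.
Proof. by rewrite /rnorm normc_def /= expr0n add0r expr1n sqrtr1. Qed.

Lemma normc_im (z : C) : `|complex.Im z| <= rnorm z.
Proof.
have -> : complex.Im z = complex.Re (- 'i%C * z) by case: z => a b; simpc.
apply: le_trans (normc_re _) _; rewrite -[X in rnorm X]/((- 'i%C) *: z).
by rewrite rnormZ rnormN rnorm_i mul1r.
Qed.

Lemma normc_le_re_im (z : C) : rnorm z <= `|complex.Re z| + `|complex.Im z|.
Proof.
have real_norm (a : R) : rnorm (a%:C%C : C) = `|a|.
  by rewrite /rnorm normc_def /= expr0n addr0 sqrtr_sqr.
have {1}-> : z = (complex.Re z)%:C%C + 'i%C *: ((complex.Im z)%:C%C : C).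
  by case: z => a b; rewrite /GRing.scale /=; simpc.
by rewrite (le_trans (rnormD _ _))// rnormZ rnorm_i mul1r !real_norm.
Qed.

End complex_norm.

Section scalar_compactness.
Context (R : realType) (k : scalar_kind).
Local Notation K := (scalar_field R k).

Lemma disc_compact (M : R) :
  exists2 D : set K^o, compact D & forall a : K^o, rnorm a <= M -> D a.
Proof.
have segD (a : R) : `|a| <= M -> `[- M, M]%classic a.
  by rewrite /= in_itv /= ler_norml.
case: k => /=.
  by exists `[- M, M]%classic; [exact: segment_compact|move=> a; exact: segD].
pose f (p : R * R) : R[i]^o := (p.1 +i* p.2)%C.
exists (f @` (`[- M, M]%classic `*` `[- M, M]%classic)); last first.
  move=> z zM; exists (complex.Re z, complex.Im z); last by case: z {zM}.
  by split; apply: segD; [exact: le_trans (normc_re z) zM|exact: le_trans (normc_im z) zM].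
apply: continuous_compact; last by apply: compact_setX; exact: segment_compact.
apply: continuous_subspaceT => -[a b].
have fE p : f p = p.1%:C%C + 'i%C * p.2%:C%C by rewrite /f; simpc.
have cR : continuous (real_complex R : R^o -> R[i]^o).
  move=> x; apply/cvgrPdist_lt => e e0.
  have e1 := @real_of_gt0 R ComplexScalars _ e0.
  apply/nbhs_ballP; exists (complex.Re e) => //= y xy.
  rewrite -rmorphB normc_def /= expr0n addr0 sqrtr_sqr.
  by rewrite -[e](@real_ofK R ComplexScalars) ?ltW// ltcR; exact: xy.
rewrite (_ : f = fun p => (real_complex R p.1 : R[i]^o) + 'i%C *: (real_complex R p.2 : R[i]^o)).
  apply: cvgD; last apply: cvgZr.
    by apply: continuous_cvg; [exact: cR|exact: cvg_fst].
  by apply: continuous_cvg; [exact: cR|exact: cvg_snd].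
exact/funext.
Qed.

End scalar_compactness.

Section normed_compactness.
Context (R : realType) (k : scalar_kind).
Local Notation K := (scalar_field R k).

Lemma abs_convexP (V : lmodType K) (A : set V) :
  (forall (a b : K) u v, rnorm (a : K^o) + rnorm (b : K^o) <= 1 -> A u -> A v ->
    A (a *: u + b *: v)) -> abs_convex A.
Proof.
move=> AP; split=> [|a v a1 Av]; last first.
  have := AP a 0 v v; rewrite rnorm0 addr0 scale0r addr0; apply=> //.
  by rewrite -(ler_of_real k) of_real_rnorm of_real1.
apply/convex_setW => u v; rewrite !inE => Au Av l l0 l1; rewrite inE /conv /=.
apply: AP => //; rewrite -(ler_of_real k) of_realD !of_real_rnorm of_real1.
rewrite !gtr0_norm ?subr_gt0//.
by rewrite /unstable.onem addrC subrK.
Qed.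

Lemma abs_convex_combP (V : lmodType K) (A : set V) (a b : K) u v :
  abs_convex A -> rnorm (a : K^o) + rnorm (b : K^o) <= 1 -> A u -> A v ->
  A (a *: u + b *: v).
Proof.
move=> acA ab; apply: abs_convex_comb => //.
by move: ab; rewrite -(ler_of_real k) of_realD !of_real_rnorm of_real1.
Qed.

Lemma nbhs_rnormP (F : normedModType K) (v : F) (A : set F) :
  nbhs v A <-> exists2 r : R, 0 < r & forall w, rnorm (v - w) < r -> A w.
Proof.
split=> [/nbhs_ballP[e /= e0 eA]|[r r0 rA]].
  exists (real_of e); first exact: real_of_gt0.
  by move=> w vw; apply/eA; rewrite -[e]real_ofK ?ltW//; apply/ball_rnorm.
apply/nbhs_ballP; exists (of_real k r); first by rewrite /= -of_real0 ltr_of_real.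
by move=> w /ball_rnorm; exact: rA.
Qed.

Lemma cvg_rnormP (F : normedModType K) (T : Type) (G : set_system T) (f : T -> F)
    (v : F) : Filter G ->
  f @ G --> v <-> forall r : R, 0 < r -> \forall t \near G, rnorm (v - f t) < r.
Proof.
move=> FG; split=> [fv r r0|fG A /nbhs_rnormP[r r0 rA]].
  by apply: (fv [set w | rnorm (v - w) < r]); apply/nbhs_rnormP; exists r.
by apply: filterS (fG r r0) => t; exact: rA.
Qed.

Lemma closure_rnormP (F : normedModType K) (v : F) (A : set F) :
  closure A v <-> forall r : R, 0 < r -> exists2 w, A w & rnorm (v - w) < r.
Proof.
split=> [clA r r0|clA B /nbhs_rnormP[r r0 rB]].
  have /clA[w [Aw vw]] : nbhs v [set w | rnorm (v - w) < r].
    by apply/nbhs_rnormP; exists r.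
  by exists w.
by have [w Aw vw] := clA r r0; exists w; split=> //; exact: rB.
Qed.

Lemma closure_abs_convex (F : normedModType K) (A : set F) :
  abs_convex A -> abs_convex (closure A).
Proof.
move=> acA; apply: abs_convexP => a b u v ab /closure_rnormP uA /closure_rnormP vA.
apply/closure_rnormP => r r0.
have [u' Au' uu'] := uA _ r0; have [v' Av' vv'] := vA _ r0.
exists (a *: u' + b *: v'); first exact: abs_convex_combP.
rewrite opprD addrACA -!scalerBr (le_lt_trans (rnormD _ _))// !rnormZ.
have a0 := rnorm_ge0 (a : K^o); have b0 := rnorm_ge0 (b : K^o).
have h1 := ler_wpM2l a0 (ltW uu'); have h2 := ler_wpM2l b0 (ltW vv').
have [a1|a1] := eqVneq (rnorm (a : K^o)) 0; last first.
  have a2 : 0 < rnorm (a : K^o) by rewrite lt_neqAle eq_sym a1.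
  have h3 : rnorm (a : K^o) * rnorm (u - u') < rnorm (a : K^o) * r by rewrite ltr_pM2l.
  by nra.
have [b1|b1] := eqVneq (rnorm (b : K^o)) 0; first by rewrite a1 b1 !mul0r addr0.
have b2 : 0 < rnorm (b : K^o) by rewrite lt_neqAle eq_sym b1.
have h3 : rnorm (b : K^o) * rnorm (v - v') < rnorm (b : K^o) * r by rewrite ltr_pM2l.
by nra.
Qed.

(** Ultrafilters on [closure A] are Cauchy: one that avoids all balls of radius [r]
    would, by compactness of [H], avoid the [r / 2]-neighbourhood of [H]. *)
Lemma approx_compact (F : completeNormedModType K) (A : set F) :
  (forall r : R, 0 < r -> exists2 H : set F, compact H &
    forall v, A v -> exists2 h : F, H h & rnorm (v - h) < r) ->
  compact (closure A).
Proof.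
move=> AH; rewrite compact_ultra => G UG GA.
have cG : cauchy G.
  apply: cauchy_exP => e e0; have r0 := real_of_gt0 e0.
  pose r := real_of e; rewrite -[e]real_ofK ?ltW// -/r.
  have r4 : 0 < r / 4 by rewrite divr_gt0.
  have [H cH HA] := AH _ r4.
  apply: contrapT => /forallNP noG.
  have GC x : G (~` ball x (of_real k r)).
    by have [/noG []|] := in_ultra_setVsetC (ball x (of_real k r)) UG.
  have /compact_near_coveringP ncH := cH.
  have GH : G [set v | forall x, H x -> r / 2 <= rnorm (v - x)].
    apply: (ncH F G (fun v x => r / 2 <= rnorm (v - x))) => x _.
    exists (ball x (of_real k (r / 2)), ~` ball x (of_real k r)).
      split; last exact: GC.
      by apply: nbhsx_ballx; rewrite -of_real0 ltr_of_real divr_gt0.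
    move=> [y v] /= [/ball_rnorm xy xv].
    have {}xv : r <= rnorm (x - v) by rewrite leNgt; apply/negP => /ball_rnorm.
    have := rnormD (x - y) (y - v); rewrite addrA subrK [rnorm (y - v)]rnorm_sub.
    by move: xy xv; clear; ilra.
  have [v [vA vH]] := filter_ex (filterI GA GH).
  have /closure_rnormP/(_ _ r4)[w Aw vw] := vA.
  have [h Hh wh] := HA w Aw.
  move: (vH h Hh) (rnormD (v - w) (w - h)) vw wh; rewrite addrA subrK; clear; ilra.
have /cvg_ex[v Gv] : cvg G by exact: cauchy_cvg.
exists v; split=> //.
apply: (@closed_closure _ A) => B /Gv GB.
by have [w []] := filter_ex (filterI GA GB); exists w.
Qed.

Fixpoint disc_span (V : lmodType K) (s : seq V) : set V :=
  if s is c :: s' then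
    [set v | exists a u, [/\ rnorm (a : K^o) <= 1, disc_span s' u & v = a *: c + u]]
  else [set 0].

Lemma disc_span_abs_convex (V : lmodType K) (s : seq V) : abs_convex (disc_span s).
Proof.
elim: s => [|c s IH]; apply: abs_convexP.
  by move=> a b u v _ -> ->; rewrite !scaler0 addr0.
move=> a b _ _ ab [a' [u [a'1 su ->]]] [b' [v [b'1 sv ->]]].
exists (a * a' + b * b'), (a *: u + b *: v); split.
- rewrite (le_trans _ ab)// (le_trans (@rnormD R k K^o _ _))//.
  by rewrite lerD// -[_ * _]/(_ *: (_ : K^o)) rnormZ ler_piMr// rnorm_ge0.
- exact: abs_convex_combP.
- by rewrite !scalerDr !scalerA addrACA -scalerDl.
Qed.

Lemma disc_span0 (V : lmodType K) (s : seq V) : disc_span s 0.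
Proof.
by elim: s => //= c s IH; exists 0, 0; rewrite rnorm0 scale0r addr0.
Qed.

Lemma disc_span_mem (V : lmodType K) (s : seq V) c : c \in s -> disc_span s c.
Proof.
elim: s => //= d s IH; rewrite inE => /orP[/eqP ->|/IH sc].
  exists 1, 0; rewrite scale1r addr0; split=> //; last exact: disc_span0.
  by rewrite -(of_real1 R k) rnorm_of_real.
by exists 0, c; rewrite rnorm0 scale0r add0r.
Qed.

Lemma disc_span_compact (F : normedModType K) (s : seq F) :
  exists2 H : set F, compact H & disc_span s `<=` H.
Proof.
elim: s => [|c s [H cH sH]]; first by exists [set 0] => //; exact: compact_set1.
have [D cD DP] := disc_compact k (1 : R).
exists ((fun p : K^o * F => p.1 *: c + p.2) @` (D `*` H)).
  apply: continuous_compact; last exact: compact_setX.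
  apply: continuous_subspaceT => p; apply: cvgD; last exact: cvg_snd.
  by apply: cvgZr_tmp; exact: cvg_fst.
by move=> _ [a [u [a1 su ->]]]; exists (a, u) => //; split; [exact: DP|exact: sH].
Qed.

(** Mazur's theorem for null sequences. The set [A] below contains the sequence
    and is, for each [N], as close to a disc of finite dimension as the tail
    after [N] is to zero. *)
Lemma null_sequence_hull (F : completeNormedModType K) (c : nat -> F) :
  (forall r : R, 0 < r -> exists N, forall n, (N <= n)%N -> rnorm (c n) <= r) ->
  exists2 C : set F, abs_convex_compact C & forall n, C (c n).
Proof.
move=> c0.
pose A : set F := [set v | forall N (r : R), 0 <= r ->
  (forall n, (N <= n)%N -> rnorm (c n) <= r) ->
  exists2 h, disc_span (mkseq c N) h & rnorm (v - h) <= r].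
exists (closure A); last first.
  move=> n; apply: subset_closure => N r r0 rN.
  have [nN|Nn] := ltnP n N.
    exists (c n); last by rewrite subrr rnorm0.
    by apply: disc_span_mem; apply/mapP; exists n; rewrite ?mem_iota.
  by exists 0; [exact: disc_span0|rewrite subr0; exact: rN].
split.
  apply: closure_abs_convex; apply: abs_convexP => a b u v ab Au Av N r r0 rN.
  have [h hN uh] := Au N r r0 rN; have [h' h'N vh'] := Av N r r0 rN.
  exists (a *: h + b *: h').
    exact: abs_convex_combP (disc_span_abs_convex _) ab hN h'N.
  rewrite opprD addrACA -!scalerBr (le_trans (rnormD _ _))// !rnormZ.
  rewrite (le_trans (y := (rnorm (a : K^o) + rnorm (b : K^o)) * r))//; last first.
    by rewrite ler_piMl.
  by rewrite mulrDl lerD// ler_wpM2l// rnorm_ge0.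
apply: approx_compact => r r0; have r2 : 0 < r / 2 by rewrite divr_gt0.
have [N NP] := c0 _ r2; have [H cH sH] := disc_span_compact (mkseq c N).
exists H => // v /(_ N _ (ltW r2) NP)[h /sH Hh vh]; exists h => //.
by rewrite (le_lt_trans vh)// ltr_pdivrMr// ltr_pMr// ltr1n.
Qed.

End normed_compactness.

(** * Closures for uniform convergence on families of sets *)

Section families.
Context (U : choiceType) (V : uniformType) (fam : set (set U)).
Context (D : set {family fam, U -> V}).

(** As the family is directed, the maps in [S] that are [E]-close to [u] on [A] form a
    filter base, which converges to [u]. *)
Lemma family_closure (S : set (set_type D)) (u : set_type D) :
  fam !=set0 -> (forall A B, fam A -> fam B -> exists2 C, fam C & A `|` B `<=` C) ->
  (forall A E, fam A -> entourage E ->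
    exists2 w, S w & forall x, A x -> E (set_val u x, set_val w x)) ->
  closure S u.
Proof.
move=> [A0 fA0] dfam SP B [_ [[W oW <-] Wu WB]].
pose G : set_system (U -> V) := filter_from
  [set AE : set U * set (V * V) | fam AE.1 /\ entourage AE.2]
  (fun AE => [set g | exists w, [/\ S w, g = set_val w &
    forall x, AE.1 x -> AE.2 (set_val u x, g x)]]).
have FG : Filter G.
  apply: filter_from_filter.
    by exists (A0, setT); split=> //=; exact: entourageT.
  move=> [A E] [A' E'] [/= fA eE] [/= fA' eE'].
  have [C fC ACC] := dfam _ _ fA fA'.
  exists (C, E `&` E'); first by split=> //=; exact: filterI.
  move=> g [w [Sw gw wP]]; split; exists w; split=> // x Ax.
    by have [] := wP x (ACC _ (or_introl Ax)).
  by have [] := wP x (ACC _ (or_intror Ax)).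
have Gu : G --> (set_val u : {family fam, U -> V}).
  apply/fam_cvgP => A fA P /uniform_nbhs[E [eE EP]].
  exists (A, E) => // g [w [_ _ wP]]; exact: EP.
have /Gu : nbhs (set_val u : {family fam, U -> V}) W by exact: open_nbhs_nbhs.
move=> [[A E] [/= fA eE] AEW].
have [w Sw wP] := SP A E fA eE.
exists w; split=> //; apply: WB; apply: AEW.
by exists w.
Qed.

Lemma closure_family (S : set (set_type D)) (u : set_type D) A E :
  closure S u -> fam A -> entourage E ->
  exists2 w, S w & forall x, A x -> E (set_val u x, set_val w x).
Proof.
move=> clS fA eE.
have := @fam_nbhs U V fam A E (set_val u) eE fA.
move=> /(@initial_continuous _ _ (set_val : set_type D -> {family fam, U -> V}) u).
by move=> /clS[w [Sw wP]]; exists w.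
Qed.

End families.

(** * Lipschitz functions and weighted slopes *)

Section half_powers.
Context (R : realType).

Lemma exp2_gt0 n : 0 < 2 ^+ n :> R.
Proof. exact: exprn_gt0. Qed.

Lemma half_power_le (r : R) : 0 < r ->
  exists N, forall n, (N <= n)%N -> 2 ^- n <= r.
Proof.
move=> r0; exists (Num.bound r^-1) => n /upper_nthrootP rn.
by rewrite -[r]invrK lef_pV2 ?posrE ?invr_gt0 ?exp2_gt0// ltW.
Qed.

End half_powers.

Section lipschitz.
Context (R : realType) (k : scalar_kind).
Local Notation K := (scalar_field R k).
Context (X : metricType R) (x0 : X).

Section vector_valued.
Context (F : normedModType K).
Implicit Types f g : lip0 x0 F.

Lemma lip_norm_ge0 f : 0 <= lip_norm f.
Proof. exact: (seminorm_ge0 _ (@lip_seminorm _ _ _ _ _)). Qed.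

Lemma slope_ge0 f z : 0 <= slope f z.
Proof. exact: (seminorm_ge0 f (@slope_seminorm _ _ _ _ _ z)). Qed.

Lemma slope_diag f z : z.1 = z.2 -> slope f z = 0.
Proof. by move=> z12; rewrite /slope z12 mdistxx invr0 mulr0. Qed.

Lemma slope_le_lip f z : slope f z <= lip_norm f.
Proof.
have [z12|z12] := eqVneq z.1 z.2; first by rewrite slope_diag// lip_norm_ge0.
by rewrite /slope ler_pdivrMr ?mdist_gt0// lip_norm_ub.
Qed.

Lemma slope_leP f x y (c : R) : slope f (x, y) <= c ->
  rnorm (f x - f y) <= c * mdist x y.
Proof.
have [->|xy] := eqVneq x y; first by rewrite subrr rnorm0 mdistxx mulr0.
by rewrite /slope /= ler_pdivrMr ?mdist_gt0.
Qed.

Lemma lip_norm_le f (c : R) : 0 <= c ->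
  (forall x y, rnorm (f x - f y) <= c * mdist x y) -> lip_norm f <= c.
Proof.
move=> c0 fc; rewrite /lip_norm; set D := image _ _.
have [->|/set0P D0] := eqVneq D set0; first by rewrite sup0.
apply: ge_sup => // _ [z /= z12 <-].
by rewrite /slope ler_pdivrMr ?mdist_gt0.
Qed.

Lemma mk_lip0 (h : X -> F) (c : R) : 0 <= c -> h x0 = 0 ->
  (forall x y, rnorm (h x - h y) <= c * mdist x y) ->
  exists2 f : lip0 x0 F, f =1 h & lip_norm f <= c.
Proof.
move=> c0 h0 hc.
have hP : h \in lip0_pred x0 F by rewrite inE; split=> //; exists c.
by exists (Lip0 hP) => //; exact: lip_norm_le.
Qed.

Definition null_weights (alpha : nat -> R) := (forall n, 0 < alpha n) /\
  forall r, 0 < r -> exists N, forall n, (N <= n)%N -> alpha n <= r.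

Lemma null_weights_cvg alpha : null_weights alpha <->
  (forall n, 0 < alpha n) /\ alpha @ \oo --> (0 : R).
Proof.
split=> -[a0 aN]; split=> //.
  apply/cvgrPdist_le => r /aN[N NP]; exists N => // n /= /NP.
  by rewrite sub0r normrN gtr0_norm.
move=> r r0; have /cvgrPdist_le/(_ r r0)[N _ NP] := aN.
by exists N => n /NP; rewrite sub0r normrN gtr0_norm.
Qed.

Lemma null_weights_bounded alpha : null_weights alpha ->
  exists2 A : R, 0 <= A & forall n, alpha n <= A.
Proof.
move=> [a0 /(_ 1 ltr01)[N NP]].
have S0 m : 0 <= \sum_(i < m) alpha i by apply: sumr_ge0 => i _; exact: ltW.
exists (1 + \sum_(i < N) alpha i); first by rewrite addr_ge0.
move=> n; have [nN|Nn] := ltnP n N; last by rewrite (le_trans (NP _ Nn))// lerDl.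
rewrite (bigD1 (Ordinal nN)) //= addrCA lerDl addr_ge0//.
by apply: sumr_ge0 => i _; exact: ltW.
Qed.

Context (alpha : nat -> R) (z : nat -> X * X) (nalpha : null_weights alpha).

Lemma weighted_slopes_has_ub f : has_ubound [set alpha n * slope f (z n) | n in [set: nat]].
Proof.
have [A A0 aA] := null_weights_bounded nalpha.
exists (A * lip_norm f) => _ [n _ <-].
by rewrite ler_pM ?slope_ge0 ?slope_le_lip// ltW// nalpha.1.
Qed.

Lemma le_weighted_slopes f n : alpha n * slope f (z n) <= weighted_slopes alpha z f.
Proof. by apply: ub_le_sup; [exact: weighted_slopes_has_ub|exists n]. Qed.

Lemma weighted_slopes_le f (c : R) :
  (forall n, alpha n * slope f (z n) <= c) -> weighted_slopes alpha z f <= c.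
Proof.
by move=> fc; apply: ge_sup; [exists (alpha 0%N * slope f (z 0%N)); exists 0%N|move=> _ [n _ <-]].
Qed.

Lemma weighted_slopes_seminorm : seminorm (@weighted_slopes R k X x0 F alpha z).
Proof.
apply: sup_seminorm => [n _|f]; last exact: weighted_slopes_has_ub.
split=> [f g|a f].
  by rewrite -mulrDr ler_pM2l ?nalpha.1// (@slope_seminorm R k X x0 F (z n)).1.
by rewrite (@slope_seminorm R k X x0 F (z n)).2 mulrCA.
Qed.

(** The defining seminorms of the topology use pairs of distinct points; the
    other pairs contribute zero and may be replaced, unless [X] is a point. *)
Lemma weighted_slopes_nbhs (e : R) : 0 < e ->
  exists2 A, lc_sets (gamma_tau_base x0 F) A &
    forall f, A f -> weighted_slopes alpha z f < e.
Proof.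
move=> e0; have [[p p12]|nd] := pselect (exists p : X * X, p.1 != p.2).
  pose z' n := if (z n).1 != (z n).2 then z n else p.
  exists [set f | forall q, q \in [:: weighted_slopes alpha z'] -> q f < e].
    exists [:: weighted_slopes alpha z'], e; split=> // q /=; rewrite inE => /eqP ->.
    have [a0 ac] := (null_weights_cvg alpha).1 nalpha.
    exists alpha, z'; split=> // n; rewrite /distinct_pairs /= /z'.
    by case: ifPn.
  move=> f /(_ _ (mem_head _ _)); apply: le_lt_trans.
  have [A A0 aA] := null_weights_bounded nalpha.
  have le n : alpha n * slope f (z' n) <= weighted_slopes alpha z' f.
    apply: ub_le_sup; last by exists n.
    exists (A * lip_norm f) => _ [m _ <-].
    by rewrite ler_pM ?slope_ge0 ?slope_le_lip// ltW// nalpha.1.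
  apply: weighted_slopes_le => n; apply: le_trans (le n); rewrite /z'.
  case: ifPn => // /negPn/eqP z12; rewrite slope_diag// mulr0.
  by rewrite mulr_ge0 ?slope_ge0// ltW// nalpha.1.
exists [set f | forall q : lip0 x0 F -> R, q \in [::] -> q f < e]; first by exists [::], e; split.
move=> f _; apply: le_lt_trans e0; apply: weighted_slopes_le => n.
rewrite slope_diag ?mulr0//; apply/eqP; apply: contra_notT nd => z12.
by exists (z n).
Qed.

End vector_valued.

(** The [j]-th pair of level [i] is listed at the code of [(i, j)], with weight
    [a / 2 ^ i]; the index [n] has weight [a / 2 ^ n] if it codes no pair. As levels are
    finite, the weights tend to zero. *)
Lemma enumerate_levels (a : R) (S : nat -> seq (X * X)) : 0 < a ->
  exists alpha z, null_weights alpha /\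
    forall i p, p \in S i -> exists2 n, z n = p & alpha n = a / 2 ^+ i.
Proof.
move=> a0.
pose code n : option (nat * nat) := pickle_inv n.
pose z n := if code n is Some ij then nth (x0, x0) (S ij.1) ij.2 else (x0, x0).
pose level n := if code n is Some ij then
  if (ij.2 < size (S ij.1))%N then ij.1 else n else n.
have codeK ij : code (pickle ij) = Some ij by rewrite /code pickleK_inv.
exists (fun n => a / 2 ^+ level n), z; split; last first.
  move=> i p pS; exists (pickle (i, index p (S i))).
    by rewrite /z codeK /= nth_index.
  by rewrite /level codeK /= index_mem pS.
split=> [n|r r0]; first by rewrite divr_gt0// exp2_gt0.
have [I IP] := half_power_le (divr_gt0 r0 a0).
have aI n : (I <= n)%N -> a / 2 ^+ n <= r.
  by move=> /IP; rewrite ler_pdivlMr// mulrC.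
pose B := \max_(i < I) \max_(j < size (S i)) pickle (i : nat, j : nat).
exists (maxn I B.+1) => n; rewrite geq_max => /andP[In Bn]; apply: aI.
rewrite /level; case codeE : (code n) => [[i j]|//] /=; case: ifPn => // jS.
rewrite leqNgt; apply/negP => iI; move: Bn; rewrite ltnNge => /negP; apply.
have <- : pickle (i, j) = n by have := @pickle_invK (nat * nat)%type n; rewrite -/(code n) codeE.
apply: leq_trans (leq_bigmax (Ordinal iI)).
exact: leq_trans (leq_bigmax (Ordinal jS)).
Qed.


End lipschitz.

(** * The mixed topology *)

Section mcshane.
Context (R : realType) (X : metricType R).

Lemma mcshane_real (S : seq X) (s0 : X) (f : X -> R) (c : R) : s0 \in S -> 0 <= c ->
  (forall x y, x \in S -> y \in S -> `|f x - f y| <= c * mdist x y) ->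
  exists2 h : X -> R, (forall x, x \in S -> h x = f x) &
    forall x y, `|h x - h y| <= c * mdist x y.
Proof.
move=> s0S c0 fS; pose E x : set R := [set f s + c * mdist x s | s in [set` S]].
have tri (x y z : X) : c * mdist x z <= c * mdist x y + c * mdist y z.
  by rewrite -mulrDr ler_wpM2l// metric_triangle.
have sym (x y : X) : c * mdist x y = c * mdist y x by rewrite metric_sym.
have fS' x y : x \in S -> y \in S -> f x - f y <= c * mdist x y.
  by move=> xS yS; rewrite (le_trans (ler_norm _))// fS.
have nE x : E x !=set0 by exists (f s0 + c * mdist x s0), s0.
have bE x : has_lbound (E x).
  exists (f s0 - c * mdist x s0) => _ [s /= sS <-].
  by have := fS' _ _ s0S sS; have := tri s0 x s; rewrite (sym s0 x); ilra.
have le x s : s \in S -> inf (E x) <= f s + c * mdist x s.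
  by move=> sS; apply: ge_inf => //; exists s.
exists (fun x => inf (E x)) => [x xS|x y].
  apply/eqP; rewrite eq_le; apply/andP; split.
    by have := le x x xS; rewrite mdistxx mulr0 addr0.
  apply: lb_le_inf => // _ [s /= sS <-].
  by have := fS' _ _ xS sS; ilra.
have half (a b : X) : inf (E a) - inf (E b) <= c * mdist a b.
  rewrite lerBlDr -lerBlDl; apply: lb_le_inf => // _ [s /= sS <-].
  by have := le a s sS; have := tri a b s; ilra.
by rewrite ler_norml half andbT; have := half y x; rewrite (sym y); ilra.
Qed.

(** Real and imaginary parts are extended separately, which costs the factor [2]. *)
Lemma mcshane (k : scalar_kind) (S : seq X) (s0 : X) (f : X -> (scalar_field R k)^o)
    (c : R) : s0 \in S -> 0 <= c ->
  (forall x y, x \in S -> y \in S -> rnorm (f x - f y) <= c * mdist x y) ->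
  exists2 h : X -> (scalar_field R k)^o, (forall x, x \in S -> h x = f x) &
    forall x y, rnorm (h x - h y) <= 2 * c * mdist x y.
Proof.
case: k f => f s0S c0 fS.
  have [h hf hc] := mcshane_real s0S c0 fS; exists h => // x y.
  rewrite -mulrA mulr_natl mulr2n (le_trans (hc x y))// lerDl.
  by rewrite mulr_ge0 ?mdist_ge0.
have [|h1 h1f h1c] := @mcshane_real S s0 (fun x => complex.Re (f x)) c s0S c0.
  move=> x y xS yS; apply: le_trans (fS x y xS yS).
  by rewrite -raddfB /= normc_re.
have [|h2 h2f h2c] := @mcshane_real S s0 (fun x => complex.Im (f x)) c s0S c0.
  move=> x y xS yS; apply: le_trans (fS x y xS yS).
  by rewrite -raddfB /= normc_im.
exists (fun x => (h1 x +i* h2 x)%C) => [x xS|x y].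
  by rewrite h1f// h2f//; case: (f x).
apply: le_trans (normc_le_re_im _) _; rewrite -mulrA mulr_natl mulr2n.
by apply: lerD; [exact: h1c|exact: h2c].
Qed.

End mcshane.

Section mixed_topology.
Context (R : realType) (k : scalar_kind).
Local Notation K := (scalar_field R k).
Context (X : metricType R) (x0 : X).
Local Notation L := (lip0 x0 (K^o : normedModType K)).

(** A compact set has a finite net, and functions with a common Lipschitz constant
    that are small on a fine enough net are small on the whole set. *)
Lemma tau0_finite (U : set L) (M : R) : tau0_nbhs0 U ->
  exists (S : seq X) (d : R), 0 < d /\ forall g : L, lip_norm g <= M ->
    (forall x, x \in S -> rnorm (g x) <= d) -> U g.
Proof.
move=> /tau0_nbhs0P[W nW WU].
pose G : set_system L := filter_from [set Sd : seq X * R | 0 < Sd.2]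
  (fun Sd => [set g | lip_norm g <= M /\ forall x, x \in Sd.1 -> rnorm (g x) <= Sd.2]).
have FG : Filter G.
  apply: filter_from_filter; first by exists ([::], 1) => /=.
  move=> [S d] [T e] /= d0 e0; exists (S ++ T, Num.min d e) => /=.
    by rewrite lt_min d0.
  move=> g [gM gS]; split; split=> // x xS.
    by have := gS x; rewrite mem_cat xS le_min => /(_ isT)/andP[].
  by have := gS x; rewrite mem_cat xS orbT le_min => /(_ isT)/andP[].
have : (@lip0_fun R k X x0 K^o @ G) --> (cst 0 : {family compact, X -> K^o}).
  apply: fam0_cvg => A e cA e0; have r0 := real_of_gt0 e0.
  have M1 : 0 < `|M| + 1 by rewrite ltr_wpDl.
  pose r := real_of e / 2 / (`|M| + 1).
  have rp : 0 < r by rewrite !divr_gt0.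
  have [x _|S SP] := @compact_finite_cover X X (fun y => [set x | mdist y x < r]) A cA.
    exists x; apply/nbhs_ballP; exists r => // y; by rewrite ballEmdist.
  exists (S, real_of e / 2); first by rewrite /= divr_gt0.
  move=> g [gM gS] x /SP[y yS /= yx].
  rewrite -of_real_rnorm -[e]real_ofK ?ltW// ltr_of_real.
  rewrite -[g x](subrK (g y)) (le_lt_trans (rnormD _ _))//.
  rewrite [ltRHS]splitr ltr_leD ?gS//.
  rewrite (le_lt_trans (lip_norm_ub _ _ _))// metric_sym.
  rewrite (le_lt_trans (y := (`|M| + 1) * mdist y x))//.
    by rewrite ler_wpM2r ?mdist_ge0// (le_trans gM)// (le_trans (ler_norm _))// lerDl.
  by rewrite mulrC -ltr_pdivlMr.
move=> /(_ W nW)[[S d] /= d0 SW]; exists S, d; split=> // g gM gS.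
by apply: WU; apply: (SW g).
Qed.

Lemma quarters (p : R) : 0 < p -> 2 * p / 4 + p / 4 <= p.
Proof. ilra. Qed.

Lemma half_quarter (p : R) : 0 < p -> p / 2 + p / 4 <= p.
Proof. ilra. Qed.

(** Let [f|_T_i] be extended to [h_i] with a constant of order [2 ^ i], where [T_i] is
    a finite net for the [i]-th constraint; it is enough to control the slopes of [f] at
    the pairs from each [T_i]. Then [f = sum (h_(i+1) - h_i)], a finite sum
    as [f] itself has some constant [2 ^ N], and [h_(i+1) - h_i] vanishes on
    [T_i]. The first term is [h_1], small on [T_0] as [f] is. *)
Theorem mixed_nbhs_weighted (W : set L) : mixed_sets k x0 W ->
  exists alpha z, null_weights alpha /\
    forall f : L, weighted_slopes alpha z f < 1 -> W f.
Proof.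
move=> [U [gU ->]].
have /choice[Sd SdP] : forall i, exists Sd : seq X * R, 0 < Sd.2 /\
    forall g : L, lip_norm g <= 2 ^+ i ->
      (forall x, x \in Sd.1 -> rnorm (g x) <= Sd.2) -> U i g.
  by move=> i; have [S [d dP]] := tau0_finite (2 ^+ i) (gU i).2; exists (S, d).
pose fix T i := if i is j.+1 then (Sd i).1 ++ T j else x0 :: (Sd 0%N).1.
have T0 i : x0 \in T i by elim: i => [|i IH]; rewrite ?mem_head//= mem_cat IH orbT.
have TS i x : x \in (Sd i).1 -> x \in T i.
  by case: i => [|i] /= xS; rewrite ?inE ?mem_cat xS ?orbT.
have Tm i x : x \in T i -> x \in T i.+1 by move=> xT; rewrite /= mem_cat xT orbT.
pose d0 := (Sd 0%N).2; have d0p : 0 < d0 by have [] := SdP 0%N.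
(* [8 <= a] bounds the constant of [h_i] by [2 ^ i / 4], and the sum makes [f] smaller
   than [d0] on the first net. *)
pose a : R := 8 + \sum_(x <- (Sd 0%N).1) mdist x x0 / d0.
have sum0 (s : seq X) : 0 <= \sum_(x <- s) mdist x x0 / d0.
  by apply: sumr_ge0 => x _; rewrite divr_ge0 ?mdist_ge0// ltW.
have a8 : 8 <= a by rewrite lerDl.
have ap : 0 < a by rewrite (lt_le_trans _ a8).
have ad x : x \in (Sd 0%N).1 -> mdist x x0 / a <= d0.
  move=> xS; rewrite ler_pdivrMr// mulrC -ler_pdivrMr//.
  rewrite /a (perm_big _ (perm_to_rem xS)) /= big_cons addrCA lerDl.
  by rewrite addr_ge0.
have [alpha [z [nalpha az]]] := enumerate_levels x0
  (fun i => [seq (x, y) | x <- T i, y <- T i]) ap.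
exists alpha, z; split=> // f fW.
pose c i : R := 2 ^+ i / a.
have c0 i : 0 <= c i by rewrite divr_ge0 ?exprn_ge0// ltW.
have fT i x y : x \in T i -> y \in T i -> rnorm (f x - f y) <= c i * mdist x y.
  move=> xT yT; apply: slope_leP.
  have [|n zn an] := az i (x, y); first exact: allpairs_f.
  have := le_lt_trans (le_weighted_slopes z nalpha f n) fW.
  rewrite zn an => /ltW; rewrite mulrC -ler_pdivlMr ?divr_gt0 ?exp2_gt0//.
  by rewrite mul1r invf_div.
have /choice[h hP] : forall i, exists h : L,
    (forall x, x \in T i -> h x = f x) /\ lip_norm h <= 2 * c i.
  move=> i; have [h hf hc] := @mcshane R X k (T i) x0 f (c i) (T0 i) (c0 i) (fT i).
  have [||g gh gc] := @mk_lip0 R k X x0 K^o h (2 * c i) _ _ hc.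
  - by rewrite mulr_ge0.
  - by rewrite hf// lip0_base.
  - by exists g; split=> // x xT; rewrite gh hf.
have c4 i : 2 * c i <= 2 ^+ i / 4.
  rewrite /c mulrCA ler_wpM2l ?exprn_ge0// ler_pdivrMr// mulrC.
  by rewrite ler_pdivlMr//; move: a8; ilra.
pose N := (Num.bound (lip_norm f)).+1.
have fN : lip_norm f <= 2 ^+ N / 2.
  by rewrite exprS mulrC mulKf ?pnatr_eq0// ltW// upper_nthrootP.
pose H i := if i == 0%N then 0 else if (i <= N)%N then h i else f.
have HN : H N.+1 = f by rewrite /H /= ltnn.
exists N, (fun i : 'I_N.+1 => H i.+1 - H i); split; last first.
  rewrite -(big_mkord xpredT (fun i => H i.+1 - H i)) telescope_sumr//.
  by rewrite HN /H eqxx subr0.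
have lipB (g g' : L) : lip_norm (g - g') <= lip_norm g + lip_norm g'.
  have [lD lZ] := @lip_seminorm R k X x0 K^o; rewrite (le_trans (lD _ _))//.
  by rewrite -scaleN1r lZ rnormN1 mul1r.
have p2 i := exp2_gt0 R i.
move=> [i iN]; rewrite -[nat_of_ord _]/i.
have lipH : lip_norm (H i.+1 - H i) <= 2 ^+ i.
  rewrite /H /=; case: i iN => [|i] iN /=.
    rewrite subr0 (le_trans (hP 1%N).2)// (le_trans (c4 1%N))//.
    by rewrite expr1 expr0 ler_pdivrMr// mul1r ler_nat.
  have iN' : (i.+1 <= N)%N := iN.
  rewrite iN' /=; apply: le_trans (lipB _ _) _.
  have h1 := le_trans (hP i.+1).2 (c4 i.+1).
  case: ifPn => [_|].
    apply: le_trans (lerD (le_trans (hP i.+2).2 (c4 i.+2)) h1) _.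
    by rewrite [2 ^+ i.+2]exprS; exact: quarters.
  rewrite -ltnNge ltnS => Ni; have NE : N = i.+1 by apply/eqP; rewrite eqn_leq Ni.
  by apply: le_trans (lerD fN h1) _; rewrite NE; exact: half_quarter.
split=> //; apply: (SdP i).2 => // x xS.
have xT := TS _ _ xS; rewrite -[(H _ - H _) x]/(H i.+1 x - H i x).
clear lipH; rewrite /H /=; case: i iN xS xT => [|i] iN xS xT /=.
  rewrite (hP 1%N).1; last exact: Tm.
  rewrite subr0; have := fT 0%N x x0 xT (T0 0%N); rewrite lip0_base subr0.
  move=> /le_trans; apply.
  by rewrite /c expr0 mulrC mulrA mulr1 ad.
have iN' : (i.+1 <= N)%N := iN.
rewrite iN' (hP i.+1).1//.
case: ifPn => _; first by rewrite (hP i.+2).1 ?subrr ?rnorm0 ?ltW ?(SdP _).1//; exact: Tm.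
by rewrite subrr rnorm0 ltW// (SdP _).1.
Qed.

End mixed_topology.

Section mixed_continuity.
Context (R : realType) (k : scalar_kind).
Local Notation K := (scalar_field R k).
Context (X : metricType R) (x0 : X).
Local Notation L := (lip0 x0 (K^o : normedModType K)).

Lemma rnorm_lip0 (F : normedModType K) (f : lip0 x0 F) : rnorm f = lip_norm f.
Proof. by rewrite /rnorm [`|f|]/(of_real k (lip_norm f)) of_realK. Qed.

Lemma seminorm_sum (V : lmodType K) (p : V -> R) (I : Type) (s : seq I) (v : I -> V) :
  seminorm p -> p (\sum_(i <- s) v i) <= \sum_(i <- s) p (v i).
Proof.
move=> sp; elim: s => [|i s IH]; first by rewrite !big_nil seminorm0.
by rewrite !big_cons (le_trans (sp.1 _ _))// lerD2l.
Qed.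

Lemma small_on_abs_convex (S : seq X) (d : R) :
  abs_convex [set g : L | forall x, x \in S -> rnorm (g x) <= d].
Proof.
apply: abs_convexP => a b f g ab fS gS x xS.
rewrite -[X in rnorm X]/(a *: f x + b *: g x) (le_trans (rnormD _ _))// !rnormZ.
have d0 : 0 <= d by rewrite (le_trans _ (fS x xS))// rnorm_ge0.
rewrite (le_trans (y := (rnorm (a : K^o) + rnorm (b : K^o)) * d)) ?ler_piMl//.
by rewrite mulrDl lerD// ler_wpM2l ?rnorm_ge0 ?fS ?gS.
Qed.

Lemma small_on_tau0 (S : seq X) (d : R) : 0 < d ->
  tau0_nbhs0 [set g : L | forall x, x \in S -> rnorm (g x) <= d].
Proof.
move=> d0; have dK : 0 < of_real k d by rewrite -of_real0 ltr_of_real.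
apply/tau0_nbhs0P; exists [set g : X -> K^o | forall x, [set` S] x -> `|g x| < of_real k d].
  by apply: fam0_nbhs => //; apply: finite_compact; exact: finite_seq.
move=> f fS x xS; have := fS x xS.
by rewrite -of_real_rnorm ltr_of_real => /ltW.
Qed.

Lemma mixed_nbhs_single (U : nat -> set L) n g :
  (forall i, abs_convex (U i) /\ tau0_nbhs0 (U i)) ->
  U n g -> lip_norm g <= 2 ^+ n -> mixed_nbhs U g.
Proof.
move=> gU Ug gn; exists n, (fun i : 'I_n.+1 => if i == n :> nat then g else 0); split.
  move=> i; case: eqP => [->//|_]; split; first exact: nbhs_singleton (gU i).2.
  by rewrite (seminorm0 (@lip_seminorm _ _ _ _ _)) exprn_ge0.
rewrite big_ord_recr /= eqxx big1 ?add0r// => i _.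
by rewrite ltn_eqF.
Qed.

(** The point of a mixed topology: seminorms that are [tau_0]-continuous on
    bounded sets are continuous, as the error [e] can be spread over the terms
    of [f = sum g_i], with [e / 2 ^ (i + 1)] for [g_i]. *)
Lemma mixed_small (P : set (L -> R)) (e : R) : 0 < e ->
  (forall p, P p -> seminorm p) ->
  (forall M r : R, 0 < r -> exists (S : seq X) (d : R), 0 < d /\
    forall g : L, lip_norm g <= M -> (forall x, x \in S -> rnorm (g x) <= d) ->
    forall p, P p -> p g <= r) ->
  exists2 W, mixed_sets k x0 W & forall f, W f -> forall p, P p -> p f <= e.
Proof.
move=> e0 sP PS.
have /choice[Sd SdP] : forall i : nat, exists Sd : seq X * R, 0 < Sd.2 /\
    forall g : L, lip_norm g <= 2 ^+ i ->
      (forall x, x \in Sd.1 -> rnorm (g x) <= Sd.2) ->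
      forall p, P p -> p g <= e / 2 ^+ i.+1.
  move=> i; have [|S [d dP]] := PS (2 ^+ i) (e / 2 ^+ i.+1).
    by rewrite divr_gt0 ?exp2_gt0.
  by exists (S, d).
pose U i : set L := [set g : L | forall x, x \in (Sd i).1 -> rnorm (g x) <= (Sd i).2].
exists (mixed_nbhs U).
  exists U; split=> // i; split; first exact: small_on_abs_convex.
  by apply: small_on_tau0; have [] := SdP i.
move=> _ [n [g [gP ->]]] p Pp.
apply: le_trans (seminorm_sum _ _ (sP _ Pp)) _.
apply: (@le_trans _ _ (\sum_(i < n.+1) e / 2 ^+ i.+1)).
  by apply: ler_sum => i _; have [Ui gi] := gP i; apply: (SdP i).2.
suff -> : \sum_(i < n.+1) e / 2 ^+ i.+1 = e - e / 2 ^+ n.+1.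
  by rewrite gerBl divr_ge0 ?exprn_ge0// ltW.
elim: n {g gP} => [|n IH]; first by rewrite big_ord_recr big_ord0 /= expr1; field.
rewrite big_ord_recr /= IH [2 ^+ n.+2]exprS.
by field; rewrite ?expf_neq0// pnatr_eq0.
Qed.

(** On a bounded set, the slopes with small weights are negligible. *)
Lemma weighted_slopes_mixed alpha z (e : R) : null_weights alpha -> 0 < e ->
  exists2 W, mixed_sets k x0 W & forall f : L, W f -> weighted_slopes alpha z f <= e.
Proof.
move=> nalpha e0.
have [|M r r0|W mW WP] := @mixed_small [set weighted_slopes alpha z] e e0; last first.
- by exists W => // f Wf; exact: WP.
- have M1 : 0 < `|M| + 1 by rewrite ltr_wpDl.
  have [N NP] := nalpha.2 _ (divr_gt0 r0 M1).
  pose D := \sum_(n < N) 2 * alpha n / mdist (z n).1 (z n).2.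
  have D0 (n : nat) : 0 <= 2 * alpha n / mdist (z n).1 (z n).2.
    by rewrite divr_ge0 ?mdist_ge0// mulr_ge0// ltW// nalpha.1.
  have D1 : 0 < D + 1 by rewrite ltr_wpDl// sumr_ge0.
  exists ([seq (z n).1 | n <- iota 0 N] ++ [seq (z n).2 | n <- iota 0 N]), (r / (D + 1)).
  split; first by rewrite divr_gt0.
  move=> g gM gS _ ->; apply: weighted_slopes_le => n.
  have [nN|Nn] := ltnP n N.
    have g12 : rnorm (g (z n).1 - g (z n).2) <= 2 * (r / (D + 1)).
      rewrite (le_trans (ler_rnormB _ _))// mulr_natl mulr2n lerD// gS// mem_cat.
        by apply/orP; left; apply/mapP; exists n; rewrite ?mem_iota.
      by apply/orP; right; apply/mapP; exists n; rewrite ?mem_iota.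
    apply: (@le_trans _ _ (2 * alpha n / mdist (z n).1 (z n).2 * (r / (D + 1)))).
      have -> : 2 * alpha n / mdist (z n).1 (z n).2 * (r / (D + 1)) =
          alpha n * ((2 * (r / (D + 1))) / mdist (z n).1 (z n).2) by ring.
      rewrite ler_wpM2l ?(ltW (nalpha.1 n))// /slope ler_wpM2r//.
      by rewrite invr_ge0 mdist_ge0.
    rewrite mulrA ler_pdivrMr// mulrC ler_wpM2l ?ltW//.
    rewrite /D (bigD1 (Ordinal nN)) //= ltr_pwDr// lerDl.
    by rewrite sumr_ge0.
  apply: (@le_trans _ _ (r / (`|M| + 1) * (`|M| + 1))); last by rewrite divfK// gt_eqF.
  rewrite ler_pM ?slope_ge0 ?NP// ?(ltW (nalpha.1 n))//.
  rewrite (le_trans (slope_le_lip _ _))// (le_trans gM)//.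
  by rewrite (le_trans (ler_norm _))// lerDl.
- by move=> _ ->; exact: weighted_slopes_seminorm.
Qed.

Lemma span_delta_small (m : dual L) : linear_hull (range (@delta R k X x0)) m ->
  forall r : R, 0 < r -> exists (S : seq X) (d : R), 0 < d /\
    forall g : L, (forall x, x \in S -> rnorm (g x) <= d) -> rnorm (m g) <= r.
Proof.
pose T := [set m : dual L | forall r : R, 0 < r -> exists (S : seq X) (d : R), 0 < d /\
    forall g : L, (forall x, x \in S -> rnorm (g x) <= d) -> rnorm (m g) <= r].
apply: (@linear_hull_sub _ _ _ T); last first.
  move=> _ [x _ <-] r r0; exists [:: x], r; split=> // g; apply.
  by rewrite inE.
split=> [r r0|a u v uT vT r r0].
  by exists [::], 1; split=> // g _; rewrite -[X in rnorm X]/(0 : K^o) rnorm0 ltW.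
have a1 : 0 < rnorm (a : K^o) + 1 by rewrite ltr_wpDl// rnorm_ge0.
have r2 : 0 < r / 2 by rewrite divr_gt0.
have [S [d [d0 SP]]] := uT _ (divr_gt0 r2 a1).
have [S' [d' [d'0 SP']]] := vT _ r2.
exists (S ++ S'), (Num.min d d'); split; first by rewrite lt_min d0.
move=> g gS; rewrite -[X in rnorm X]/(a *: u g + v g) (le_trans (rnormD _ _))//.
rewrite [leRHS]splitr lerD//; last first.
  by apply: SP' => x xS; have := gS x; rewrite mem_cat xS orbT le_min => /(_ isT)/andP[].
rewrite rnormZ (le_trans (y := (rnorm (a : K^o) + 1) * (r / 2 / (rnorm (a : K^o) + 1))))//.
  rewrite ler_pM ?rnorm_ge0 ?lerDl// SP// => x xS.
  by have := gS x; rewrite mem_cat xS le_min => /(_ isT)/andP[].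
by rewrite mulrC divfK// gt_eqF.
Qed.

Lemma rnorm_lipfree (m : lipfree k x0) : rnorm m = dual_norm (lipfree_val m).
Proof. by rewrite /rnorm [`|m|]/(of_real k (dual_norm (lipfree_val m))) of_realK. Qed.

(** Up to a small error in norm, the members of [C] are finitely many combinations of
    evaluations. *)
Lemma lipfree_compact_mixed (C : set (lipfree k x0)) (e : R) : compact C -> 0 < e ->
  exists2 W, mixed_sets k x0 W &
    forall f : L, W f -> forall m, C m -> rnorm (lipfree_val m f) <= e.
Proof.
move=> cC e0.
have [|M r r0|W mW WP] := @mixed_small
  [set (fun f : L => rnorm (lipfree_val m f)) | m in C] e e0; last first.
- by exists W => // f Wf m Cm; apply: (WP f Wf (fun f => rnorm (lipfree_val m f))); exists m.
- have M1 : 0 < `|M| + 1 by rewrite ltr_wpDl.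
  have r2 : 0 < r / 2 by rewrite divr_gt0.
  pose rho := r / 2 / (`|M| + 1); have rho0 : 0 < rho by rewrite divr_gt0.
  pose U (i : dual L) : set (lipfree k x0) := [set m |
    linear_hull (range (@delta R k X x0)) i /\ rnorm (lipfree_val m - i) < rho].
  have [m Cm|s sP] := @compact_finite_cover _ (dual L) U C cC.
    have /set_mem/closure_rnormP/(_ _ rho0)[i Hi mi] := valP m.
    exists i; apply/nbhs_rnormP; exists (rho - rnorm (lipfree_val m - i)).
      by rewrite subr_gt0.
    move=> m' mm'; split; first exact: Hi.
    rewrite -[lipfree_val m'](subrK (lipfree_val m)) -addrA.
    apply: le_lt_trans (rnormD _ _) _; rewrite -ltrBrDr rnorm_sub.
    exact: mm'.
  have [S [d [d0 SP]]] : exists (S : seq X) (d : R), 0 < d /\ forall i, i \in s ->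
      linear_hull (range (@delta R k X x0)) i ->
      forall g : L, (forall x, x \in S -> rnorm (g x) <= d) -> rnorm (i g) <= r / 2.
    elim: s {sP} => [|i s [S [d [d0 SP]]]]; first by exists [::], 1.
    have [Hi|nHi] := pselect (linear_hull (range (@delta R k X x0)) i); last first.
      exists S, d; split=> // j; rewrite inE => /orP[/eqP -> //|js]; exact: SP.
    have [S' [d' [d'0 SP']]] := span_delta_small Hi r2.
    exists (S' ++ S), (Num.min d' d); split; first by rewrite lt_min d'0.
    move=> j; rewrite inE => js Hj g gS.
    have gS' x : x \in S' -> rnorm (g x) <= d'.
      by move=> xS; have := gS x; rewrite mem_cat xS le_min => /(_ isT)/andP[].
    have gS'' x : x \in S -> rnorm (g x) <= d.
      by move=> xS; have := gS x; rewrite mem_cat xS orbT le_min => /(_ isT)/andP[].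
    by case/orP: js => [/eqP ->|js]; [exact: SP'|exact: SP].
  exists S, d; split=> // g gM gS _ [m Cm <-].
  have [i js [Hi mi]] := sP m Cm.
  have -> : lipfree_val m g = i g + (lipfree_val m - i) g.
    by rewrite -[X in _ = _ + X]/(lipfree_val m g - i g) addrC subrK.
  rewrite (le_trans (rnormD _ _))// [leRHS]splitr; apply: lerD; first exact: (SP i).
  apply: le_trans (dual_norm_le _ _) _; rewrite rnorm_lip0.
  apply: (@le_trans _ _ (rho * (`|M| + 1))); last by rewrite divfK// gt_eqF.
  rewrite ler_pM ?dual_norm_ge0 ?lip_norm_ge0//.
    by rewrite -rnorm_dual ltW.
  by rewrite (le_trans gM)// (le_trans (ler_norm _))// lerDl.
- move=> _ [m _ <-]; split=> [f g|a f].
    by rewrite linearD rnormD.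
  by rewrite linearZ rnormZ.
Qed.

Lemma lipfree_mixed_dual (m : lipfree k x0) :
  exists phi : dual (lip0_mixed k x0), forall f : L, phi f = lipfree_val m f.
Proof.
suff mP : (fun f : lip0_mixed k x0 => lipfree_val m f) \in dual_pred (lip0_mixed k x0).
  by exists (Dual mP).
rewrite inE; split; first by move=> a f g; rewrite linearP.
move=> f; have FF : Filter (nbhs (f : lip0_mixed k x0)) by exact: nbhs_filter.
apply/(@cvg_rnormP R k K^o _ _ _ _ FF) => r r0; have r2 : 0 < r / 2 by rewrite divr_gt0.
have [W mW WP] := lipfree_compact_mixed (@compact_set1 _ m) r2.
apply/lcs_nbhsP; exists W => // w Ww.
have E : lipfree_val m (f : L) - lipfree_val m ((f : L) + (w : L)) = - lipfree_val m (w : L).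
  by rewrite linearD opprD addrA subrr sub0r.
rewrite -[X in X < r]/(rnorm (lipfree_val m (f : L) - lipfree_val m ((f : L) + (w : L)) : K^o)).
rewrite E rnormN; apply: le_lt_trans (WP w Ww m (erefl _)) _.
by rewrite ltr_pdivrMr// ltr_pMr// ltr1n.
Qed.

(** A gliding hump: if functions [f_n] in [A] with slopes above [4 ^ n] at [z_n]
    existed, the weights [2 ^ - n] would give an unbounded seminorm. *)
Lemma weighted_bounded (A : set L) :
  (forall alpha z, null_weights alpha -> exists B : R, forall f, A f ->
    weighted_slopes alpha z f <= B) ->
  exists M : R, forall f, A f -> lip_norm f <= M.
Proof.
move=> Aw; apply: contrapT => /forallNP nA.
have /choice[fz fzP] : forall n : nat, exists fz : L * (X * X),
    A fz.1 /\ 4 ^+ n < slope fz.1 fz.2.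
  move=> n; have /existsNP[f /not_implyP[Af /negP]] := nA (4 ^+ n).
  rewrite -ltNge => fn; have n0 : 0 <= 4 ^+ n :> R by rewrite exprn_ge0.
  have [|_ [z _ <-] zn] := sup_gt _ fn; last by exists (f, z).
  apply/set0P/eqP => E0; move: fn; rewrite /lip_norm E0 sup0.
  by rewrite ltNge n0.
pose alpha n : R := 2 ^- n.
have nalpha : null_weights alpha.
  split; first by move=> n; rewrite invr_gt0 exp2_gt0.
  exact: half_power_le.
have [B BP] := Aw alpha (fun n => (fz n).2) nalpha.
pose n := Num.bound B; have [An fn] := fzP n.
have := BP _ An; rewrite leNgt => /negP; apply.
apply: lt_le_trans (le_weighted_slopes _ nalpha _ n).
rewrite /alpha mulrC ltr_pdivlMr ?exp2_gt0//; apply: le_lt_trans fn.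
have -> : 4 = 2 * 2 :> R by ring.
by rewrite exprMn ler_wpM2r ?exprn_ge0// ltW// upper_nthrootP.
Qed.

Lemma mixed_compact_bounded (A : set (lip0_mixed k x0)) : compact A ->
  exists M : R, forall f : L, A f -> lip_norm f <= M.
Proof.
move=> cA; apply: weighted_bounded => alpha z nalpha.
have [W mW WP] := weighted_slopes_mixed z nalpha ltr01.
have sp := @weighted_slopes_seminorm R k X x0 K^o alpha z nalpha.
pose U (g : L) : set (lip0_mixed k x0) :=
  [set f : L | weighted_slopes alpha z (f - g) <= 1].
have [f Af|s sP] := @compact_finite_cover (lip0_mixed k x0) L U A cA.
  exists (f : L); apply/lcs_nbhsP; exists W => // w Ww; rewrite /U /=.
  rewrite -[X in weighted_slopes _ _ X]/((f : L) + (w : L) - (f : L)).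
  by rewrite addrAC subrr add0r; exact: WP.
exists (1 + \sum_(g <- s) weighted_slopes alpha z g) => f /sP[g gs fg].
rewrite -[f](subrK g) (le_trans (sp.1 _ _))// lerD//.
rewrite (perm_big _ (perm_to_rem gs)) /= big_cons lerDl.
by apply: sumr_ge0 => h _; exact: seminorm_ge0.
Qed.

(** An ultrafilter on a ball converges pointwise, hence for the mixed topology. *)
Lemma lip_ball_compact (M : R) :
  compact ([set f : L | lip_norm f <= M] : set (lip0_mixed k x0)).
Proof.
rewrite compact_ultra => G UG GM.
have /choice[f fP] : forall x, exists l : K^o, forall r : R, 0 < r ->
    G [set g : L | rnorm (l - g x) < r].
  move=> x; have [D cD DP] := disc_compact k (M * mdist x x0).
  have GD : G [set g : L | D (g x)].
    apply: filterS GM => g /= gM; apply: DP.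
    have := lip_norm_ub g x x0; rewrite lip0_base subr0 => /le_trans; apply.
    by rewrite ler_wpM2r ?mdist_ge0.
  have [l [Dl lP]] := cD ((fun g : L => g x) @ G) _ GD.
  exists l => r r0.
  have [//|Gn] := in_ultra_setVsetC [set g : L | rnorm (l - g x) < r] UG.
  have nl : nbhs l [set v : K^o | rnorm (l - v) < r] by apply/nbhs_rnormP; exists r.
  by have [v []] := lP [set v : K^o | ~ rnorm (l - v) < r] _ Gn nl.
have fM x y : rnorm (f x - f y) <= M * mdist x y.
  apply/ler_addgt0Pr => r r0; have r2 : 0 < r / 2 by rewrite divr_gt0.
  have [g [[gM gx] gy]] := filter_ex (filterI (filterI GM (fP x _ r2)) (fP y _ r2)).
  have -> : f x - f y = (g x - g y) + ((f x - g x) - (f y - g y)).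
    by rewrite addrACA opprB !addrA; ring.
  rewrite (le_trans (rnormD _ _))// lerD//.
    by rewrite (le_trans (lip_norm_ub _ _ _))// ler_wpM2r ?mdist_ge0.
  by rewrite (le_trans (ler_rnormB _ _))// [leRHS]splitr lerD// ltW.
have f0 : f x0 = 0.
  apply: rnorm0_eq0; apply/eqP; rewrite eq_le rnorm_ge0 andbT.
  apply/ler_addgt0Pr => r r0; rewrite add0r.
  have [g gr] := filter_ex (fP x0 r r0).
  by move: gr; rewrite /= lip0_base subr0 => /ltW.
have M0 : 0 <= M.
  by have [g gM] := filter_ex GM; rewrite (le_trans (lip_norm_ge0 g)).
have [h hf hM] := mk_lip0 M0 f0 fM.
exists (h : L); split=> //.
move=> A /lcs_nbhsP[_ [U [gU ->]] UA].
pose n := Num.bound (M + M).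
have Mn : M + M <= 2 ^+ n by rewrite ltW// upper_nthrootP.
have [S [d [d0 SU]]] := tau0_finite (2 ^+ n) (gU n).2.
have GS : G [set g : L | forall x, x \in S -> rnorm (f x - g x) < d].
  elim: S {SU} => [|x S IH]; first by apply: filterS GM.
  apply: filterS (filterI (fP x d d0) IH) => g [gx gS] y.
  by rewrite inE => /orP[/eqP ->|/gS].
apply: filterS (filterI GM GS) => g [gM gS].
have -> : g = h + (g - h) by rewrite addrC subrK.
have ghn : lip_norm (g - h) <= 2 ^+ n.
  have [lD lZ] := @lip_seminorm R k X x0 K^o; rewrite (le_trans (lD _ _))//.
  by rewrite -scaleN1r lZ rnormN1 mul1r (le_trans (lerD gM hM)).
apply: UA; apply: (mixed_nbhs_single gU (n := n)) => //.
apply: SU => // x xS.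
by rewrite -[X in rnorm X]/(g x - h x) hf rnorm_sub ltW// gS.
Qed.

End mixed_continuity.

(** * Duals with the topology of compact convergence *)

Section mackey_arens.
Context (R : realType) (k : scalar_kind).
Local Notation K := (scalar_field R k).

Lemma quarter_sum (r : R) : 0 < r -> r / 4 + r / 4 < r.
Proof. ilra. Qed.

Lemma dual_norm_leP (F : normedModType K) (psi : dual F) (c : R) : 0 <= c ->
  (forall v, rnorm (psi v) <= c * rnorm v) -> dual_norm psi <= c.
Proof.
move=> c0 psic; apply: ge_sup.
  by exists (rnorm (psi 0)); exists 0 => //; rewrite /= rnorm0.
by move=> _ [v /= v1 <-]; rewrite (le_trans (psic v))// ler_piMr.
Qed.

Lemma dualc_cvg (F : normedModType K) (G : set_system (dual F)) (psi : dual F) :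
  Filter G ->
  (forall C, abs_convex_compact C -> forall r : R, 0 < r ->
    G [set psi' | forall v, C v -> rnorm (psi v - psi' v) < r]) ->
  G --> (psi : dualc F).
Proof.
move=> FG GC A [_ [[W oW <-] Wpsi WA]].
have Gfam : (@dual_fun K F @ G) --> (dual_fun psi : {family @abs_convex_compact K F, F -> K^o}).
  apply/fam_cvgP => C cC P /uniform_nbhs[E [eE EP]].
  move: eE; rewrite -entourage_ballE => -[e /= e0 eE].
  apply: filterS (GC C cC _ (real_of_gt0 e0)) => psi' psiC; apply: EP => v Cv; apply: eE => /=.
  by rewrite -[e]real_ofK ?ltW//; apply/ball_rnorm; exact: psiC.
have nW : nbhs (dual_fun psi : {family @abs_convex_compact K F, F -> K^o}) W.
  exact: open_nbhs_nbhs.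
have GW : G (@dual_fun K F @^-1` W) := Gfam W nW.
exact: filterS WA GW.
Qed.

Lemma dualc_nbhs (F : normedModType K) (psi : dual F) (C : set F) (r : R) :
  abs_convex_compact C -> 0 < r ->
  nbhs (psi : dualc F) [set psi' : dual F | forall v, C v -> rnorm (psi v - psi' v) < r].
Proof.
move=> cC r0; have rK : 0 < of_real k r by rewrite -of_real0 ltr_of_real.
have := @fam_nbhs F (K^o : uniformType) (@abs_convex_compact K F) C
  [set xy : K^o * K^o | ball xy.1 (of_real k r) xy.2] (dual_fun psi)
  (entourage_ball _ (PosNum rK)) cC.
move=> /(@initial_continuous _ _
  (@dual_fun K F : dual F -> {family @abs_convex_compact K F, F -> K^o}) psi).
rewrite nbhs_simpl /=; apply: filterS => psi' psiC v Cv.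
by apply/ball_rnorm; exact: psiC.
Qed.

Section evaluations.
Context (F : completeNormedModType K) (phi : dual F -> K).
Hypotheses (lphi : linear (phi : dual F -> K^o))
  (cphi : continuous (phi : dualc F -> K^o)).

(** Bounded functionals that are small at finitely many points converge to zero
    uniformly on compact sets. *)
Lemma dualc_functional_finite (e : R) : 0 < e ->
  exists (s : seq F) (d : R), 0 < d /\ forall psi : dual F, dual_norm psi <= 1 ->
    (forall c, c \in s -> rnorm (psi c) <= d) -> rnorm (phi psi : K^o) <= e.
Proof.
move=> e0.
pose G : set_system (dual F) := filter_from [set sd : seq F * R | 0 < sd.2]
  (fun sd => [set psi | dual_norm psi <= 1 /\
    forall c, c \in sd.1 -> rnorm (psi c) <= sd.2]).
have FG : Filter G.
  apply: filter_from_filter; first by exists ([::], 1) => /=.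
  move=> [S d] [T e'] /= d0 e'0; exists (S ++ T, Num.min d e') => /=.
    by rewrite lt_min d0.
  move=> g [gM gS]; split; split=> // x xS.
    by have := gS x; rewrite mem_cat xS le_min => /(_ isT)/andP[].
  by have := gS x; rewrite mem_cat xS orbT le_min => /(_ isT)/andP[].
have G0 : G --> ((0 : dual F) : dualc F).
  apply: dualc_cvg => C [_ cC] r r0; have r2 : 0 < r / 2 by rewrite divr_gt0.
  have [v _|s sP] := @compact_finite_cover F F (fun c => [set v | rnorm (c - v) < r / 2]) C cC.
    by exists v; apply/nbhs_rnormP; exists (r / 2).
  exists (s, r / 2) => //= psi [psi1 psis] v /sP[c cs cv].
  rewrite -[X in rnorm (X - _)]/(0 : K^o) sub0r rnormN.
  have -> : psi v = psi c - psi (c - v) by rewrite linearB opprB addrC subrK.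
  apply: le_lt_trans (ler_rnormB _ _) _; rewrite [ltRHS]splitr ler_ltD ?psis//.
  apply: le_lt_trans (dual_norm_le _ _) _; apply: le_lt_trans cv.
  by rewrite ler_piMl ?rnorm_ge0.
have phi0 : phi 0 = 0 by exact: linear_functional0.
have n0 : nbhs (phi 0 : K^o) [set a : K^o | rnorm a < e].
  by apply/nbhs_rnormP; exists e => // a; rewrite phi0 sub0r rnormN.
have [[s d] /= d0 sP] := G0 _ (cphi n0).
by exists s, d; split=> // psi psi1 psis; apply/ltW/sP.
Qed.

(** By scaling, [phi] is dominated by a multiple of finitely many evaluations plus
    [e] times the norm. The Hahn-Banach theorem splits it accordingly, and the first
    part is a combination of those evaluations. *)
Lemma dualc_functional_approx (e : R) : 0 < e ->
  exists v : F, forall psi : dual F, rnorm (phi psi - psi v : K^o) <= e * dual_norm psi.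
Proof.
move=> e0; have [s [d [d0 sP]]] := dualc_functional_finite e0.
have sev c : seminorm (fun psi : dual F => rnorm (psi c)).
  split=> [psi psi'|a psi]; first exact: (rnormD (psi c) (psi' c)).
  exact: (rnormZ a (psi c)).
pose p (psi : dual F) : R := e / d * \sum_(c <- s) rnorm (psi c).
pose q (psi : dual F) : R := e * dual_norm psi.
have ed : 0 <= e / d by rewrite divr_ge0 ?ltW.
have sp : seminorm p.
  split=> [psi psi'|a psi]; rewrite /p.
    rewrite -mulrDr ler_wpM2l// -big_split /=; apply: ler_sum => c _.
    exact: (sev c).1.
  rewrite mulrCA; congr (_ * _); rewrite mulr_sumr; apply: eq_bigr => c _.
  exact: (sev c).2.
have sq : seminorm q.
  split=> [psi psi'|a psi]; rewrite /q.
    by rewrite -mulrDr ler_wpM2l ?(ltW e0)// (dual_seminorm F).1.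
  by rewrite (dual_seminorm F).2 mulrCA.
have sum0 (psi : dual F) : 0 <= \sum_(c <- s) rnorm (psi c).
  by apply: sumr_ge0 => c _; exact: rnorm_ge0.
have [|phi1 [lphi1 phi1p phi1q]] := @split_functional R k (dual F) phi p q lphi sp sq.
  move=> psi; pose t : R := dual_norm psi + (\sum_(c <- s) rnorm (psi c)) / d.
  have -> : p psi + q psi = e * t.
    by rewrite /p /q /t mulrDr addrC; congr (_ + _); rewrite mulrAC mulrA.
  have sd0 : 0 <= (\sum_(c <- s) rnorm (psi c)) / d by rewrite divr_ge0 ?(ltW d0).
  have t0 : 0 <= t by rewrite addr_ge0 ?dual_norm_ge0.
  have [t00|tn0] := eqVneq t 0.
    have psi0 : psi = 0.
      apply/rnorm0_eq0; rewrite rnorm_dual; apply/eqP; rewrite eq_le dual_norm_ge0 andbT.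
      by rewrite -t00 lerDl.
    by rewrite psi0 linear_functional0// rnorm0 mulr_ge0// ltW.
  have tp : 0 < t by rewrite lt_neqAle eq_sym tn0.
  have it0 : 0 <= t^-1 by rewrite invr_ge0.
  have := sP (of_real k t^-1 *: psi).
  rewrite (dual_seminorm F).2 rnorm_of_real// linear_functionalZ//.
  rewrite -[X in rnorm X <= e]/(of_real k t^-1 *: (phi psi : K^o)) rnorm_scale_real//.
  rewrite mulrC ler_pdivrMr// mul1r lerDl sd0 mulrC ler_pdivrMr//; apply=> // c cs.
  rewrite -[X in rnorm X]/(of_real k t^-1 *: (psi c)) rnorm_scale_real//.
  rewrite mulrC ler_pdivrMr// mulrC -ler_pdivrMr// /t ler_wpDl ?dual_norm_ge0//.
  rewrite ler_pM2r ?invr_gt0// (perm_big _ (perm_to_rem cs)) /= big_cons lerDl.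
  by apply: sumr_ge0 => c' _; exact: rnorm_ge0.
have [||//|psi psis|v vP] := @functional_in_span K (dual F) F (fun c psi => psi c) s phi1.
- by move=> c a psi psi'.
- by move=> psi a c c'; rewrite linearP.
- apply: rnorm0_eq0; apply/eqP; rewrite eq_le rnorm_ge0 andbT (le_trans (phi1p _))//.
  by rewrite /p big_seq big1 ?mulr0// => c cs; rewrite psis// rnorm0.
- by exists v => psi; rewrite -vP.
Qed.

(** The points [v_n] that represent [phi] up to [2 ^ - n] form a Cauchy sequence,
    by norming functionals. *)
Theorem mackey_arens : exists v : F, forall psi : dual F, phi psi = psi v.
Proof.
have /choice[v vP] : forall n : nat, exists v : F, forall psi : dual F,
    rnorm (phi psi - psi v : K^o) <= 2 ^- n * dual_norm psi.
  by move=> n; apply: dualc_functional_approx; rewrite invr_gt0 exp2_gt0.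
have vv n m : rnorm (v n - v m) <= 2 ^- n + 2 ^- m.
  have [psi psi1] := norming_dual (v n - v m); move=> /le_trans; apply.
  have -> : psi (v n - v m) = (phi psi - psi (v m)) - (phi psi - psi (v n)).
    by rewrite linearB opprB [RHS]addrC addrA subrK.
  rewrite [leRHS]addrC; apply: le_trans (ler_rnormB _ _) _.
  have half i : rnorm (phi psi - psi (v i) : K^o) <= 2 ^- i.
    rewrite (le_trans (vP i psi))// ler_piMr// invr_ge0 exprn_ge0//.
  exact: lerD.
have cv : cauchy (v @ \oo).
  apply: cauchy_exP => e e0; have r0 := real_of_gt0 e0.
  have r4 : 0 < real_of e / 4 by rewrite divr_gt0.
  have [N NP] := half_power_le r4.
  exists (v N); exists N => // n /= Nn; rewrite -[e]real_ofK ?ltW//; apply/ball_rnorm.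
  apply: le_lt_trans (vv N n) _.
  have := lerD (NP N (leqnn N)) (NP n Nn); move=> /le_lt_trans; apply.
  exact: quarter_sum.
have /cvg_ex[w vw] : cvg (v @ \oo) by exact: cauchy_cvg.
exists w => psi; apply/eqP; rewrite -subr_eq0 -rnorm_eq0 eq_le rnorm_ge0 andbT.
apply/ler_addgt0Pr => r r0; rewrite add0r.
have D1 : 0 < dual_norm psi + 1 by rewrite ltr_wpDl ?dual_norm_ge0.
have rD : 0 < r / 2 / (dual_norm psi + 1) by rewrite !divr_gt0.
have [N1 N1P] := half_power_le rD.
have /cvg_rnormP/(_ _ rD)[N2 _ N2P] := vw.
pose n := maxn N1 N2.
have h1 := N1P n (leq_maxl _ _); have h2 := ltW (N2P n (leq_maxr _ _)).
have bound x : 0 <= x -> x <= r / 2 / (dual_norm psi + 1) -> dual_norm psi * x <= r / 2.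
  move=> x0 xr; apply: le_trans (_ : (dual_norm psi + 1) * (r / 2 / (dual_norm psi + 1)) <= _).
    by rewrite ler_pM ?dual_norm_ge0// lerDl.
  by rewrite mulrC divfK// gt_eqF.
have -> : phi psi - psi w = (phi psi - psi (v n)) - psi (w - v n).
  by rewrite linearB opprB addrA subrK.
apply: le_trans (ler_rnormB _ _) _; rewrite [leRHS]splitr lerD//.
  apply: le_trans (vP n psi) _; rewrite mulrC.
  by apply: bound; [rewrite invr_ge0 exprn_ge0|exact: h1].
by apply: le_trans (dual_norm_le _ _) _; apply: bound; [exact: rnorm_ge0|exact: h2].
Qed.

End evaluations.
End mackey_arens.

(** * Composition with functionals *)

Section composition.
Context (R : realType) (k : scalar_kind).
Local Notation K := (scalar_field R k).
Context (X : metricType R) (x0 : X).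
Local Notation L := (lip0 x0 (K^o : normedModType K)).

Section dual_comp.
Context (F : normedModType K).

Lemma dual_comp_subproof (f : lip0 x0 F) (psi : dual F) :
  ((fun x => psi (f x)) : X -> K^o) \in lip0_pred x0 (K^o : normedModType K).
Proof.
rewrite inE; split; first by rewrite lip0_base linear0.
exists (dual_norm psi * lip_norm f) => x y.
rewrite -linearB -mulrA (le_trans (dual_norm_le _ _))//.
by rewrite ler_wpM2l ?dual_norm_ge0// lip_norm_ub.
Qed.

Definition dual_comp (f : lip0 x0 F) (psi : dual F) : L :=
  Lip0 (dual_comp_subproof f psi).

Lemma slope_dual_comp f psi z : slope (dual_comp f psi) z <= dual_norm psi * slope f z.
Proof.
rewrite /slope mulrA ler_wpM2r ?invr_ge0 ?mdist_ge0// /= -linearB.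
exact: dual_norm_le.
Qed.

Lemma weighted_slopes_dual_comp alpha z f psi : null_weights alpha ->
  weighted_slopes alpha z (dual_comp f psi) <= dual_norm psi * weighted_slopes alpha z f.
Proof.
move=> nalpha; apply: weighted_slopes_le => n.
apply: (@le_trans _ _ (dual_norm psi * (alpha n * slope f (z n)))).
  by rewrite [leRHS]mulrCA ler_wpM2l ?slope_dual_comp// ltW// nalpha.1.
by apply: ler_wpM2l; [exact: dual_norm_ge0|exact: le_weighted_slopes].
Qed.

Lemma dual_compP f a psi psi' :
  dual_comp f (a *: psi + psi') = a *: dual_comp f psi + dual_comp f psi'.
Proof. exact: val_inj. Qed.

Lemma dual_compB f g psi : dual_comp (f - g) psi = dual_comp f psi - dual_comp g psi.
Proof.
apply: val_inj; apply/funext => x.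
by rewrite -[LHS]/(psi (f x - g x)) linearB.
Qed.

End dual_comp.

(** For [f] the embedding of [X] in its free space, these are the elementary molecules
    of the pairs [z n], times the weights. *)
Definition weighted_difference (alpha : nat -> R) (z : nat -> X * X)
    (F : normedModType K) (f : lip0 x0 F) n : F :=
  of_real k (alpha n / mdist (z n).1 (z n).2) *: (f (z n).1 - f (z n).2).

Lemma rnorm_weighted_difference alpha z (F : normedModType K) (f : lip0 x0 F) n :
  0 < alpha n -> rnorm (weighted_difference alpha z f n) = alpha n * slope f (z n).
Proof.
move=> a0; rewrite rnorm_scale_real ?divr_ge0 ?mdist_ge0 ?(ltW a0)//.
by rewrite /slope mulrAC mulrA.
Qed.

Lemma dual_comp_weighted_difference alpha z (F : normedModType K) (f : lip0 x0 F)
    (psi : dual F) n : 0 < alpha n ->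
  alpha n * slope (dual_comp f psi) (z n) = rnorm (psi (weighted_difference alpha z f n)).
Proof.
move=> a0; rewrite -rnorm_weighted_difference// /weighted_difference [psi _]linearZ.
by congr (rnorm (_ *: _)); rewrite /= linearB.
Qed.

Lemma weighted_difference_hull alpha z (F : completeNormedModType K) (f : lip0 x0 F) :
  null_weights alpha ->
  exists2 C : set F, abs_convex_compact C & forall n, C (weighted_difference alpha z f n).
Proof.
move=> nalpha; apply: null_sequence_hull => r r0.
have l1 : 0 < lip_norm f + 1 by rewrite ltr_wpDl ?lip_norm_ge0.
have [N NP] := nalpha.2 _ (divr_gt0 r0 l1); exists N => n Nn.
rewrite rnorm_weighted_difference ?nalpha.1//.
apply: (@le_trans _ _ (r / (lip_norm f + 1) * (lip_norm f + 1))); last first.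
  by rewrite divfK// gt_eqF.
rewrite ler_pM ?slope_ge0 ?NP ?(ltW (nalpha.1 n))//.
by rewrite (le_trans (slope_le_lip _ _))// lerDl.
Qed.

(** The weighted differences of [f] tend to zero, so they lie in a compact convex
    set: that is what the topology of [F'_c] sees. *)
Lemma dual_comp_continuous (F : completeNormedModType K) (f : lip0 x0 F) :
  @continuous_linear K (dualc F) (lip0_mixed k x0) (dual_comp f).
Proof.
split; first by move=> a psi psi'; exact: dual_compP.
move=> psi A /lcs_nbhsP[W mW WA].
have [alpha [z [nalpha zW]]] := mixed_nbhs_weighted mW.
have [C cC Cc] := weighted_difference_hull z f nalpha.
have h0 : 0 < 2^-1 :> R by rewrite invr_gt0.
apply: filterS (dualc_nbhs psi cC h0) => psi' psiC /=.
have -> : dual_comp f psi' = dual_comp f psi + dual_comp f (psi' - psi).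
  apply: val_inj; apply/funext => x.
  by rewrite -[RHS]/(psi (f x) + (psi' (f x) - psi (f x))) addrC subrK.
apply: WA; apply: zW; apply: (@le_lt_trans _ _ 2^-1); last by rewrite invf_lt1// ltr1n.
apply: weighted_slopes_le => n; rewrite dual_comp_weighted_difference ?nalpha.1//.
set c := weighted_difference _ _ _ _.
by rewrite -[X in rnorm X]/(psi' c - psi c) rnorm_sub ltW//; apply: psiC; exact: Cc.
Qed.

End composition.

(** * Completeness of the free space *)

Section lipfree_complete.
Context (R : realType) (k : scalar_kind).
Local Notation K := (scalar_field R k).
Context (X : metricType R) (x0 : X).
Local Notation L := (lip0 x0 (K^o : normedModType K)).

Lemma lipfree_eval_le (m m' : lipfree k x0) (f : L) :
  rnorm (lipfree_val m f - lipfree_val m' f : K^o) <= rnorm (m - m') * lip_norm f.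
Proof.
have := dual_norm_le (lipfree_val (m - m')) f; rewrite rnorm_lip0 -rnorm_lipfree.
exact.
Qed.

(** A Cauchy filter converges pointwise on [Lip_0(X)] to a functional [psi], and the
    distance to [psi] is controlled by the Cauchy property. *)
Lemma lipfree_complete (G : set_system (lipfree k x0)) :
  ProperFilter G -> cauchy G -> cvg G.
Proof.
move=> PG /cauchyP cG.
have Gball (r : R) : 0 < r -> exists m : lipfree k x0, G [set m' | rnorm (m - m') < r].
  move=> r0; have [|m mG] := cG (of_real k r); first by rewrite -of_real0 ltr_of_real.
  by exists m; apply: filterS mG => m' /ball_rnorm.
have /choice[l lP] : forall f : L, exists l : K^o, forall r : R, 0 < r ->
    G [set m | rnorm (l - lipfree_val m f) < r].
  move=> f; have [m0 m0G] := Gball 1 ltr01.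
  have [D cD DP] := disc_compact k (rnorm (lipfree_val m0 f : K^o) + lip_norm f).
  have GD : G [set m | D (lipfree_val m f)].
    apply: filterS m0G => m /= m01; apply: DP.
    rewrite -[lipfree_val m f](subrK (lipfree_val m0 f)) addrC.
    apply: le_trans (rnormD _ _) _; rewrite lerD2l rnorm_sub.
    apply: le_trans (lipfree_eval_le _ _ _) _; rewrite ler_piMl ?lip_norm_ge0//.
    exact: ltW.
  have [l [Dl lG]] := cD ((fun m => lipfree_val m f) @ G) _ GD.
  exists l => r r0; have r2 : 0 < r / 2 by rewrite divr_gt0.
  have l1 : 0 < 2 * (lip_norm f + 1) by rewrite mulr_gt0// ltr_wpDl ?lip_norm_ge0.
  have [m1 m1G] := Gball _ (divr_gt0 r2 l1).
  pose B := [set v : K^o | exists m, [/\ v = lipfree_val m f &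
    rnorm (m1 - m) < r / 2 / (2 * (lip_norm f + 1))]].
  have GB : G [set m | B (lipfree_val m f)] by apply: filterS m1G => m mr; exists m.
  have nl : nbhs l [set v : K^o | rnorm (l - v) < r / 2].
    by apply/nbhs_rnormP; exists (r / 2).
  have [_ [[m2 [-> m2P]] lm2]] := lG B _ GB nl.
  apply: filterS m1G => m /= mP.
  rewrite -[l](subrK (lipfree_val m2 f)) -addrA.
  apply: le_lt_trans (rnormD _ _) _; rewrite [ltRHS]splitr ltr_leD//.
  apply: le_trans (lipfree_eval_le _ _ _) _.
  have m2m : rnorm (m2 - m) <= r / 2 / (2 * (lip_norm f + 1)) * 2.
    have -> : m2 - m = (m1 - m) - (m1 - m2) by rewrite opprB [RHS]addrC addrA subrK.
    by rewrite mulr_natr mulr2n (le_trans (ler_rnormB _ _))// lerD// ltW.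
  apply: (@le_trans _ _ (r / 2 / (2 * (lip_norm f + 1)) * 2 * (lip_norm f + 1))).
    by rewrite ler_pM ?rnorm_ge0 ?lip_norm_ge0// lerDl.
  by rewrite -mulrA divfK// gt_eqF.
have lcvg f : (fun m => lipfree_val m f : K^o) @ G --> l f.
  by apply/cvg_rnormP => r r0; exact: lP.
have ll : linear (l : L -> K^o).
  move=> a f g; apply: (cvg_unique (@norm_hausdorff _ K^o) (lcvg (a *: f + g))).
  rewrite (_ : (fun m => _) =
      (fun m : lipfree k x0 => a *: (lipfree_val m f : K^o) + lipfree_val m g)).
    by apply: cvgD; [apply: cvgZl_tmp; exact: lcvg|exact: lcvg].
  by apply/funext => m; rewrite linearP.
have near_l (m1 m : lipfree k x0) (r : R) f : G [set m' | rnorm (m1 - m') < r] ->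
    rnorm (m1 - m) < r -> rnorm (l f - lipfree_val m f) <= 2 * r * lip_norm f.
  move=> m1G m1m; apply/ler_addgt0Pl => e e0.
  have [m' [/= m1m' lm']] := filter_ex (filterI m1G (lP f e e0)).
  rewrite -[l f](subrK (lipfree_val m' f)) -addrA.
  apply: le_trans (rnormD _ _) _; rewrite lerD ?(ltW lm')//.
  apply: le_trans (lipfree_eval_le _ _ _) _; rewrite ler_wpM2r ?lip_norm_ge0//.
  have -> : m' - m = (m1 - m) - (m1 - m') by rewrite opprB [RHS]addrC addrA subrK.
  by rewrite mulr_natl mulr2n (le_trans (ler_rnormB _ _))// lerD// ltW.
have r0_in (m1 : lipfree k x0) (r : R) : 0 < r -> rnorm (m1 - m1) < r.
  by rewrite subrr rnorm0.
have [m0 m0G] := Gball 1 ltr01.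
have M0 : 0 <= rnorm m0 + 2 * 1 by rewrite addr_ge0 ?rnorm_ge0.
have [|psi psiE _] := dual_of_bounded ll M0.
  move=> f; rewrite rnorm_lip0 mulrDl -[l f](subrK (lipfree_val m0 f)) addrC.
  apply: le_trans (rnormD _ _) _; rewrite lerD//; last first.
    by apply: near_l m0G _; exact: r0_in.
  by have := lipfree_eval_le m0 0 f; rewrite !subr0.
have psi_near (m1 m : lipfree k x0) (r : R) : 0 < r ->
    G [set m' | rnorm (m1 - m') < r] -> rnorm (m1 - m) < r ->
    rnorm (psi - lipfree_val m) <= 2 * r.
  move=> r0 m1G m1m; rewrite rnorm_dual; apply: dual_norm_leP.
    by rewrite mulr_ge0// ltW.
  move=> f; rewrite rnorm_lip0 -[X in rnorm X]/(psi f - lipfree_val m f) psiE.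
  exact: near_l m1G m1m.
have psiP : psi \in lipfree_pred k x0.
  apply/mem_set; apply: (@closed_closure _ (linear_hull (range (@delta R k X x0)))).
  apply/closure_rnormP => r r0; have r4 : 0 < r / 4 by rewrite divr_gt0.
  have [m1 m1G] := Gball _ r4; exists (lipfree_val m1); first exact/set_mem/valP.
  apply: le_lt_trans (psi_near m1 m1 _ r4 m1G (r0_in _ _ r4)) _.
  by rewrite mulr_natl mulr2n; exact: quarter_sum.
apply/cvg_ex; exists (Lipfree psiP); apply/cvg_rnormP => r r0.
have r4 : 0 < r / 4 by rewrite divr_gt0.
have [m1 m1G] := Gball _ r4; apply: filterS (m1G) => m m1m.
apply: le_lt_trans (psi_near m1 m _ r4 m1G m1m) _.
by rewrite mulr_natl mulr2n; exact: quarter_sum.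
Qed.

HB.instance Definition _ := Uniform_isComplete.Build (lipfree k x0) lipfree_complete.


End lipfree_complete.

(** * The equivalences *)

Section rank_one_sums.
Context (K : numFieldType) (E F : tvsType K).

Lemma rank_one_sum_continuous_linear (n : nat) (phi : 'I_n -> dual E) (v : 'I_n -> F) :
  @continuous_linear K E F (fun x => \sum_(i < n) phi i x *: v i).
Proof.
split=> [a x y|x].
  rewrite scaler_sumr -big_split /=; apply: eq_bigr => i _.
  by rewrite linearP scalerDl scalerA.
have cterm (psi : dual E) (w : F) : {for x, continuous (fun x => psi x *: w)}.
  apply: (@continuous2_cvg _ _ _ _ _ _ (fun x => psi x : K^o) (fun=> w) *:%R).
  - exact: (@scale_continuous K F (psi x, w)).
  - exact: dual_continuous.
  - exact: cvg_cst.
elim: n phi v => [|n IH] phi v.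
  rewrite (_ : (fun x => _) = fun=> 0); first exact: cvg_cst.
  by apply/funext => y; rewrite big_ord0.
rewrite (_ : (fun x => _) = fun x => \sum_(i < n) phi (widen_ord (leqnSn n) i) x *:
    v (widen_ord (leqnSn n) i) + phi ord_max x *: v ord_max); last first.
  by apply/funext => y; rewrite big_ord_recr.
apply: (@continuous2_cvg _ _ _ _ _ _ _ _ +%R).
- exact: (@add_continuous F (_, _)).
- exact: IH.
- exact: cterm.
Qed.

End rank_one_sums.

Lemma abs_convex_compact_directed (R : realType) (k : scalar_kind)
    (E : tvsType (scalar_field R k)) (A B : set E) :
  abs_convex_compact A -> abs_convex_compact B ->
  exists2 C : set E, abs_convex_compact C & A `|` B `<=` C.
Proof.
move=> cA cB.
have [->|/set0P[a Aa]] := eqVneq A set0; first by exists B => // x [].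
have [->|/set0P[b Bb]] := eqVneq B set0; first by exists A => // x [].
have A0 : A 0 by have := cA.1.2 0 _ _ Aa; rewrite normr0 scale0r; apply.
have B0 : B 0 by have := cB.1.2 0 _ _ Bb; rewrite normr0 scale0r; apply.
exists ((fun x : E * E => x.1 + x.2) @` (A `*` B)); last first.
  move=> x [Ax|Bx]; first by exists (x, 0); rewrite //= addr0.
  by exists (0, x); rewrite //= add0r.
split.
  apply: abs_convexP => s t _ _ st [[x y] [/= Ax By] <-] [[x' y'] [/= Ax' By'] <-].
  exists (s *: x + t *: x', s *: y + t *: y').
    by split; apply: abs_convex_combP => //; [exact: cA.1|exact: cB.1].
  by rewrite /= !scalerDr addrACA.
apply: continuous_compact; last exact: compact_setX cA.2 cB.2.
apply: continuous_subspaceT; exact: add_continuous.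
Qed.

Section bounded_sets.
Context (R : realType) (k : scalar_kind).
Local Notation K := (scalar_field R k).
Context (F : normedModType K).

Lemma bounded_setP (D : set F) : bounded_set D <->
  exists2 B : R, 0 <= B & forall v, D v -> rnorm v <= B.
Proof.
split=> [/pinfty_ex_gt0[M M0 MD]|[B B0 BD]].
  exists (real_of M); first exact/ltW/real_of_gt0.
  by move=> v Dv; rewrite -(ler_of_real k) of_real_rnorm real_ofK ?(ltW M0)//; exact: MD.
exists (of_real k B); split; first by rewrite ger0_real// -of_real0 ler_of_real.
move=> M BM v Dv /=; rewrite (le_trans _ (ltW BM))//.
by rewrite -of_real_rnorm ler_of_real BD.
Qed.

Lemma bounded_set_directed (A B : set F) : bounded_set A -> bounded_set B ->
  exists2 C : set F, bounded_set C & A `|` B `<=` C.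
Proof.
move=> /bounded_setP[a a0 aA] /bounded_setP[b b0 bB].
exists (A `|` B) => //; apply/bounded_setP; exists (a + b); first exact: addr_ge0.
move=> v [/aA|/bB] /le_trans; apply; first by rewrite lerDl.
by rewrite lerDr.
Qed.

End bounded_sets.

Lemma dense_closure (T : topologicalType) (S : set T) :
  dense S <-> forall u, closure S u.
Proof.
split=> [dS u A nA|clS O [u Ou] oO].
  have [|x [xA Sx]] := dS (interior A) _ (open_interior A); first by exists u.
  by exists x; split=> //; exact: interior_subset.
have /clS[x [Sx Ox]] : nbhs u O by exact: open_nbhs_nbhs.
by exists x.
Qed.

Lemma subrACA (V : zmodType) (a b c d : V) : a - b - (c - d) = a - c - (b - d).
Proof. by rewrite !opprB addrACA [RHS]addrACA [- b - c]addrC. Qed.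

Section equivalences.
Context (R : realType) (k : scalar_kind).
Local Notation K := (scalar_field R k).
Context (X : metricType R) (x0 : X).
Local Notation L := (lip0 x0 (K^o : normedModType K)).

Lemma lcs_entourage_base (V : lmodType K) (B : lc_base V) (W : set V) :
  lc_sets B W -> entourage [set uv : lcs B * lcs B | W ((uv.1 : V) - (uv.2 : V))].
Proof. by move=> BW; exists W. Qed.

(** The norm topology of [F'] is finer than that of [F'_c], so each weighted seminorm
    is bounded on the image of a ball, and then so is the Lipschitz norm. *)
Lemma eps_product_bounded (F : normedModType K) (u : dual F -> L) (B : R) :
  @continuous_linear K (dualc F) (lip0_mixed k x0) u ->
  exists2 M : R, 0 <= M & forall psi : dual F, dual_norm psi <= B -> lip_norm (u psi) <= M.
Proof.
move=> [lu cu].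
have ul a (psi psi' : dual F) : u (a *: psi + psi') = a *: u psi + u psi' by exact: lu.
have u0 : u 0 = 0 by have := ul (-1) 0 0; rewrite scaler0 addr0 scaleN1r addNr.
have uZ a psi : u (a *: psi) = a *: u psi by have := ul a psi 0; rewrite u0 !addr0.
have normc : nbhs (0 : dual F) --> ((0 : dual F) : dualc F).
  apply: dualc_cvg => C [_ cC] r r0.
  have [v _|s sP] := @compact_finite_cover F F (fun c => [set v | rnorm (c - v) < 1]) C cC.
    by exists v; apply/nbhs_rnormP; exists 1.
  pose M := 1 + \sum_(c <- s) rnorm c.
  have M0 : 0 < M by rewrite ltr_pwDl// sumr_ge0// => c _; exact: rnorm_ge0.
  apply/nbhs_rnormP; exists (r / M); first by rewrite divr_gt0.
  move=> psi; rewrite sub0r rnormN rnorm_dual => psir v /sP[c cs cv].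
  rewrite -[X in rnorm (X - _)]/(0 : K^o) sub0r rnormN.
  apply: le_lt_trans (dual_norm_le _ _) _.
  apply: (@le_lt_trans _ _ (dual_norm psi * M)); last by rewrite -ltr_pdivlMr.
  rewrite ler_wpM2l ?dual_norm_ge0//.
  have -> : v = c - (c - v) by rewrite opprB addrC subrK.
  rewrite (le_trans (ler_rnormB _ _))// addrC lerD ?(ltW cv)//.
  rewrite (perm_big _ (perm_to_rem cs)) /= big_cons lerDl.
  by apply: sumr_ge0 => c' _; exact: rnorm_ge0.
have [|M MP] := @weighted_bounded R k X x0 [set u psi | psi in [set psi | dual_norm psi <= B]].
  move=> alpha z nalpha; have [W mW WP] := weighted_slopes_mixed k x0 z nalpha ltr01.
  have nW : nbhs (u 0 : lip0_mixed k x0) W.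
    by apply/lcs_nbhsP; exists W => // w Ww; rewrite u0 add0r.
  have /nbhs_rnormP[r r0 rW] := normc _ (cu _ _ nW).
  have B1 : 0 < `|B| + 1 by rewrite ltr_wpDl.
  pose t := r / 2 / (`|B| + 1); have t0 : 0 < t by rewrite !divr_gt0.
  exists t^-1 => _ [psi /= psiB <-].
  have h : weighted_slopes alpha z (of_real k t *: u psi) <= 1.
    rewrite -uZ; apply: WP; apply: rW; rewrite sub0r rnormN rnorm_scale_real ?(ltW t0)//.
    rewrite rnorm_dual; apply: (@le_lt_trans _ _ (t * (`|B| + 1))).
      by rewrite ler_wpM2l ?(ltW t0)// (le_trans psiB)// (le_trans (ler_norm _))// lerDl.
    by rewrite divfK ?gt_eqF// ltr_pdivrMr// ltr_pMr// ltr1n.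
  move: h; rewrite (@weighted_slopes_seminorm R k X x0 K^o alpha z nalpha).2.
  by rewrite rnorm_of_real ?(ltW t0)// mulrC -ler_pdivlMr// mul1r.
exists `|M| => // psi psiB; rewrite (le_trans _ (ler_norm _))//.
by apply: MP; exists psi.
Qed.

(** A finite-rank operator [w] close to the identity on a ball of [Lip_0(X)], which
    is compact, yields [w \o u] close to [u]; its functionals are evaluations. *)
Lemma mixed_ap_eps_dense : approximation_property (lip0_mixed k x0) ->
  forall F : completeNormedModType K, dense (eps_tensor (lip0_mixed k x0) F).
Proof.
move=> ap F; apply/dense_closure => u; apply: family_closure.
- by exists set0; apply/bounded_setP; exists 0.
- exact: bounded_set_directed.
move=> D E /bounded_setP[B B0 BD] eE.
have [lu cu] := set_valP u.
have [M M0 MP] := eps_product_bounded B (conj lu cu).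
pose A := [set f : L | lip_norm f <= M] : set (lip0_mixed k x0).
have cA : abs_convex_compact A.
  split; last exact: lip_ball_compact.
  exact: (@seminorm_ball_abs_convex R k L (@lip_norm R k X x0 K^o) M (@lip_seminorm R k X x0 K^o)).
have [w [n [phi [g wE]]] wP] := closure_family ap cA eE.
have [lw cw] := set_valP w.
have wuP : (set_val w \o set_val u) \in
    (@continuous_linear K (dualc F) (lip0_mixed k x0)).
  apply/mem_set; split.
    by move=> a psi psi'; exact: etrans (congr1 (set_val w) (lu a psi psi')) (lw a _ _).
  move=> psi; apply: (@continuous_comp (dualc F) (lip0_mixed k x0) (lip0_mixed k x0)
    (set_val u) (set_val w) psi); [exact: cu|exact: cw].
exists (SigSub wuP); last first.
  by move=> psi Dpsi; apply: wP; apply: MP; rewrite -rnorm_dual BD.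
have /choice[v vP] : forall i : 'I_n, exists v : F, forall psi : dual F,
    phi i (set_val u psi) = psi v.
  move=> i; apply: mackey_arens.
    move=> a psi psi'; apply: etrans (congr1 (phi i) (lu a psi psi')) _.
    exact: dual_linear.
  move=> psi; apply: (@continuous_comp (dualc F) (lip0_mixed k x0) K^o
    (set_val u) (phi i) psi); [exact: cu|exact: dual_continuous].
exists n, g, v => psi; rewrite -[LHS]/(set_val w (set_val u psi)) wE.
by apply: eq_bigr => i _; rewrite vP.
Qed.

Lemma rank_one_sum_lip0 (F : normedModType K) n (g : 'I_n -> L) (v : 'I_n -> F) :
  exists h : lip0 x0 F, forall x, h x = \sum_(i < n) g i x *: v i.
Proof.
have [|||h hE _] := @mk_lip0 R k X x0 F (fun x => \sum_(i < n) g i x *: v i)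
    (\sum_(i < n) lip_norm (g i) * rnorm (v i)).
- by apply: sumr_ge0 => i _; rewrite mulr_ge0 ?lip_norm_ge0 ?rnorm_ge0.
- by rewrite big1 // => i _; rewrite lip0_base scale0r.
- move=> x y; rewrite -sumrB (le_trans (rnorm_sum _ _))// mulr_suml.
  apply: ler_sum => i _; rewrite -scalerBl rnormZ mulrAC.
  by rewrite ler_wpM2r ?rnorm_ge0// lip_norm_ub.
- by exists h.
Qed.

Lemma rank_one_sum_finite_rank (F : normedModType K) n (g : 'I_n -> L) (v : 'I_n -> F)
    (h : lip0 x0 F) : (forall x, h x = \sum_(i < n) g i x *: v i) ->
  lip0_finite_rank x0 F h.
Proof.
move=> hE; apply: (@subspace_finite_dimensional _ _ [seq v i | i <- enum 'I_n]).
  exact: linear_hull_subspace.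
have HS := linear_hull_subspace [set` [seq v i | i <- enum 'I_n]].
apply: linear_hull_sub => // _ [x _ <-]; rewrite hE; apply: (linear_subspace_sum _ HS) => i.
have vi : [set` [seq v i | i <- enum 'I_n]] (v i) by rewrite /= map_f ?mem_enum.
exact: (linear_subspaceZ (g i x) HS (sub_linear_hull vi)).
Qed.

(** By norming functionals, the defining seminorms are suprema of the scalar ones. *)
Lemma gamma_tau_scalar (F : normedModType K) (s : seq (lip0 x0 F -> R)) (e : R) :
  [set` s] `<=` @gamma_tau_seminorms R k X x0 F -> 0 < e ->
  exists2 W, mixed_sets k x0 W & forall h : lip0 x0 F,
    (forall psi : dual F, dual_norm psi <= 1 -> W (dual_comp h psi)) ->
    forall p, p \in s -> p h < e.
Proof.
elim: s => [|p s IH] sP e0.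
  by have [W mW] := mixed_inhabited k x0; exists W.
have [q /= qs|W mW WP] := IH _ e0; first by apply: sP; rewrite /= inE qs orbT.
have [|alpha [z [a0 ac _ pE]]] := sP p; first by rewrite /= mem_head.
have nalpha : null_weights alpha by apply/null_weights_cvg.
have e2 : 0 < e / 2 by rewrite divr_gt0.
have [W' mW' W'P] := weighted_slopes_mixed k x0 z nalpha e2.
have [V mV VW] := mixed_directed mW mW'.
exists V => // h hV q; rewrite inE => /orP[/eqP ->|qs]; last first.
  by apply: WP qs => psi psi1; have [] := VW _ (hV psi psi1).
rewrite pE; apply: (@le_lt_trans _ _ (e / 2)); last first.
  by rewrite ltr_pdivrMr// ltr_pMr// ltr1n.
apply: weighted_slopes_le => n.
have [psi psi1 psih] := norming_dual (weighted_difference alpha z h n).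
rewrite -rnorm_weighted_difference ?nalpha.1// (le_trans psih)//.
rewrite -dual_comp_weighted_difference ?nalpha.1//.
apply: le_trans (le_weighted_slopes _ nalpha _ n) _; apply: W'P.
by have [] := VW _ (hV psi psi1).
Qed.

Lemma lip0_sumE (I : Type) (s : seq I) (a : I -> K) (g : I -> L) x :
  (\sum_(i <- s) a i *: g i : L) x = \sum_(i <- s) a i * g i x.
Proof. by elim: s => [|i s IH]; rewrite ?big_nil// !big_cons -IH. Qed.

(** The operator [psi |-> psi o f] belongs to the [eps]-product, and a tensor that is
    close to it on the unit ball of [F'] comes from a finite-rank map close to [f]. *)
Lemma eps_dense_finite_rank_dense :
  (forall F : completeNormedModType K, dense (eps_tensor (lip0_mixed k x0) F)) ->
  forall F : completeNormedModType K,
    dense (lip0_finite_rank x0 F : set (lip0_gamma_tau x0 F)).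
Proof.
move=> epsd F; apply/dense_closure => f A /lcs_nbhsP[_ [s [e [sP e0 ->]]] sA].
have [W mW WP] := gamma_tau_scalar sP e0.
have ufP : (dual_comp (f : lip0 x0 F) : dual F -> L) \in
    (@continuous_linear K (dualc F) (lip0_mixed k x0)).
  by apply/mem_set; exact: dual_comp_continuous.
pose D := [set psi : dual F | dual_norm psi <= 1].
have bD : bounded_set D.
  by apply/bounded_setP; exists 1 => // psi; rewrite rnorm_dual.
have /dense_closure/(_ (SigSub ufP)) clt := epsd F.
have [w [n [g [v wE]]] wP] :=
  closure_family clt bD (entourage_inv (lcs_entourage_base (B := mixed_base k x0) mW)).
have [h hE] := rank_one_sum_lip0 g v.
exists h; split; first exact: rank_one_sum_finite_rank hE.
have -> : h = (f : lip0 x0 F) + (h - (f : lip0 x0 F)) by rewrite addrC subrK.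
apply: sA; apply: WP => psi psi1; rewrite dual_compB.
have := wP psi psi1; rewrite wE /=.
have -> // : dual_comp h psi = \sum_(i < n) psi (v i) *: g i.
apply: val_inj; apply/funext => x; rewrite [RHS]lip0_sumE /= hE linear_sum /=.
by apply: eq_bigr => i _; rewrite linearZ /= [RHS]mulrC.
Qed.

Lemma lipfree_delta_subproof (x : X) : @delta R k X x0 x \in lipfree_pred k x0.
Proof.
apply/mem_set/subset_closure; apply: (@sub_linear_hull _ _ (range (@delta R k X x0))).
by exists x.
Qed.

Definition lipfree_delta (x : X) : lipfree k x0 := Lipfree (lipfree_delta_subproof x).

Lemma lipfree_delta_lip : lipfree_delta \in lip0_pred x0 (lipfree k x0).
Proof.
apply/mem_set; split.
  by apply: val_inj; apply: val_inj; apply/funext => f; exact: lip0_base.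
exists 1 => x y; rewrite mul1r rnorm_lipfree; apply: dual_norm_leP; first exact: mdist_ge0.
by move=> f; rewrite rnorm_lip0 mulrC; exact: lip_norm_ub.
Qed.

(** The canonical embedding of [X] in its free space *)
Definition delta_lip : lip0 x0 (lipfree k x0) := Lip0 lipfree_delta_lip.

Lemma lipfree_functional (f : L) : exists phi : dual (lipfree k x0),
  (forall m, phi m = lipfree_val m f) /\ dual_norm phi <= lip_norm f.
Proof.
have [||phi phiE phif] := @dual_of_bounded R k (lipfree k x0)
    (fun m => lipfree_val m f) (lip_norm f) _ (lip_norm_ge0 f).
- by move=> a m m'.
- by move=> m; have := lipfree_eval_le m 0 f; rewrite !subr0 mulrC.
- by exists phi.
Qed.

Lemma dual_comp_delta_lip (f : L) (phi : dual (lipfree k x0)) :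
  (forall m, phi m = lipfree_val m f) -> dual_comp delta_lip phi = f.
Proof. by move=> phiE; apply: val_inj; apply/funext => x; exact: phiE. Qed.

Lemma lipfree_norm_le (m : lipfree k x0) (r : R) :
  (forall f : L, lip_norm f <= 1 -> rnorm (lipfree_val m f : K^o) <= r) -> rnorm m <= r.
Proof.
move=> mr; rewrite rnorm_lipfree; apply: ge_sup.
  by exists (rnorm (lipfree_val m 0 : K^o)); exists 0 => //; rewrite /= rnorm0.
by move=> _ [f /= f1 <-]; apply: mr; rewrite -rnorm_lip0.
Qed.

(** The embedding of [X] is approximated by a finite-rank [h], and [h] extends
    linearly to the free space. The values at [f] of the extension and of the identity
    are those of a member of [C] at functions that are close for the mixed topology,
    and so are close uniformly on [C]. *)
Lemma finite_rank_dense_lipfree_ap :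
  (forall F : completeNormedModType K,
    dense (lip0_finite_rank x0 F : set (lip0_gamma_tau x0 F))) ->
  approximation_property (lipfree k x0).
Proof.
move=> frd; apply: family_closure.
- by exists set0; split; [split=> // u v l; rewrite !inE|exact: compact0].
- exact: abs_convex_compact_directed.
move=> C E [_ cC]; rewrite -entourage_ballE => -[e /= e0 eE].
have r0 := real_of_gt0 e0.
have r2 : 0 < real_of e / 2 by rewrite divr_gt0.
have [W mW WC] := lipfree_compact_mixed cC r2.
have [alpha [z [nalpha zW]]] := mixed_nbhs_weighted mW.
have [A mA Az] := weighted_slopes_nbhs x0 (lipfree k x0) z nalpha ltr01.
have /dense_closure/(_ delta_lip) := frd (lipfree k x0).
move=> /(_ [set h : lip0 x0 (lipfree k x0) | weighted_slopes alpha z (h - delta_lip) < 1]).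
case=> [|h [[s hs] /= hz]].
  apply/lcs_nbhsP; exists A => // w Aw /=.
  rewrite -[X in weighted_slopes _ _ X]/(delta_lip + w - delta_lip) addrAC subrr add0r.
  exact: Az.
have [t tP] := hull_projection s.
have hP x : \sum_(p <- t) p.1 (h x) *: p.2 = h x.
  by apply: tP; rewrite -hs; apply: (@sub_linear_hull _ _ (range h)); exists x.
have /choice[phi phiP] : forall p : dual (lipfree k x0) * lipfree k x0,
    exists phi : dual (lipfree k x0), forall m, phi m = lipfree_val m (dual_comp h p.1).
  by move=> p; have [phi [phiE _]] := lipfree_functional (dual_comp h p.1); exists phi.
pose T (m : lipfree k x0) := \sum_(i < size t)
  phi (tnth (in_tuple t) i) m *: (tnth (in_tuple t) i).2.
have Tclin : T \in (@continuous_linear K (lipfree k x0) (lipfree k x0)).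
  exact/mem_set/rank_one_sum_continuous_linear.
exists (SigSub Tclin).
  by exists (size t), (fun i => phi (tnth (in_tuple t) i)), (fun i => (tnth (in_tuple t) i).2).
move=> m Cm; apply: eE; rewrite -[e]real_ofK ?ltW//; apply/ball_rnorm.
apply: (@le_lt_trans _ _ (real_of e / 2)); last by rewrite ltr_pdivrMr// ltr_pMr// ltr1n.
apply: lipfree_norm_le => f f1; have [psi [psiE psif]] := lipfree_functional f.
have Tf : lipfree_val (T m) f = lipfree_val m (dual_comp h psi).
  have -> : dual_comp h psi = \sum_(p <- t) psi p.2 *: dual_comp h p.1.
    apply: val_inj; apply/funext => x; rewrite [RHS]lip0_sumE /= -{1}(hP x) linear_sum /=.
    by apply: eq_bigr => p _; rewrite linearZ /= [RHS]mulrC.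
  rewrite -psiE /T linear_sum linear_sum (big_tnth _ _ t) /=; apply: eq_bigr => i _.
  by rewrite !linearZ /= phiP [LHS]mulrC.
rewrite -[X in rnorm X]/(lipfree_val m f - lipfree_val (T m) f) Tf.
rewrite -{1}(dual_comp_delta_lip psiE) -linearB /= -dual_compB.
apply: WC => //; apply: zW.
apply: le_lt_trans (weighted_slopes_dual_comp _ _ _ nalpha) _.
have sw := @weighted_slopes_seminorm R k X x0 (lipfree k x0) alpha z nalpha.
apply: (@le_lt_trans _ _ (weighted_slopes alpha z (delta_lip - h))).
  by rewrite ler_piMl ?(seminorm_ge0 _ sw)// (le_trans psif).
by rewrite -opprB -scaleN1r sw.2 rnormN1 mul1r.
Qed.

(** The adjoint of a finite-rank operator on the free space is of finite rank
    on [Lip_0(X)], with functionals given by points of the free space. A slope of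
    [f - S' f] is the value of [f] at [c - S c] for an elementary molecule [c], and
    the molecules times null weights lie in a compact set. *)
Lemma lipfree_ap_mixed_ap :
  approximation_property (lipfree k x0) -> approximation_property (lip0_mixed k x0).
Proof.
move=> ap; apply: family_closure.
- by exists set0; split; [split=> // u v l; rewrite !inE|exact: compact0].
- exact: abs_convex_compact_directed.
move=> A E [_ cA] [W mW WE].
have [alpha [z [nalpha zW]]] := mixed_nbhs_weighted mW.
have [M AM] := mixed_compact_bounded cA.
have M1 : 0 < `|M| + 1 by rewrite ltr_wpDl.
have [C cC Cz] := weighted_difference_hull z delta_lip nalpha.
pose r := (`|M| + 1)^-1 / 2; have r0 : 0 < r by rewrite divr_gt0 ?invr_gt0.
have rK : 0 < of_real k r by rewrite -of_real0 ltr_of_real.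
have [S [n [phi [v SE]]] SP] := closure_family ap cC (entourage_ball _ (PosNum rK)).
have [lS _] := set_valP S.
have /choice[psi psiP] : forall i : 'I_n, exists psi : dual (lip0_mixed k x0),
    forall f : L, psi f = lipfree_val (v i) f.
  by move=> i; exact: lipfree_mixed_dual.
pose T (f : lip0_mixed k x0) : lip0_mixed k x0 :=
  \sum_(i < n) psi i f *: (dual_comp delta_lip (phi i) : lip0_mixed k x0).
have Tclin : T \in (@continuous_linear K (lip0_mixed k x0) (lip0_mixed k x0)).
  exact/mem_set/rank_one_sum_continuous_linear.
exists (SigSub Tclin).
  by exists n, psi, (fun i => dual_comp delta_lip (phi i)).
move=> f Af; apply: WE; apply: zW.
have [hat [hatE hatf]] := lipfree_functional (f : L).
have TE x : (T f : L) x = hat (set_val S (lipfree_delta x)).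
  rewrite [LHS]lip0_sumE SE linear_sum /=; apply: eq_bigr => i _.
  by rewrite linearZ /= hatE psiP [RHS]mulrC.
apply: (@le_lt_trans _ _ 2^-1); last by rewrite invf_lt1// ltr1n.
apply: weighted_slopes_le => j.
pose c := weighted_difference alpha z delta_lip j.
have a0 := nalpha.1 j.
rewrite -rnorm_weighted_difference//.
have -> : weighted_difference alpha z ((f : L) - (T f : L)) j = hat (c - set_val S c).
  have SL a (x y : lipfree k x0) : set_val S (a *: x + y) = a *: set_val S x + set_val S y.
    exact: lS.
  have SB (x y : lipfree k x0) : set_val S (x - y) = set_val S x - set_val S y.
    by have := SL (-1) y x; rewrite !scaleN1r ![- _ + _]addrC.
  have SZ a (x : lipfree k x0) : set_val S (a *: x) = a *: set_val S x.
    have S0 : set_val S 0 = 0 by have := SB 0 0; rewrite !subrr.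
    by have := SL a x 0; rewrite S0 !addr0.
  rewrite /c /weighted_difference SZ SB -scalerBr linearZ; congr (_ *: _).
  set x := (z j).1; set y := (z j).2.
  rewrite -[LHS]/(((f : L) x - (T f : L) x) - ((f : L) y - (T f : L) y)) !TE.
  have fE x' : (f : L) x' = hat (lipfree_delta x') by rewrite hatE.
  by rewrite !fE -!linearB subrACA.
apply: le_trans (dual_norm_le _ _) _.
have /ball_rnorm /= cS := SP c (Cz j).
apply: (@le_trans _ _ ((`|M| + 1) * r)).
  rewrite ler_pM ?dual_norm_ge0 ?rnorm_ge0 ?(ltW cS)//.
  rewrite (le_trans hatf)// (le_trans (AM _ Af))//.
  by rewrite (le_trans (ler_norm _))// lerDl.
by rewrite /r mulrA divff ?mul1r// gt_eqF.
Qed.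

End equivalences.

Theorem corollary4p6 (R : realType) (k : scalar_kind) (X : metricType R) (x0 : X) :
  [<-> approximation_property (lip0_mixed k x0);
       approximation_property (lipfree k x0);
       forall F : completeNormedModType (scalar_field R k),
         dense (eps_tensor (lip0_mixed k x0) F);
       forall F : completeNormedModType (scalar_field R k),
         dense (lip0_finite_rank x0 F : set (lip0_gamma_tau x0 F))].
Proof.
have i_iii := @mixed_ap_eps_dense R k X x0.
have iii_iv := @eps_dense_finite_rank_dense R k X x0.
have iv_ii := @finite_rank_dense_lipfree_ap R k X x0.
have ii_i := @lipfree_ap_mixed_ap R k X x0.
tfae=> [ap|ap|epsd|frd].
- exact/iv_ii/iii_iv/i_iii.
- exact/i_iii/ii_i.
- exact: iii_iv.
- exact/ii_i/iv_ii.
Qed.
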